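(* Assume $\operatorname{Re} a_k>0$ for all $k=1,\dots,m$. Then the difference operator $$\mathcal L f(s)=A(s)f(s+i)-\bigl(A(s)+B(s)\bigr)f(s)+B(s)f(s-i),$$ defined on the domain $\mathcal H[w]$, is symmetric in $L^2(\mathbb R,w(s)\,ds)$, i.e. $\langle \mathcal L f,g\rangle=\langle f,\mathcal L g\rangle$ for all $f,g\in\mathcal H[w]$.
   Context: Here $i$ is the imaginary unit, $c\in\mathbb R$, $a_1,\dots,a_m,b_1,\dots,b_n\in\mathbb C$, and $$\mu(s)=e^{cs}\frac{\prod_{k=1}^m\Gamma(a_k+is)}{\prod_{l=1}^n\Gamma(b_l+is)},\qquad \nu(s)=\overline{\mu(\overline s)}=e^{cs}\frac{\prod_{k=1}^m\Gamma(\overline a_k-is)}{\prod_{l=1}^n\Gamma(\overline b_l-is)},$$ $$w(s)=\frac1{2\pi}\mu(s)\nu(s),$$ $$A(s)=\frac{\nu(s+i)}{\nu(s)}=e^{ic}\frac{\prod_{k}(\overline a_k-is)}{\prod_{l}(\overline b_l-is)},\qquad B(s)=\frac{\mu(s-i)}{\mu(s)}=e^{-ic}\frac{\prod_{k}(a_k+is)}{\prod_{l}(b_l+is)}.$$ The inner product is $\langle f,g\rangle=\int_{-\infty}^{\infty}f(s)\overline{g(s)}\,w(s)\,ds$. Put $$\Psi(s)=|s|^{\sum_k(2\operatorname{Re}a_k-1)-\sum_l(2\operatorname{Re}b_l-1)}\exp\bigl(2c\operatorname{Re}s+(n-m)\pi|\operatorname{Re}s|\bigr),$$ which describes the order of growth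 of $|w(s)|$ in strips. A function is called holomorphic in the closed strip $|\operatorname{Im}s|\le1$ if it is holomorphic in $|\operatorname{Im}s|<1+\delta$ for some $\delta>0$. $\mathcal H[w]$ is the space of functions $f$ holomorphic in the closed strip $|\operatorname{Im} s|\le 1$ such that, for some $\varepsilon>0$, $f(s)=O\bigl(\Psi(s)^{-1/2}|s|^{-m-1/2-\varepsilon}\bigr)$ as $s\to\infty$ in this strip. *)

(* Defs.v *)
From HB Require Import structures.
From mathcomp Require Import all_boot all_order all_algebra.
From mathcomp Require Import all_classical all_reals all_analysis.
From mathcomp Require Import complex.

Set Implicit Arguments.
Unset Strict Implicit.
Unset Printing Implicit Defensive.

Import Order.TTheory GRing.Theory Num.Theory.
Import numFieldNormedType.Exports.

Local Open Scope classical_set_scope.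
Local Open Scope ring_scope.
Local Open Scope complex_scope.

Local Notation Re := complex.Re.
Local Notation Im := complex.Im.

(* [normc z : R] is the modulus of [z] as a real number; [`|z|] lives in
   [R[i]]. *)
Local Notation normc := Normc.normc.

Definition cexp (R : realType) (z : R[i]) : R[i] :=
  (expR (Re z) * cos (Im z)) +i* (expR (Re z) * sin (Im z)).

(* Euler's limit
     Gamma(z) = lim_n  n! n^z / (z (z + 1) ... (z + n)),
   valid on the whole plane minus the poles 0, -1, -2, ...  Since [0^-1 = 0],
   the value at a pole is 0, so that [(cGamma z)^-1] is the entire function
   1 / Gamma, zeros included. *)
Definition cGamma (R : realType) (z : R[i]) : R[i] :=
  lim ((fun n : nat =>
     n`!%:R * cexp (z * (ln n%:R)%:C) / \prod_(k < n.+1) (z + k%:R)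
       : R[i]^o) @ \oo).

Definition mu (R : realType) (m n : nat) (c : R)
    (a : 'I_m -> R[i]) (b : 'I_n -> R[i]) (s : R[i]) : R[i] :=
  cexp (c%:C * s) *
  ((\prod_(k < m) cGamma (a k + 'i * s)) /
   (\prod_(l < n) cGamma (b l + 'i * s))).

Definition nu (R : realType) (m n : nat) (c : R)
    (a : 'I_m -> R[i]) (b : 'I_n -> R[i]) (s : R[i]) : R[i] :=
  (mu c a b s^*)^*.

Definition weight (R : realType) (m n : nat) (c : R)
    (a : 'I_m -> R[i]) (b : 'I_n -> R[i]) (s : R[i]) : R[i] :=
  (2 * pi)^-1%:C * (mu c a b s * nu c a b s).

(* The rational functions continuing nu(s + i) / nu(s) and mu(s - i) / mu(s). *)
Definition coefA (R : realType) (m n : nat) (c : R)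
    (a : 'I_m -> R[i]) (b : 'I_n -> R[i]) (s : R[i]) : R[i] :=
  cexp ('i * c%:C) *
  ((\prod_(k < m) ((a k)^* - 'i * s)) / (\prod_(l < n) ((b l)^* - 'i * s))).

Definition coefB (R : realType) (m n : nat) (c : R)
    (a : 'I_m -> R[i]) (b : 'I_n -> R[i]) (s : R[i]) : R[i] :=
  cexp (- ('i * c%:C)) *
  ((\prod_(k < m) (a k + 'i * s)) / (\prod_(l < n) (b l + 'i * s))).

Definition opL (R : realType) (m n : nat) (c : R)
    (a : 'I_m -> R[i]) (b : 'I_n -> R[i]) (f : R[i] -> R[i]) (s : R[i])
    : R[i] :=
  coefA c a b s * f (s + 'i) - (coefA c a b s + coefB c a b s) * f s
  + coefB c a b s * f (s - 'i).

Definition Psi (R : realType) (m n : nat) (c : R)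
    (a : 'I_m -> R[i]) (b : 'I_n -> R[i]) (s : R[i]) : R :=
  normc s `^ (\sum_(k < m) (2 * Re (a k) - 1) - \sum_(l < n) (2 * Re (b l) - 1))
  * expR (2 * c * Re s + (n%:R - m%:R) * pi * `|Re s|).

(* [derivable f z 1], with [R[i]] as scalar field, is complex
   differentiability at [z]. *)
Definition holomorphic_on (R : realType) (U : set R[i]) (f : R[i] -> R[i]) :=
  forall z, U z -> derivable (f : R[i]^o -> R[i]^o) z 1.

Definition holomorphic_closed_strip (R : realType) (f : R[i] -> R[i]) :=
  exists2 delta : R, 0 < delta &
    holomorphic_on [set z | `|Im z| < 1 + delta] f.

Definition spaceH (R : realType) (m n : nat) (c : R)
    (a : 'I_m -> R[i]) (b : 'I_n -> R[i]) : set (R[i] -> R[i]) :=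
  [set f | holomorphic_closed_strip f /\
    exists2 eps : R, 0 < eps &
    exists K M : R, forall s : R[i], `|Im s| <= 1 -> M <= normc s ->
      normc (f s) <=
      K * (Psi c a b s `^ (- 2^-1) * normc s `^ (- m%:R - 2^-1 - eps))].

Definition Cintegral (R : realType) (h : R -> R[i]) : R[i] :=
  Rintegral lebesgue_measure setT (fun x => Re (h x))
  +i* Rintegral lebesgue_measure setT (fun x => Im (h x)).

Definition inner (R : realType) (w f g : R[i] -> R[i]) : R[i] :=
  Cintegral (fun x : R => f x%:C * (g x%:C)^* * w x%:C).

(* Membership in L^2(R, w(s) ds) of the restriction of [f] to the real line,
   for a weight [w] that is real and nonnegative there. *)
Definition inL2 (R : realType) (w f : R[i] -> R[i]) : Prop :=
  [/\ measurable_fun [set: R] (fun x : R => Re (f x%:C)),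
      measurable_fun [set: R] (fun x : R => Im (f x%:C)) &
      (@lebesgue_measure R).-integrable [set: R]
        (fun x : R => (normc (f x%:C) ^+ 2 * Re (w x%:C))%:E)].

(* The first clause says that [T], with domain [D], is an operator in L^2(w);
   it makes all the integrals in the second clause converge, so that their
   equality never compares default values of the total integral. *)
Definition symmetric_in_L2 (R : realType) (w : R[i] -> R[i])
    (D : set (R[i] -> R[i])) (T : (R[i] -> R[i]) -> (R[i] -> R[i])) : Prop :=
  (forall f, D f -> inL2 w f /\ inL2 w (T f)) /\
  (forall f g, D f -> D g -> inner w (T f) g = inner w f (T g)).

(* Main.v *)
From mathcomp Require Import all_boot all_order all_algebra.
From mathcomp Require Import all_classical all_reals all_analysis.
From mathcomp Require Import complex.
From mathcomp Require Import measurable_realfun ring lra.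
Require Import Defs.

(** Write [mu] for the factor of the weight, so that [w = mu nu / (2 pi)] with
    [nu z = conj (mu (conj z))], and put [g* z = conj (g (conj z))].  Off the
    finitely many real poles, [A nu] is [nu (. + i)] and [B mu] is
    [mu (. - i)].  Hence the terms of [<L f, g>] and [<f, L g>] containing [A]
    and [B] are integrals over [R] and over [R - i] of the functions
    [f (z + i) g* z mu z nu (z + i)] and [f z g* (z + i) mu z nu (z + i)], and
    Cauchy's theorem on the strip [-1 <= Im z <= 0] exchanges them; the term in
    [A + B] is symmetric because [A + B] is real on [R].

    Decay in the strip comes from a two-sided Stirling estimate of [|Gamma|],
    obtained by applying the trapezoidal rule to the logarithm of Euler's
    product.  Cauchy's theorem is used only for the Euler approximants of
    [Gamma] and [1 / Gamma], which are elementary functions, and dominated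
    convergence passes to the limit: holomorphy of [Gamma] is never needed. *)

Set Implicit Arguments.
Unset Strict Implicit.
Unset Printing Implicit Defensive.

Import Order.TTheory GRing.Theory Num.Theory.
Import numFieldNormedType.Exports.

Local Open Scope classical_set_scope.
Local Open Scope ring_scope.
Local Open Scope complex_scope.

Local Notation Re := complex.Re.
Local Notation Im := complex.Im.
Local Notation normc := Normc.normc.

(** The hypothesis [0 < Re (a k)] fixes the strip: for [-1 <= Im z <= 0] the real part of
    [a_k + i z] is at least [Re a_k], so [mu] has no pole there, and the reflection
    [z |-> conj (z + i)] maps this strip to itself, so that [nu (. + i)] inherits the properties of
    [mu]. The decay exponent fits the same picture. On the line [Im z = y] the bound for [mu] gains
    the power [- y (m - n)] over its value on the real line, and the bound for [nu (. + i)] gains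
    [(y + 1) (m - n)]; the product gains [m - n] on every line, and two factors of order
    [- m - 1/2 - eps] bring the exponent below [-1]. The same [m] absorbs the growth of [A] and [B]
    when [L f] is placed in L^2. Two points need care: at a real zero of [b_l + i x] the quotients
    take the default value 0, which touches only finitely many points; and the bounds of [Gamma] and
    [1 / Gamma] on compact sets are proved separately, because an upper bound for one says nothing
    about the other. *)

Local Notation "f '\dat' z" := (derivable (f : _[i]^o -> _[i]^o) z 1)
  (at level 70).

(** * The complex plane *)

Section ComplexModulus.
Context {R : realType}.
Implicit Types x y z : R[i].

Lemma normcD x y : normc (x + y) <= normc x + normc y.
Proof. exact: le_normcD. Qed.

Lemma normc_ge0 z : 0 <= normc z.
Proof. by case: z => a b; rewrite sqrtr_ge0. Qed.

Lemma normc_eq0 z : (normc z == 0) = (z == 0).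
Proof.
by apply/eqP/eqP => [/Normc.eq0_normc //|->]; exact: Normc.normc0.
Qed.

Lemma normc_gt0 z : (0 < normc z) = (z != 0).
Proof. by rewrite lt_def normc_ge0 andbT normc_eq0. Qed.

Lemma normc_norm z : `|z| = (normc z)%:C.
Proof. by []. Qed.

Lemma distcC x y : normc (x - y) = normc (y - x).
Proof. by rewrite -normcN opprB. Qed.

Lemma le_Re_normc z : `|Re z| <= normc z.
Proof.
by case: z => a b /=; rewrite -sqrtr_sqr ler_wsqrtr// lerDl sqr_ge0.
Qed.

Lemma le_Im_normc z : `|Im z| <= normc z.
Proof.
by case: z => a b /=; rewrite -sqrtr_sqr ler_wsqrtr// lerDr sqr_ge0.
Qed.

Lemma normc_real (r : R) : normc r%:C = `|r|.
Proof. by rewrite /= expr0n /= addr0 sqrtr_sqr. Qed.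

Lemma normc_i : normc ('i : R[i]) = 1.
Proof. by rewrite /= expr0n expr1n add0r sqrtr1. Qed.

Lemma normc_le_ReIm z : normc z <= `|Re z| + `|Im z|.
Proof.
rewrite {1}[z]complexE; apply: (le_trans (normcD _ _)).
by rewrite Normc.normcM normc_i mul1r !normc_real.
Qed.

Lemma normc_conj z : normc z^* = normc z.
Proof. by case: z => a b /=; rewrite sqrrN. Qed.

Lemma normc_nat n : normc (n%:R : R[i]) = n%:R.
Proof. by rewrite -(rmorph_nat (real_complex R)) normc_real normr_nat. Qed.

Lemma normc_prod (I : Type) (r : seq I) (P : pred I) (F : I -> R[i]) :
  normc (\prod_(i <- r | P i) F i) = \prod_(i <- r | P i) normc (F i).
Proof.
exact: (big_morph (@normc R) (@Normc.normcM R) (@Normc.normc1 R)).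
Qed.

End ComplexModulus.

(** * Limits and complex derivatives expressed through the real modulus *)

Section ComplexTopology.
Context {R : realType}.
Implicit Types (f : R[i] -> R[i]) (z l : R[i]) (u : nat -> R[i]).

(** Convergence in [R[i]^o] is tested against radii that are themselves complex; a positive element
    of [R[i]] is real, so the real modulus decides it. *)
Lemma cvg_normc u l : (fun n => normc (u n - l)) @ \oo --> (0 : R) ->
  lim ((u : nat -> R[i]^o) @ \oo) = l.
Proof.
move=> ul; apply: cvg_lim => //.
apply/cvgrPdist_lt => e e0.
have [er ei] : 0 < Re e /\ Im e = 0.
  by move: e0; rewrite ltcE => /andP[/eqP -> ?].
move/cvgrPdist_lt : ul => /(_ _ er); apply: filterS => n.
rewrite sub0r normrN ger0_norm ?normc_ge0// => H.
by rewrite distrC normc_norm ltcE /= ei eqxx.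
Qed.

(** Removes the quotient and the complex radii at once; the increment 0 is allowed. The exponential,
    conjugation and Goursat's argument all use this form. *)
Lemma derivable_normc f z : derivable (f : R[i]^o -> R[i]^o) z 1 <->
  exists L, forall e : R, 0 < e -> exists2 d : R, 0 < d &
    forall h, normc h < d -> normc (f (z + h) - f z - L * h) <= e * normc h.
Proof.
split.
  move=> /cvg_ex[L /cvgrPdist_le /= H]; exists L => e e0.
  have eC : 0 < e%:C by rewrite ltcR.
  have := H _ eC; rewrite near_withinE => /nbhs_ballP[d d0 Hd].
  have [dr di] : 0 < Re d /\ Im d = 0.
    by move: d0; rewrite /= ltcE => /andP[/eqP -> ?].
  exists (Re d) => // h hd.
  have [->|h0] := eqVneq h 0.
    by rewrite addr0 mulr0 subrr subr0 (_ : (0 : R[i]) = 0%C)// Normc.normc0 mulr0.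
  have /= := Hd h; rewrite /ball /= sub0r normrN normc_norm ltcE /= di eqxx hd.
  move=> /(_ isT h0).
  rewrite normc_norm lecR distcC => K.
  have -> : f (z + h) - f z - L * h = h * (h^-1 * (f (h * 1 + z) - f z) - L).
    by rewrite mulr1 mulrBr mulrA divff// mul1r (addrC h) (mulrC h L).
  by rewrite Normc.normcM mulrC ler_pM2r// normc_gt0.
move=> [L H]; apply/cvg_ex; exists L; apply/cvgrPdist_le => /= e e0.
have [er ei] : 0 < Re e /\ Im e = 0.
  by move: e0; rewrite ltcE => /andP[/eqP -> ?].
have [d d0 Hd] := H _ er.
rewrite near_withinE; apply/nbhs_ballP; exists d%:C => /=; first by rewrite ltcR.
move=> h; rewrite /ball /= sub0r normrN normc_norm ltcR => hd h0.
rewrite normc_norm lecE /= ei eqxx /=.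
have := Hd _ hd.
have -> : f (z + h) - f z - L * h = h * (h^-1 * (f (h * 1 + z) - f z) - L).
  by rewrite mulr1 mulrBr mulrA divff// mul1r (addrC h) (mulrC h L).
rewrite Normc.normcM mulrC ler_pM2r ?normc_gt0// distcC.
by [].
Qed.

End ComplexTopology.

(** * Second-order estimates for the complex exponential *)

Section ElementaryBounds.
Context {R : realType}.
Implicit Types (x y t : R) (w z h : R[i]).

(** From [exp (- x) >= 1 - x] one gets [exp x <= 1 / (1 - x)], and [(1 - x) (1 + x + 2 x^2) = 1 +
    x^2 (1 - 2 x)]. *)
Lemma expR_le_quad x : `|x| <= 2^-1 -> expR x <= 1 + x + 2 * x ^+ 2.
Proof.
rewrite ler_norml => /andP[x1 x2].
have h : 0 < 1 - x by lra.
have : expR x <= (1 - x)^-1.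
  rewrite -[x]opprK expRN opprK lef_pV2 ?posrE ?expR_gt0//.
  exact: expR_ge1Dx.
move/le_trans; apply.
rewrite -[(1 - x)^-1]mul1r ler_pdivrMr//.
have : 0 <= x ^+ 2 * (1 - 2 * x) by rewrite mulr_ge0 ?sqr_ge0//; lra.
by nra.
Qed.

Lemma norm_sin_le t : `|sin t| <= `|t|.
Proof.
wlog t0 : t / 0 <= t.
  move=> H; have [/H//|/ltW t0] := leP 0 t.
  by rewrite -(normrN t) -(normrN (sin t)) -sinN H// oppr_ge0.
have [c _ /=] := @MVT_segment R sin cos 0 t t0 (fun x _ => is_derive_sin x)
  (continuous_subspaceT (@continuous_sin R)).
rewrite sin0 !subr0 => ->; rewrite normrM ler_piMl//.
exact: cos_max.
Qed.

(** The half-angle formula gives [1 - cos t = 2 sin^2 (t / 2)]. *)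
Lemma cos_ge_quad t : 1 - cos t <= t ^+ 2 / 2.
Proof.
have -> : t = (t / 2) *+ 2 by rewrite -mulr_natr; field.
rewrite cos_mulr2n; set s := t / 2.
have := norm_sin_le s; rewrite -ler_sqr ?nnegrE// !real_normK ?num_real//.
rewrite (sin2cos2 s) => H; rewrite -[s *+ 2]mulr_natr -[_ *+ 2]mulr_natr.
by nra.
Qed.

Lemma norm_sinB_le t : `|t| <= 1 -> `|sin t - t| <= t ^+ 2.
Proof.
wlog t0 : t / 0 <= t.
  move=> H; have [/H//|/ltW t0] := leP 0 t.
  rewrite -(normrN t) => t1.
  have -> : sin t - t = - (sin (- t) - - t) by rewrite sinN; ring.
  by rewrite normrN -sqrrN H// oppr_ge0.
rewrite ger0_norm// => t1.
have [c] := @MVT_segment R sin cos 0 t t0 (fun x _ => is_derive_sin x)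
  (continuous_subspaceT (@continuous_sin R)).
rewrite in_itv/= sin0 !subr0 => /andP[c0 ct] ->.
have -> : cos c * t - t = - ((1 - cos c) * t) by ring.
have c1 : 0 <= 1 - cos c by rewrite subr_ge0 cos_le1.
rewrite normrN ger0_norm ?mulr_ge0// expr2 ler_wpM2r//.
by apply: (le_trans (cos_ge_quad _)); nra.
Qed.

Lemma cexp0 : cexp 0 = 1 :> R[i].
Proof. by rewrite /cexp /= expR0 cos0 sin0 mulr0 mulr1. Qed.

Lemma cexpD w z : cexp (w + z) = cexp w * cexp z.
Proof.
case: w z => a b [c d]; rewrite /cexp /= expRD cosD sinD; simpc.
by congr (_ +i* _); ring.
Qed.

Lemma cexpJ z : (cexp z)^* = cexp z^*.
Proof. by case: z => a b; rewrite /cexp /= cosN sinN mulrN. Qed.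

Lemma normc_cexp z : normc (cexp z) = expR (Re z).
Proof.
case: z => a b; rewrite /cexp /= !exprMn -mulrDr cos2Dsin2 mulr1 sqrtr_sqr.
by rewrite ger0_norm// expR_ge0.
Qed.

Lemma cexp_neq0 z : cexp z != 0.
Proof. by rewrite -normc_gt0 normc_cexp expR_gt0. Qed.

Lemma cexpN z : cexp (- z) = (cexp z)^-1.
Proof.
apply: (mulIf (cexp_neq0 z)); rewrite -cexpD addNr cexp0 mulVf//.
exact: cexp_neq0.
Qed.

(** With [w = x + i y], the real part of the error is at most [2 x^2 + y^2] and the imaginary part
    at most [2 |x| |y| + y^2 <= x^2 + 2 y^2], whence the 3. This yields both the derivative of
    [cexp] and the error of one Euler factor. *)
Lemma cexp_quad w : normc w <= 2^-1 ->
  normc (cexp w - 1 - w) <= 3 * normc w ^+ 2.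
Proof.
move=> w1.
have := le_trans (le_Re_normc w) w1; have := le_trans (le_Im_normc w) w1.
have -> : normc w ^+ 2 = Re w ^+ 2 + Im w ^+ 2.
  by case: w {w1} => a b /=; rewrite sqr_sqrtr// addr_ge0 ?sqr_ge0.
case: w {w1} => x y y1 x1; rewrite /= in y1 x1; rewrite [Re _]/= [Im _]/=.
apply: (le_trans (normc_le_ReIm _)); rewrite /cexp /=.
have e1 := expR_le_quad x1; have e2 := expR_ge1Dx x.
have c1 := cos_ge_quad y; have c2 := cos_le1 y.
have s1 : `|sin y - y| <= y ^+ 2 by apply: norm_sinB_le; lra.
have s2 := norm_sin_le y.
have e0 := expR_gt0 x.
have := x1; rewrite ler_norml => /andP[x2 x3].
have x2n : x ^+ 2 <= `|x| / 2.
  by rewrite -real_normK ?num_real// expr2 ler_wpM2l.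
have e3 : `|expR x - 1| <= 2 * `|x|.
  rewrite ler_norml; have := ler_norm x; have := ler_norm (- x).
  by rewrite normrN => *; apply/andP; split; lra.
have a1 : `|expR x * cos y - 1 - x| <= 2 * x ^+ 2 + y ^+ 2.
  have -> : expR x * cos y - 1 - x = (expR x - 1 - x) - expR x * (1 - cos y).
    by ring.
  have ex2 : expR x <= 2 by have := ler_norm x; nra.
  have : 0 <= expR x * (1 - cos y) <= y ^+ 2.
    by apply/andP; split; nra.
  move=> /andP[? ?]; have := sqr_ge0 x; have := sqr_ge0 y.
  by move=> ? ?; rewrite ler_norml; apply/andP; split; lra.
have a2 : `|expR x * sin y - 0 - y| <= 2 * `|x| * `|y| + y ^+ 2.
  have -> : expR x * sin y - 0 - y = (expR x - 1) * sin y + (sin y - y).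
    by ring.
  apply: (le_trans (ler_normD _ _)); apply: lerD => //.
  by rewrite normrM ler_pM.
have : 2 * `|x| * `|y| <= x ^+ 2 + y ^+ 2.
  rewrite -(real_normK (num_real x)) -(real_normK (num_real y)).
  by have := sqr_ge0 (`|x| - `|y|); nra.
by move: a1 a2; rewrite ?subr0 ?oppr0 ?addr0; lra.
Qed.

End ElementaryBounds.

(** * Closure properties of complex differentiability *)

Section ComplexDerivable.
Context {R : realType}.
Implicit Types (f g : R[i] -> R[i]) (z k l : R[i]).

Lemma derivable_cexp z : (@cexp R) \dat z.
Proof.
apply/derivable_normc; exists (cexp z) => e e0.
exists (Num.min 2^-1 (e / (3 * expR (Re z)))).
  by rewrite lt_min invr_gt0 ltr0n divr_gt0// mulr_gt0 ?expR_gt0.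
move=> h; rewrite lt_min => /andP[/ltW h1 h2].
have -> : cexp (z + h) - cexp z - cexp z * h = cexp z * (cexp h - 1 - h).
  by rewrite cexpD; ring.
rewrite Normc.normcM normc_cexp.
apply: (@le_trans _ _ (expR (Re z) * (3 * normc h ^+ 2))).
  by rewrite ler_pM2l ?expR_gt0// cexp_quad.
rewrite [leLHS](_ : _ = (normc h * (3 * expR (Re z))) * normc h); last by ring.
rewrite ler_wpM2r ?normc_ge0// -ler_pdivlMr ?mulr_gt0 ?expR_gt0//.
exact: ltW.
Qed.

Lemma derivable_mulc f g z :
  f \dat z -> g \dat z -> (fun w => f w * g w) \dat z.
Proof. exact: (@derivableM R[i] R[i]^o f g z 1). Qed.

Lemma derivable_invc f z : f z != 0 -> f \dat z -> (fun w => (f w)^-1) \dat z.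
Proof. exact: (@derivableV R[i] R[i]^o f z 1). Qed.

Lemma derivable_affine k l f z : f \dat (k * z + l) ->
  (fun w => f (k * w + l)) \dat z.
Proof.
move=> /derivable1_diffP df; apply/derivable1_diffP.
have da : differentiable (fun w : R[i]^o => k * w + l : R[i]^o) (z : R[i]^o).
  apply/derivable1_diffP; apply: derivableD; last exact: derivable_cst.
  by apply: derivableM => //; exact: derivable_cst.
exact: (@differentiable_comp R[i] R[i]^o R[i]^o R[i]^o _ f z da df).
Qed.

(** Schwarz reflection: conjugating the remainder at the conjugate point restores complex linearity,
    with the conjugate derivative. *)
Lemma derivable_conj f z : f \dat z^* -> (fun w => (f w^*)^*) \dat z.
Proof.
move=> /derivable_normc[L H]; apply/derivable_normc; exists L^* => e /H[d d0 Hd].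
exists d => // h hd.
have -> : (f (z + h)^*)^* - (f z^*)^* - L^* * h =
    (f (z^* + h^*) - f z^* - L * h^*)^*.
  by rewrite !rmorphB !rmorphM /= conjcK rmorphD.
by rewrite normc_conj -[normc h in leRHS]normc_conj Hd// normc_conj.
Qed.

Lemma derivable_prod (I : Type) (r : seq I) (F : I -> R[i] -> R[i]) z :
  (forall i, F i \dat z) -> (fun w => \prod_(i <- r) F i w) \dat z.
Proof.
move=> dF; elim: r => [|i r ih].
  rewrite (_ : (fun _ => _) = cst 1); last by apply/funext => w; rewrite big_nil.
  exact: (@derivable_cst R[i] R[i]^o).
rewrite (_ : (fun _ => _) = (fun w => F i w * \prod_(j <- r) F j w)).
  exact: (@derivable_mulc (F i) (fun w => \prod_(j <- r) F j w) z (dF i) ih).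
by apply/funext => w; rewrite big_cons.
Qed.

End ComplexDerivable.

(** * Integrals of complex-valued functions *)

Section ComplexIntegral.
Context {R : realType}.
Notation mu := (@lebesgue_measure R).
Implicit Types (D : set R) (h g : R -> R[i]) (k : R[i]) (a b c M : R).

(** On [setT] this is convertible to [Cintegral]; subdomains are needed for the sides of
    rectangles. *)
Definition Cint (D : set R) (h : R -> R[i]) : R[i] :=
  Rintegral mu D (fun x => Re (h x)) +i* Rintegral mu D (fun x => Im (h x)).

Definition cintegrable (D : set R) (h : R -> R[i]) :=
  mu.-integrable D (EFin \o (fun x => Re (h x))) /\
  mu.-integrable D (EFin \o (fun x => Im (h x))).

Lemma eq_Cint D h g : (forall x, D x -> h x = g x) -> Cint D h = Cint D g.
Proof.
by move=> hg; congr (_ +i* _); apply: eq_Rintegral => x /set_mem/hg ->.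
Qed.

Lemma integrableMl D (f : R -> R) r : measurable D ->
  mu.-integrable D (EFin \o f) -> mu.-integrable D (EFin \o (fun x => r * f x)).
Proof.
move=> mD fi; have : mu.-integrable D (fun x => r%:E * (EFin \o f) x)%E.
  exact: integrableZl.
by apply: eq_integrable.
Qed.

Lemma integrableRD D (f1 f2 : R -> R) : measurable D ->
  mu.-integrable D (EFin \o f1) -> mu.-integrable D (EFin \o f2) ->
  mu.-integrable D (EFin \o (fun x => f1 x + f2 x)).
Proof.
move=> mD h1 h2.
have : mu.-integrable D (fun x => (EFin \o f1) x + (EFin \o f2) x)%E.
  exact: integrableD.
by apply: eq_integrable.
Qed.

Lemma cintegrableD D h g : measurable D ->
  cintegrable D h -> cintegrable D g -> cintegrable D (fun x => h x + g x).
Proof.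
move=> mD [h1 h2] [g1 g2]; split.
- have := integrableRD mD h1 g1; apply: eq_integrable => // x _ /=.
  by case: (h x) (g x) => ? ? [].
- have := integrableRD mD h2 g2; apply: eq_integrable => // x _ /=.
  by case: (h x) (g x) => ? ? [].
Qed.

Lemma cintegrableMl D h k : measurable D ->
  cintegrable D h -> cintegrable D (fun x => k * h x).
Proof.
case: k => p q mD [h1 h2]; split.
- have := integrableRD mD (integrableMl p mD h1) (integrableMl (- q) mD h2).
  apply: eq_integrable => // x _ /=; congr EFin.
  by case: (h x) => ? ? /=; rewrite mulNr.
- have := integrableRD mD (integrableMl p mD h2) (integrableMl q mD h1).
  by apply: eq_integrable => // x _ /=; congr EFin; case: (h x).
Qed.

Lemma CintD D h g : measurable D -> cintegrable D h -> cintegrable D g ->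
  Cint D (fun x => h x + g x) = Cint D h + Cint D g.
Proof.
move=> mD [h1 h2] [g1 g2]; rewrite /Cint.
rewrite -[RHS]/((_ + _) +i* (_ + _)) -!RintegralD//.
by congr (_ +i* _); apply: eq_Rintegral => x _; case: (h x) (g x) => ? ? [].
Qed.

Lemma CintMl D h k : measurable D -> cintegrable D h ->
  Cint D (fun x => k * h x) = k * Cint D h.
Proof.
case: k => p q mD [h1 h2]; rewrite /Cint.
rewrite -[RHS]/((_ - _) +i* (_ + _)) -!RintegralZl//.
rewrite -RintegralB -?RintegralD//; try exact: integrableMl.
by congr (_ +i* _); apply: eq_Rintegral => x _; case: (h x) => ? ?.
Qed.

Lemma cintegrableB D h g : measurable D ->
  cintegrable D h -> cintegrable D g -> cintegrable D (fun x => h x - g x).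
Proof.
move=> mD ih ig.
have := cintegrableD mD ih (@cintegrableMl D g (-1) mD ig).
by rewrite (_ : (fun x => _ + _) = (fun x => h x - g x))//; apply/funext => x;
  rewrite mulN1r.
Qed.

Lemma CintB D h g : measurable D -> cintegrable D h -> cintegrable D g ->
  Cint D (fun x => h x - g x) = Cint D h - Cint D g.
Proof.
move=> mD ih ig; have := CintD mD ih (@cintegrableMl D g (-1) mD ig).
rewrite CintMl// mulN1r => <-; apply: eq_Cint => x _.
by rewrite mulN1r.
Qed.

Lemma Cint_cst a b k : a <= b -> Cint `[a, b] (fun=> k) = k * (b - a)%:C.
Proof.
move=> ab; rewrite /Cint !Rintegral_cst//= lebesgue_measure_itv/= lte_fin.
case: k => p q /=.
have [ab'|ba] := ltP a b; simpc => //.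
by have -> : a = b by [apply/le_anti; rewrite ab]; simpc.
Qed.

(** The two components are bounded separately, which costs the factor 2. It is harmless, as the
    bound only serves to show that quantities vanish. *)
Lemma normc_Cint_le D h (g : R -> R) : measurable D ->
  cintegrable D h -> mu.-integrable D (EFin \o g) ->
  (forall x, D x -> normc (h x) <= g x) ->
  normc (Cint D h) <= 2 * Rintegral mu D g.
Proof.
move=> mD [h1 h2] ig hg; apply: (le_trans (normc_le_ReIm _)).
rewrite mulr_natl mulr2n.
apply: lerD; apply: (le_trans (le_normr_Rintegral _ _)) => //;
  apply: le_Rintegral => //.
- by have := integrable_abse h1.
- by move=> x Dx; apply: (le_trans (le_Re_normc _)); exact: hg.
- by have := integrable_abse h2.
- by move=> x Dx; apply: (le_trans (le_Im_normc _)); exact: hg.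
Qed.

Lemma integrable_itv_cst a b M : mu.-integrable `[a, b] (EFin \o (fun=> M)).
Proof.
apply: continuous_compact_integrable; first exact: segment_compact.
by apply: continuous_subspaceT => x; exact: cvg_cst.
Qed.

Lemma normc_Cint_itv_le a b h M : a <= b -> cintegrable `[a, b] h ->
  (forall x, a <= x <= b -> normc (h x) <= M) ->
  normc (Cint `[a, b] h) <= 2 * (M * (b - a)).
Proof.
move=> ab ih hM.
have -> : M * (b - a) = Rintegral mu `[a, b] (fun=> M).
  rewrite Rintegral_cst//= lebesgue_measure_itv/= lte_fin.
  have [//|ba] := ltP a b.
  by have -> : a = b by [apply/le_anti; rewrite ab]; rewrite subrr.
apply: normc_Cint_le => //; first exact: integrable_itv_cst.
Qed.

Lemma Rintegral_itv_split (f : R -> R) a b c : a <= b -> b <= c ->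
  mu.-integrable `[a, c] (EFin \o f) ->
  Rintegral mu `[a, c] f = Rintegral mu `[a, b] f + Rintegral mu `[b, c] f.
Proof.
move=> ab bc fi.
have := @Rintegral_itvB R f (BLeft a) (BRight c) b fi.
rewrite !bnd_simp => /(_ ab bc) H.
rewrite -[LHS](subrK (Rintegral mu `[a, b] f)) H addrC.
congr (_ + _); rewrite Rintegral_itv_obnd_cbnd//.
by apply: integrableS fi => //; apply: subset_itv; rewrite ?bnd_simp.
Qed.

Lemma Cint_split h a b c : a <= b -> b <= c -> cintegrable `[a, c] h ->
  Cint `[a, c] h = Cint `[a, b] h + Cint `[b, c] h.
Proof.
move=> ab bc [h1 h2]; rewrite /Cint -[RHS]/((_ + _) +i* (_ + _)).
by congr (_ +i* _); apply: Rintegral_itv_split.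
Qed.

End ComplexIntegral.

(** * Cauchy's theorem on rectangles *)

Section Goursat.
Context {R : realType}.
Notation mu := (@lebesgue_measure R).
Implicit Types (F G : R[i] -> R[i]) (x y w h : R) (z k L : R[i]).

Lemma derivable_continuous_normc F z : F \dat z ->
  forall e : R, 0 < e -> exists2 d : R, 0 < d &
    forall v, normc (v - z) < d -> normc (F v - F z) < e.
Proof.
move=> /derivable_normc[L H] e e0; have [d d0 Hd] := H _ ltr01.
have L0 : 0 < 1 + normc L by rewrite ltr_pwDl// normc_ge0.
exists (Num.min d (e / (1 + normc L))).
  by rewrite lt_min d0 divr_gt0.
move=> v; rewrite lt_min => /andP[vd ve].
have := Hd _ vd; rewrite [z + _]addrC subrK mul1r => K.
have -> : F v - F z = (F v - F z - L * (v - z)) + L * (v - z) by ring.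
apply: (le_lt_trans (normcD _ _)); rewrite Normc.normcM.
apply: (@le_lt_trans _ _ ((1 + normc L) * normc (v - z))).
  by rewrite mulrDl mul1r lerD2r.
by rewrite mulrC -ltr_pdivlMr.
Qed.

(** Being 1-Lipschitz is all that horizontal and vertical segments need to share the same continuity
    and integrability proofs. *)
Definition short_path (g : R -> R[i]) :=
  forall s t, normc (g s - g t) <= `|s - t|.

Lemma short_path_h y : short_path (fun t => t +i* y).
Proof. by move=> s t; simpc; rewrite complexr0 normc_real. Qed.

Lemma short_path_v x : short_path (fun t => x +i* t).
Proof.
by move=> s t; simpc; rewrite /= expr0n/= add0r sqrtr_sqr.
Qed.

Lemma ReB (u v : R[i]) : Re (u - v) = Re u - Re v.
Proof. by case: u v => ? ? []. Qed.

Lemma ImB (u v : R[i]) : Im (u - v) = Im u - Im v.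
Proof. by case: u v => ? ? []. Qed.

Lemma continuous_path F (g : R -> R[i]) t : short_path g -> F \dat (g t) ->
  {for t, continuous (fun s => Re (F (g s)))} /\
  {for t, continuous (fun s => Im (F (g s)))}.
Proof.
move=> gl dF; have H := derivable_continuous_normc dF.
split; apply/cvgrPdist_lt => e /H[d d0 Hd]; apply/nbhs_ballP; exists d => //= s;
  rewrite /ball/= distrC => st;
  have := Hd (g s) (le_lt_trans (gl _ _) st); apply: le_lt_trans.
- by rewrite /= distrC -ReB le_Re_normc.
- by rewrite /= distrC -ImB le_Im_normc.
Qed.

Lemma cintegrable_path F (g : R -> R[i]) a b : short_path g ->
  (forall t, a <= t <= b -> F \dat (g t)) ->
  cintegrable `[a, b] (fun t => F (g t)).
Proof.
move=> gl dF; split; apply: continuous_compact_integrable;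
  try exact: segment_compact; apply: continuous_in_subspaceT => t;
  rewrite inE/= in_itv/= => /dF/(continuous_path gl)[]//.
Qed.

(** The counterclockwise contour integral around the rectangle with lower left corner [x + i y]:
    bottom minus top, plus right minus left with [dz = i dt]. *)
Definition rect_int F x y w h : R[i] :=
  (Cint `[x, x + w] (fun t => F (t +i* y)) -
   Cint `[x, x + w] (fun t => F (t +i* (y + h)))) +
  'i * (Cint `[y, y + h] (fun t => F ((x + w) +i* t)) -
        Cint `[y, y + h] (fun t => F (x +i* t))).

Definition in_rect x y w h z :=
  x <= Re z <= x + w /\ y <= Im z <= y + h.

Lemma in_rectS x y w h x' y' w' h' z : x <= x' -> x' + w' <= x + w ->
  y <= y' -> y' + h' <= y + h -> in_rect x' y' w' h' z -> in_rect x y w h z.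
Proof.
by move=> ? ? ? ? [/andP[? ?] /andP[? ?]]; split; apply/andP; split; lra.
Qed.

Lemma rect_integrable F x y w h : 0 <= w -> 0 <= h ->
  (forall z, in_rect x y w h z -> F \dat z) ->
  [/\ cintegrable `[x, x + w] (fun t => F (t +i* y)),
      cintegrable `[x, x + w] (fun t => F (t +i* (y + h))),
      cintegrable `[y, y + h] (fun t => F ((x + w) +i* t)) &
      cintegrable `[y, y + h] (fun t => F (x +i* t))].
Proof.
move=> w0 h0 dF; split.
- apply: (@cintegrable_path F _ _ _ (short_path_h y)) => t /andP[? ?].
  by apply: dF; split => /=; apply/andP; split; lra.
- apply: (@cintegrable_path F _ _ _ (short_path_h (y + h))) => t /andP[? ?].
  by apply: dF; split => /=; apply/andP; split; lra.
- apply: (@cintegrable_path F _ _ _ (short_path_v (x + w))) => t /andP[? ?].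
  by apply: dF; split => /=; apply/andP; split; lra.
- apply: (@cintegrable_path F _ _ _ (short_path_v x)) => t /andP[? ?].
  by apply: dF; split => /=; apply/andP; split; lra.
Qed.

Lemma rect_intB F G x y w h : 0 <= w -> 0 <= h ->
  (forall z, in_rect x y w h z -> F \dat z) ->
  (forall z, in_rect x y w h z -> G \dat z) ->
  rect_int (fun z => F z - G z) x y w h =
  rect_int F x y w h - rect_int G x y w h.
Proof.
move=> w0 h0 /(rect_integrable w0 h0)[f1 f2 f3 f4].
move=> /(rect_integrable w0 h0)[g1 g2 g3 g4].
rewrite /rect_int !CintB//; ring.
Qed.

Lemma derivable_subc F G z : F \dat z -> G \dat z -> (fun v => F v - G v) \dat z.
Proof. exact: (@derivableB R[i] R[i]^o R[i]^o F G z 1). Qed.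

Lemma derivable_linear k L z : (fun v => L * v + k) \dat z.
Proof. exact: (@derivable_affine R L k id z (@derivable_id R[i] R[i]^o _ 1)). Qed.

(** On opposite sides the values differ by a constant: the horizontal pair contributes [- i L h w],
    the vertical pair [i L w h]. *)
Lemma rect_int_linear k L x y w h : 0 <= w -> 0 <= h ->
  rect_int (fun z => L * z + k) x y w h = 0.
Proof.
move=> w0 h0.
have [f1 f2 f3 f4] := @rect_integrable (fun v => L * v + k) x y w h w0 h0
  (fun z _ => @derivable_linear k L z).
rewrite /rect_int -!CintB//.
rewrite (@eq_Cint _ _ _ (fun=> - (L * 'i * h%:C))); last first.
  move=> t _.
  have -> : t +i* (y + h) = t +i* y + 'i * h%:C by simpc.
  by ring.
rewrite [X in 'i * X](@eq_Cint _ _ _ (fun=> L * w%:C)); last first.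
  move=> t _.
  have -> : (x + w) +i* t = x +i* t + w%:C by simpc.
  by ring.
by rewrite !Cint_cst ?lerDl// ![_ + _ - _]addrAC !subrr !add0r; ring.
Qed.

(** Maximum times the perimeter [2 (w + h)], doubled by the loss in [normc_Cint_le]. *)
Lemma rect_int_le F x y w h M : 0 <= w -> 0 <= h ->
  (forall z, in_rect x y w h z -> F \dat z) ->
  (forall z, in_rect x y w h z -> normc (F z) <= M) ->
  normc (rect_int F x y w h) <= 4 * M * (w + h).
Proof.
move=> w0 h0 /(rect_integrable w0 h0)[f1 f2 f3 f4] FM.
have xw : x <= x + w by rewrite lerDl.
have yh : y <= y + h by rewrite lerDl.
have := normc_Cint_itv_le xw f1 (M := M).
have := normc_Cint_itv_le xw f2 (M := M).
have := normc_Cint_itv_le yh f3 (M := M).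
have := normc_Cint_itv_le yh f4 (M := M).
rewrite ![_ + _ - _]addrAC !subrr !add0r => H4 H3 H2 H1.
have {}H1 := H1 (fun t tx => FM (t +i* y) (conj tx _)).
have {}H2 := H2 (fun t tx => FM (t +i* (y + h)) (conj tx _)).
have {}H3 := H3 (fun t tx => FM ((x + w) +i* t) (conj _ tx)).
have {}H4 := H4 (fun t tx => FM (x +i* t) (conj _ tx)).
apply: (le_trans (normcD _ _)); rewrite Normc.normcM normc_i mul1r.
apply: (le_trans (lerD (normcD _ _) (normcD _ _))); rewrite !normcN.
have e1 : y <= y <= y + h by rewrite lexx.
have e2 : y <= y + h <= y + h by rewrite lexx andbT.
have e3 : x <= x + w <= x + w by rewrite lexx andbT.
have e4 : x <= x <= x + w by rewrite lexx.
have := H1 (fun=> e1); have := H2 (fun=> e2); have := H3 (fun=> e3).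
by have := H4 (fun=> e4); lra.
Qed.

(** Each inner side is traversed twice, in opposite directions. *)
Lemma rect_int_split F x y w h : 0 <= w -> 0 <= h ->
  (forall z, in_rect x y w h z -> F \dat z) ->
  rect_int F x y w h =
  rect_int F x y (w / 2) (h / 2) + rect_int F (x + w / 2) y (w / 2) (h / 2) +
  (rect_int F x (y + h / 2) (w / 2) (h / 2) +
   rect_int F (x + w / 2) (y + h / 2) (w / 2) (h / 2)).
Proof.
move=> w0 h0 dF.
have [f1 f2 f3 f4] := rect_integrable w0 h0 dF.
have xw : x + w / 2 + w / 2 = x + w by field.
have yh : y + h / 2 + h / 2 = y + h by field.
have x1 : x <= x + w / 2 by lra.
have x2 : x + w / 2 <= x + w by lra.
have y1 : y <= y + h / 2 by lra.
have y2 : y + h / 2 <= y + h by lra.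
rewrite /rect_int !xw !yh.
rewrite (Cint_split x1 x2 f1) (Cint_split x1 x2 f2).
rewrite (Cint_split y1 y2 f3) (Cint_split y1 y2 f4).
by ring.
Qed.

Lemma rect_int_quarter F x y w h : 0 <= w -> 0 <= h ->
  (forall z, in_rect x y w h z -> F \dat z) ->
  exists p : R * R, [/\ x <= p.1, p.1 + w / 2 <= x + w,
    y <= p.2, p.2 + h / 2 <= y + h &
    normc (rect_int F x y w h) <= 4 * normc (rect_int F p.1 p.2 (w / 2) (h / 2))].
Proof.
move=> w0 h0.
have x1 : x + w / 2 <= x + w by lra.
have x2 : x + w / 2 + w / 2 <= x + w by lra.
have x3 : x <= x + w / 2 by lra.
have y1 : y + h / 2 <= y + h by lra.
have y2 : y + h / 2 + h / 2 <= y + h by lra.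
have y3 : y <= y + h / 2 by lra.
have four (q a b c d : R) : q <= a + b + (c + d) ->
    4 * a < q -> 4 * b < q -> 4 * c < q -> 4 * d < q -> False by lra.
move=> dF; apply: contrapT => /forallNP H.
have K u v : x <= u -> u + w / 2 <= x + w -> y <= v -> v + h / 2 <= y + h ->
    4 * normc (rect_int F u v (w / 2) (h / 2)) < normc (rect_int F x y w h).
  move=> xu ux yv vy; rewrite ltNge; apply/negP => Huv.
  by apply: (H (u, v)); split.
have := K x y; have := K (x + w / 2) y; have := K x (y + h / 2).
have := K (x + w / 2) (y + h / 2).
have := rect_int_split w0 h0 dF.
set Q := rect_int F x y w h; set Q1 := rect_int _ _ _ _ _.
set Q2 := rect_int _ _ _ _ _; set Q3 := rect_int _ _ _ _ _.
set Q4 := rect_int _ _ _ _ _ => QE.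
have T : normc Q <= normc Q1 + normc Q2 + (normc Q3 + normc Q4).
  by rewrite QE; apply: (le_trans (normcD _ _)); apply: lerD; exact: normcD.
move=> /(_ x3 x2 y3 y2) K4 /(_ (lexx _) x1 y3 y2) K3 /(_ x3 x2 (lexx _) y1) K2.
move=> /(_ (lexx _) x1 (lexx _) y1) K1.
exact: (four _ _ _ _ _ T K1 K2 K3 K4).
Qed.

(** Every left end lies below every right end, so the supremum of the left ends lies in all the
    intervals. *)
Lemma nested_point (a : R^nat) (w : R) : 0 <= w ->
  (forall j, a j <= a j.+1) ->
  (forall j, a j.+1 + w / 2 ^+ j.+1 <= a j + w / 2 ^+ j) ->
  exists c, forall j, a j <= c <= a j + w / 2 ^+ j.
Proof.
move=> w0 ai bd.
have am : {homo a : i j / (i <= j)%N >-> i <= j}.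
  by apply: homo_leq => //; exact: le_trans.
have bm : {homo (fun j => a j + w / 2 ^+ j) : i j / (i <= j)%N >-> j <= i}.
  apply: (@homo_leq _ _ (fun x y => y <= x)) => //.
  by move=> y x z ? ?; exact: (@le_trans _ _ y).
have ab i j : a i <= a j + w / 2 ^+ j.
  have p0 n : 0 <= w / 2 ^+ n by rewrite divr_ge0// exprn_ge0.
  have [ij|/ltnW ji] := leqP i j.
    by apply: (le_trans (am _ _ ij)); rewrite lerDl.
  by apply: (@le_trans _ _ (a i + w / 2 ^+ i)); [rewrite lerDl|exact: bm].
exists (sup (range a)) => j; apply/andP; split.
  by apply: ub_le_sup; [exists (a 0%N + w / 2 ^+ 0) => _ [i _ <-]|exists j].
by apply: ge_sup; [exists (a 0%N), 0%N|move=> _ [i _ <-]].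
Qed.

(** Bisection keeps the average of the contour integral over the area, while
    differentiability at the limit point makes it small at small scales. *)
Lemma goursat F x y w h : 0 <= w -> 0 <= h ->
  (forall z, in_rect x y w h z -> F \dat z) -> rect_int F x y w h = 0.
Proof.
move=> w0 h0 dF.
have pw j : 0 <= w / 2 ^+ j by rewrite divr_ge0// exprn_ge0.
have ph j : 0 <= h / 2 ^+ j by rewrite divr_ge0// exprn_ge0.
pose ok j (p : R * R) := [/\ x <= p.1, p.1 + w / 2 ^+ j <= x + w,
  y <= p.2 & p.2 + h / 2 ^+ j <= y + h].
pose step j (p q : R * R) := [/\ p.1 <= q.1,
  q.1 + w / 2 ^+ j.+1 <= p.1 + w / 2 ^+ j, p.2 <= q.2,
  q.2 + h / 2 ^+ j.+1 <= p.2 + h / 2 ^+ j &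
  normc (rect_int F p.1 p.2 (w / 2 ^+ j) (h / 2 ^+ j)) <=
  4 * normc (rect_int F q.1 q.2 (w / 2 ^+ j.+1) (h / 2 ^+ j.+1))].
(* The invariant is a premise under the existential, so that [choice] yields a total function, with
   an arbitrary value off the invariant. *)
have next (jp : nat * (R * R)) :
    exists q, ok jp.1 jp.2 -> ok jp.1.+1 q /\ step jp.1 jp.2 q.
  case: jp => j p /=; have [okp|] := pselect (ok j p); last by exists p.
  have dFp z : in_rect p.1 p.2 (w / 2 ^+ j) (h / 2 ^+ j) z -> F \dat z.
    by case: okp => *; apply: dF; apply: in_rectS; eassumption.
  have [q] := rect_int_quarter (pw j) (ph j) dFp.
  have E u : u / 2 ^+ j / 2 = u / 2 ^+ j.+1 :> R.
    by rewrite exprSr invfM mulrA.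
  rewrite !E => -[q1 q2 q3 q4 q5]; exists q => _; split; last by split.
  by case: okp => *; split; lra.
have /choice[nx Hnx] := next.
pose p := fix p j := if j is i.+1 then nx (i, p i) else (x, y).
have okp j : ok j (p j).
  elim: j => [|j /(Hnx (j, p j))[]//].
  by split; rewrite /= ?expr0 ?divr1.
have stp j : step j (p j) (p j.+1) by have [] := Hnx (j, p j) (okp j).
have [c1 Hc1] : exists c, forall j, (p j).1 <= c <= (p j).1 + w / 2 ^+ j.
  by apply: nested_point => // j; case: (stp j).
have [c2 Hc2] : exists c, forall j, (p j).2 <= c <= (p j).2 + h / 2 ^+ j.
  by apply: nested_point => // j; case: (stp j).
pose Q j := rect_int F (p j).1 (p j).2 (w / 2 ^+ j) (h / 2 ^+ j).
have Qj j : normc (Q 0%N) <= 4 ^+ j * normc (Q j).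
  elim: j => [|j ih]; first by rewrite expr0 mul1r.
  apply: (le_trans ih); rewrite exprSr -mulrA ler_pM2l ?exprn_gt0//.
  by case: (stp j).
have dc : F \dat (c1 +i* c2).
  by apply: dF; have := Hc1 0%N; have := Hc2 0%N; rewrite /= expr0 !divr1.
have [L HL] := (derivable_normc _ _).1 dc.
suff : normc (Q 0%N) <= 0.
  have -> : Q 0%N = rect_int F x y w h by rewrite /Q /= expr0 !divr1.
  by rewrite le_eqVlt normc_eq0 ltNge normc_ge0 orbF => /eqP.
apply/ler_addgt0Pl => e e0; rewrite addr0.
pose s := w + h; have s0 : 0 <= s by rewrite addr_ge0.
(* At level [j] the bound is [4^j * 4 * e' * (s / 2^j) * (s / 2^j) = 4 s^2 e'], since [s = w + h]
   controls both the distance to the limit point and the perimeter. The [+ 1] keeps the denominator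
   positive when [s = 0]. *)
have e'0 : 0 < e / (4 * s ^+ 2 + 1).
  by rewrite divr_gt0// ltr_wpDl// mulr_ge0// sqr_ge0.
have [d d0 Hd] := HL _ e'0.
have [j Hj] : exists j, s / 2 ^+ j < d.
  have [N HN] : exists N : nat, s / d < N%:R.
    by exists (Num.bound (s / d)); apply: archi_boundP; rewrite divr_ge0// ltW.
  exists N; rewrite ltr_pdivrMr ?exprn_gt0// mulrC -ltr_pdivrMr//.
  by apply: (lt_le_trans HN); rewrite -natrX ler_nat ltnW// ltn_expl.
pose z0 := c1 +i* c2.
have rin z : in_rect (p j).1 (p j).2 (w / 2 ^+ j) (h / 2 ^+ j) z -> F \dat z.
  by case: (okp j) => *; apply: dF; apply: in_rectS; eassumption.
have near_z0 z : in_rect (p j).1 (p j).2 (w / 2 ^+ j) (h / 2 ^+ j) z ->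
    normc (z - z0) <= s / 2 ^+ j.
  move=> [/andP[? ?] /andP[? ?]]; apply: (le_trans (normc_le_ReIm _)).
  have /andP[? ?] := Hc1 j; have /andP[? ?] := Hc2 j.
  rewrite /s mulrDl ReB ImB /=.
  by apply: lerD; rewrite ler_norml; apply/andP; split; lra.
(* The tangent map at the limit point has zero contour integral, so subtracting it leaves only the
   remainder of differentiability to estimate. *)
pose A z := L * z + (F z0 - L * z0).
have dA z : A \dat z by exact: (@derivable_linear _ _ z).
have QE : Q j = rect_int (fun z => F z - A z) (p j).1 (p j).2
    (w / 2 ^+ j) (h / 2 ^+ j).
  rewrite (@rect_intB F A _ _ _ _ (pw j) (ph j) rin (fun z _ => dA z)).
  by rewrite (rect_int_linear _ _ _ _ (pw j) (ph j)) subr0.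
have QB : normc (Q j) <=
    4 * (e / (4 * s ^+ 2 + 1) * (s / 2 ^+ j)) * (w / 2 ^+ j + h / 2 ^+ j).
  rewrite QE; apply: (@rect_int_le _ _ _ _ _ _ (pw j) (ph j)) => z zin.
    exact: (@derivable_subc F A z (rin z zin) (dA z)).
  have zz := near_z0 z zin.
  have := Hd (z - z0) (le_lt_trans zz Hj); rewrite [_ + (z - z0)]addrC subrK.
  have -> : F z - A z = F z - F z0 - L * (z - z0) by rewrite /A; ring.
  by move=> /le_trans; apply; rewrite ler_wpM2l// ltW.
apply: (le_trans (Qj j)).
have p2 : 0 < 2 ^+ j :> R by rewrite exprn_gt0.
apply: (@le_trans _ _ (4 ^+ j * (4 * (e / (4 * s ^+ 2 + 1) * (s / 2 ^+ j)) *
   (w / 2 ^+ j + h / 2 ^+ j)))).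
  by rewrite ler_wpM2l// exprn_ge0.
rewrite -mulrDl -/s (_ : 4 = 2 ^+ 2 :> R); last by rewrite expr2; ring.
rewrite -exprM mulnC exprM.
have q0 : 0 < 2 ^+ 2 * s ^+ 2 + 1 :> R.
  by rewrite ltr_wpDl// mulr_ge0// ?sqr_ge0// exprn_ge0.
rewrite [leLHS](_ : _ = e * ((2 ^+ 2 * s ^+ 2) / (2 ^+ 2 * s ^+ 2 + 1))); last first.
  field; rewrite (lt0r_neq0 p2) andbT lt0r_neq0//.
  by rewrite ltr_wpDl// mulr_ge0// sqr_ge0.
by rewrite ler_piMr ?ltW// ltr_pdivrMr// mul1r ltrDl.
Qed.

End Goursat.

(** * Shifting the line of integration *)

Section Bracket.
Context {R : realType}.
Notation mu := (@lebesgue_measure R).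
Implicit Types (x p q eta : R).

(** A substitute for [|x|^p] that is positive and continuous everywhere, the origin included. *)
Definition bracket p x : R := (1 + `|x|) `^ p.

Lemma bracket_base x : 0 < 1 + `|x|.
Proof. by rewrite ltr_pwDl. Qed.

Lemma bracket_gt0 p x : 0 < bracket p x.
Proof. by rewrite powR_gt0// bracket_base. Qed.

Lemma bracketD p q x : bracket (p + q) x = bracket p x * bracket q x.
Proof. by rewrite /bracket powRD// lt0r_neq0 ?bracket_base ?implybT. Qed.

Lemma bracket_le p q x : p <= q -> bracket p x <= bracket q x.
Proof. by move=> pq; apply: ler_powR => //; rewrite lerDl. Qed.

Lemma continuous_bracket p : continuous (bracket p).
Proof.
move=> x; rewrite /bracket.
have c1 : {for x, continuous (fun y : R => 1 + `|y|)}.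
  by apply: cvgD; [exact: cvg_cst|exact: norm_continuous].
apply: (@continuous_comp _ _ _ (fun y : R => 1 + `|y|) (fun y => y `^ p)) => //.
apply: differentiable_continuous; apply/derivable1_diffP.
by have [] := is_derive1_powR p (bracket_base x).
Qed.

Lemma bracket_cvg0 p (e : R) : p < 0 -> 0 < e ->
  exists T : R, forall x, T <= `|x| -> bracket p x <= e.
Proof.
move=> p0 e0; exists (e `^ (p^-1)) => x Tx.
have -> : bracket p x = ((1 + `|x|) `^ (- p))^-1 by rewrite -powRN opprK.
rewrite -[e]invrK lef_pV2 ?posrE ?powR_gt0 ?invr_gt0 ?bracket_base//.
have -> : e^-1 = (e `^ p^-1) `^ (- p).
  by rewrite -powRrM mulrN mulVf ?lt_eqF// powRN powRr1// ltW.
rewrite ge0_ler_powR ?nnegrE ?powR_ge0 ?oppr_ge0 ?(ltW p0) ?(ltW (bracket_base _))//.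
by apply: (le_trans Tx); rewrite lerDr.
Qed.

(** By evenness the half line suffices; there [- (1 + x)^(- eta) / eta] is a primitive vanishing at
    infinity. *)
Lemma integrable_bracket eta : 0 < eta ->
  mu.-integrable setT (EFin \o bracket (- 1 - eta)).
Proof.
move=> eta0.
have mb : measurable_fun setT (bracket (- 1 - eta)).
  by apply: continuous_measurable_fun; exact: continuous_bracket.
apply/integrableP; split; first exact/measurable_EFinP.
under eq_integral => x _ do rewrite /= ger0_norm ?ltW ?bracket_gt0//.
rewrite ge0_symfun_integralT.
- rewrite -set_itvcy.
  pose F x : R := - eta^-1 * (1 + x) `^ (- eta).
  have base x : 0 <= x -> 0 < 1 + x by move=> x0; rewrite ltr_pwDl.
  have dF x : 0 <= x -> is_derive x 1 F (bracket (- 1 - eta) x).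
    move=> x0; rewrite /F /bracket ger0_norm//.
    have d1 : is_derive (1 + x) 1 (fun y : R => y `^ (- eta))
      (- eta * (1 + x) `^ (- eta - 1)) by apply: is_derive1_powR; exact: base.
    have d2 : is_derive x 1 (fun y : R => 1 + y) (0 + 1).
      by apply: is_deriveD.
    have := @is_derive1_comp R (fun y : R => y `^ (- eta)) (fun y => 1 + y) x _ _ d1 d2.
    move=> d3; have d4 := is_deriveZ (- eta^-1) d3.
    apply: is_derive_eq d4 _.
    rewrite -[LHS]/(- eta^-1 * _) add0r mulr1 mulrA mulrNN mulVf ?gt_eqF// mul1r.
    by rewrite [- eta - 1]addrC.
  rewrite (@ge0_continuous_FTC2y _ _ F _ 0)//.
  + by rewrite -EFinB -EFinM ltry.
  + by move=> x _; rewrite ltW ?bracket_gt0.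
  + by apply: continuous_subspaceT; exact: continuous_bracket.
  + rewrite (_ : 0 = - eta^-1 * 0); last by rewrite mulr0.
    apply: cvgM; first exact: cvg_cst.
    apply/cvgrPdist_le => e e0.
    have [|T HT] := @bracket_cvg0 (- eta) e _ e0; first by rewrite oppr_lt0.
    near=> x; rewrite sub0r normrN.
    have x0 : 0 <= x by near: x; apply: nbhs_pinfty_ge; rewrite num_real.
    have xT : T <= x by near: x; apply: nbhs_pinfty_ge; rewrite num_real.
    have := HT x; rewrite /bracket ger0_norm// => /(_ xT).
    by rewrite ger0_norm// powR_ge0.
  + by move=> x x0; have [] := dF x (ltW x0).
  + apply: cvg_at_right_filter.
    by have [/derivable1_diffP/differentiable_continuous] := dF 0 (lexx _).
  + move=> x; rewrite in_itv/= andbT => x0; rewrite derive1E.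
    by have [_ ->] := dF x (ltW x0).
- by move=> x; rewrite ltW ?bracket_gt0.
- exact: continuous_bracket.
- by move=> x; rewrite /bracket /= normrN.
Unshelve. all: by end_near.
Qed.

End Bracket.

(** * Dominated convergence for complex-valued functions *)

Section ComplexDominated.
Context {R : realType}.
Notation mu := (@lebesgue_measure R).
Implicit Types (D : set R) (h : R -> R[i]) (g : R -> R).

Definition cmeasurable D h :=
  measurable_fun D (fun x => Re (h x)) /\ measurable_fun D (fun x => Im (h x)).

Lemma cintegrable_measurable D h : measurable D -> cintegrable D h -> cmeasurable D h.
Proof.
move=> mD [h1 h2]; split.
- by apply/measurable_EFinP; exact: (measurable_int mu).
- by apply/measurable_EFinP; exact: (measurable_int mu).
Qed.

Lemma cvg_normc0_Re (u : nat -> R[i]) (l : R[i]) :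
  (fun n => normc (u n - l)) @ \oo --> (0 : R) ->
  (fun n => Re (u n)) @ \oo --> Re l /\ (fun n => Im (u n)) @ \oo --> Im l.
Proof.
move=> /cvgrPdist_lt ul; split; apply/cvgrPdist_lt => e /ul; apply: filterS => n;
  rewrite sub0r normrN ger0_norm ?normc_ge0//; apply: le_lt_trans.
- by rewrite distrC -ReB le_Re_normc.
- by rewrite distrC -ImB le_Im_normc.
Qed.

Lemma cvg_normc0 (u : nat -> R[i]) (l : R[i]) :
  (fun n => Re (u n)) @ \oo --> Re l -> (fun n => Im (u n)) @ \oo --> Im l ->
  (fun n => normc (u n - l)) @ \oo --> (0 : R).
Proof.
move=> /cvgrPdist_lt hr /cvgrPdist_lt hi; apply/cvgrPdist_lt => e e0.
have e2 : 0 < e / 2 by rewrite divr_gt0.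
near=> n; rewrite sub0r normrN ger0_norm ?normc_ge0//.
apply: (le_lt_trans (normc_le_ReIm _)); rewrite ReB ImB (splitr e) ltrD//.
- by rewrite distrC; near: n; exact: hr.
- by rewrite distrC; near: n; exact: hi.
Unshelve. all: by end_near. Qed.

Lemma cvg_normc_norm (u : nat -> R[i]) (l : R[i]) :
  (fun n => normc (u n - l)) @ \oo --> (0 : R) ->
  (fun n => normc (u n)) @ \oo --> normc l.
Proof.
move=> /cvgrPdist_le ul; apply/cvgrPdist_le => e /ul; apply: filterS => n.
rewrite sub0r normrN ger0_norm ?normc_ge0//; apply: le_trans.
rewrite ler_norml lerNl opprB !lerBlDr; apply/andP; split.
- by rewrite -[X in normc X <= _](subrK l) normcD.
- by rewrite distcC -[X in normc X <= _](subrK (u n)) normcD.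
Qed.

Lemma cmeasurable_cvg D (hN : nat -> R -> R[i]) h :
  (forall N, cmeasurable D (hN N)) ->
  (forall x, D x -> (fun N => normc (hN N x - h x)) @ \oo --> (0 : R)) ->
  cmeasurable D h.
Proof.
move=> mh hc; split.
- apply: (@measurable_fun_cvg _ _ _ _ (fun N x => Re (hN N x))) => [N|x Dx].
    by have [] := mh N.
  by have [] := cvg_normc0_Re (hc x Dx).
- apply: (@measurable_fun_cvg _ _ _ _ (fun N x => Im (hN N x))) => [N|x Dx].
    by have [] := mh N.
  by have [] := cvg_normc0_Re (hc x Dx).
Qed.

Lemma cintegrable_le D h g : measurable D -> cmeasurable D h ->
  mu.-integrable D (EFin \o g) -> (forall x, D x -> normc (h x) <= g x) ->
  cintegrable D h.
Proof.
move=> mD [m1 m2] gi hg; split.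
- apply: (le_integrable _ _ _ gi) => //; first exact/measurable_EFinP.
  move=> x Dx /=; rewrite lee_fin; apply: (le_trans (le_Re_normc _)).
  by apply: (le_trans (hg x Dx)); exact: ler_norm.
- apply: (le_integrable _ _ _ gi) => //; first exact/measurable_EFinP.
  move=> x Dx /=; rewrite lee_fin; apply: (le_trans (le_Im_normc _)).
  by apply: (le_trans (hg x Dx)); exact: ler_norm.
Qed.

(** The theorem for extended reals descends to [Rintegral] once the limit integral is known to be
    finite; the dominating function also bounds the limit function. *)
Lemma cvg_Rintegral D (f_ : nat -> R -> R) (f : R -> R) g : measurable D ->
  (forall n, measurable_fun D (f_ n)) ->
  (forall x, D x -> (fun n => f_ n x) @ \oo --> f x) ->
  mu.-integrable D (EFin \o g) ->
  (forall n x, D x -> `|f_ n x| <= g x) ->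
  (fun n => Rintegral mu D (f_ n)) @ \oo --> Rintegral mu D f.
Proof.
move=> mD mf cf ig fg.
have H : (\int[mu]_(x in D) (f_ n x)%:E)%E @[n --> \oo] -->
    (\int[mu]_(x in D) (f x)%:E)%E.
  apply: (@dominated_cvg _ _ _ mu D mD (fun n => EFin \o f_ n) (EFin \o f) (EFin \o
    g)) => //.
  - by move=> n; apply/measurable_EFinP; exact: mf.
  - by move=> x Dx; apply: cvg_EFin; [exact: nearW|exact: cf].
suff H2 : (\int[mu]_(x in D) (f_ n x)%:E)%E @[n --> \oo] -->
    (Rintegral mu D f)%:E by exact: (fine_cvg H2).
rewrite /Rintegral fineK//.
have mfl : measurable_fun D f by exact: (measurable_fun_cvg mf cf).
have fi : mu.-integrable D (EFin \o f).
  apply: (le_integrable _ _ _ ig) => //; first exact/measurable_EFinP.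
  move=> x Dx /=; rewrite lee_fin; apply: (@le_trans _ _ (g x)); last exact: ler_norm.
  apply: (ler_cvg_to (cvg_norm (cf x Dx)) (cvg_cst _)).
  by apply: nearW => n; exact: fg.
exact: integrable_fin_num.
Qed.

Lemma cvg_Cint D (hN : nat -> R -> R[i]) h g : measurable D ->
  (forall N, cmeasurable D (hN N)) ->
  (forall x, D x -> (fun N => normc (hN N x - h x)) @ \oo --> (0 : R)) ->
  mu.-integrable D (EFin \o g) ->
  (forall N x, D x -> normc (hN N x) <= g x) ->
  (fun N => normc (Cint D (hN N) - Cint D h)) @ \oo --> (0 : R).
Proof.
move=> mD mh hc ig hg; apply: cvg_normc0.
- apply: (@cvg_Rintegral D (fun N x => Re (hN N x)) _ g) => // [N|x Dx|N x Dx].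
  + by have [] := mh N.
  + by have [] := cvg_normc0_Re (hc x Dx).
  + exact: le_trans (le_Re_normc _) (hg N x Dx).
- apply: (@cvg_Rintegral D (fun N x => Im (hN N x)) _ g) => // [N|x Dx|N x Dx].
  + by have [] := mh N.
  + by have [] := cvg_normc0_Re (hc x Dx).
  + exact: le_trans (le_Im_normc _) (hg N x Dx).
Qed.

Lemma cvg_normc_unique (u : nat -> R[i]) (k l : R[i]) :
  (fun n => normc (u n - k)) @ \oo --> (0 : R) ->
  (fun n => normc (u n - l)) @ \oo --> (0 : R) -> k = l.
Proof.
move=> /cvg_normc0_Re[k1 k2] /cvg_normc0_Re[l1 l2].
apply/eqP; rewrite eq_complex; apply/andP; split; apply/eqP.
- by rewrite -(cvg_lim _ k1)// -(cvg_lim _ l1).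
- by rewrite -(cvg_lim _ k2)// -(cvg_lim _ l2).
Qed.

End ComplexDominated.

(** * Moving the contour across the strip [-1 <= Im z <= 0] *)

Section StripShift.
Context {R : realType}.
Notation mu := (@lebesgue_measure R).
Implicit Types (F H : R[i] -> R[i]) (eta K : R).

Definition in_strip (z : R[i]) := -1 <= Im z <= 0.

(** Exactly what dominated convergence requires on segments: pointwise limits of holomorphic
    functions, bounded on each compact part of the strip. Local uniform convergence is not demanded,
    and the class is visibly closed under products. The bound starts at an index depending on [T],
    because Euler's approximants are controlled on a disc only from such an index on. *)
Definition approximable H := exists HN : nat -> R[i] -> R[i],
  [/\ forall N z, in_strip z -> HN N \dat z,
      forall z, in_strip z ->
        (fun N => normc (HN N z - H z)) @ \oo --> (0 : R) &
      forall T : R, exists M : R, exists N0 : nat, forall N z, (N0 <= N)%N ->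
        in_strip z -> `|Re z| <= T -> normc (HN N z) <= M].

Lemma approximable_path_cvg (g : R -> R[i]) (a b M : R) H (HN : nat -> R[i] -> R[i]) :
  short_path g ->
  (forall N t, a <= t <= b -> HN N \dat g t) ->
  (forall t, a <= t <= b ->
     (fun N => normc (HN N (g t) - H (g t))) @ \oo --> (0 : R)) ->
  (forall N t, a <= t <= b -> normc (HN N (g t)) <= M) ->
  (fun N => normc (Cint `[a, b] (fun t => HN N (g t)) -
                   Cint `[a, b] (fun t => H (g t)))) @ \oo --> (0 : R).
Proof.
move=> sg dH cH bH.
apply: (@cvg_Cint R _ (fun N t => HN N (g t)) _ (fun=> M)) => //.
- by move=> N; apply: cintegrable_measurable => //; exact: (cintegrable_path sg (dH N)).
- exact: integrable_itv_cst.
Qed.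

Lemma cvg_normcD (u v : nat -> R[i]) (k l : R[i]) :
  (fun n => normc (u n - k)) @ \oo --> (0 : R) ->
  (fun n => normc (v n - l)) @ \oo --> (0 : R) ->
  (fun n => normc (u n + v n - (k + l))) @ \oo --> (0 : R).
Proof.
move=> hu hv; apply: (@squeeze_cvgr _ _ _ _ (cst 0)
    (fun n => normc (u n - k) + normc (v n - l))).
- apply: nearW => n; rewrite normc_ge0/=.
  by rewrite opprD addrACA; exact: normcD.
- exact: cvg_cst.
- have : (fun n => normc (u n - k) + normc (v n - l)) @ \oo --> (0 + 0 : R).
    exact: cvgD.
  by rewrite addr0.
Qed.

Lemma cvg_normcMl (u : nat -> R[i]) (k l : R[i]) :
  (fun n => normc (u n - k)) @ \oo --> (0 : R) ->
  (fun n => normc (l * u n - l * k)) @ \oo --> (0 : R).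
Proof.
move=> hu; under eq_fun do rewrite -mulrBr Normc.normcM.
have : (fun n => normc l * normc (u n - k)) @ \oo --> normc l * 0.
  by apply: cvgM => //; exact: cvg_cst.
by rewrite mulr0.
Qed.

Lemma cvg_normcN (u : nat -> R[i]) (k : R[i]) :
  (fun n => normc (u n - k)) @ \oo --> (0 : R) ->
  (fun n => normc (- u n - - k)) @ \oo --> (0 : R).
Proof.
by move=> hu; under eq_fun do rewrite -opprD normcN.
Qed.

Lemma approximable_rect H (T : R) : 0 <= T -> approximable H ->
  rect_int H (- T) (-1) (T + T) 1 = 0.
Proof.
move=> T0 [GN [dG cG bG]]; have [M [N0 HMG]] := bG T.
(* Domination must hold at every index, so the first [N0] approximants are dropped. *)
pose HN N := GN (N + N0)%N.
have dH N z : in_strip z -> HN N \dat z by exact: dG.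
have cH z : in_strip z -> (fun N => normc (HN N z - H z)) @ \oo --> (0 : R).
  by move=> /cG; rewrite -(cvg_shiftn N0).
have HM N z : in_strip z -> `|Re z| <= T -> normc (HN N z) <= M.
  by apply: HMG; exact: leq_addl.
have rN0 N : rect_int (HN N) (- T) (-1) (T + T) 1 = 0.
  by apply: goursat => //; [exact: addr_ge0|move=> z [_]; rewrite addNr; exact: dH].
apply: (@cvg_normc_unique R (fun N => rect_int (HN N) (- T) (-1) (T + T) 1));
  last first.
  by under eq_fun do rewrite rN0 subr0 Normc.normc0; exact: cvg_cst.
have e : - T + (T + T) = T by ring.
have bT t : - T <= t <= T -> `|t| <= T by rewrite ler_norml.
rewrite /rect_int e addNr.
have TT : `|T| <= T by rewrite ger0_norm.
have NTT : `|- T| <= T by rewrite normrN ger0_norm.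
have s1 t : in_strip (t +i* (-1)) by rewrite /in_strip /= lexx lerN10.
have s2 t : in_strip (t +i* 0) by rewrite /in_strip /= lexx lerN10.
have s3 t u : -1 <= u <= 0 -> in_strip (t +i* u) by [].
apply: cvg_normcD; last apply: cvg_normcMl; apply: cvg_normcD; try apply: cvg_normcN.
- apply: (@approximable_path_cvg (fun t => t +i* (-1)) _ _ M) => // [|N t|t _|N t tT].
  + exact: short_path_h.
  + by move=> _; exact: dH.
  + exact: cH.
  + by apply: HM => //=; exact: bT.
- apply: (@approximable_path_cvg (fun t => t +i* 0) _ _ M) => // [|N t|t _|N t tT].
  + exact: short_path_h.
  + by move=> _; exact: dH.
  + exact: cH.
  + by apply: HM => //=; exact: bT.
- apply: (@approximable_path_cvg (fun t => T +i* t) _ _ M) => // [|N t tT|t tT|N t tT].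
  + exact: short_path_v.
  + by apply: dH; exact: s3.
  + by apply: cH; exact: s3.
  + by apply: HM => //=; exact: s3.
- apply: (@approximable_path_cvg (fun t => (- T) +i* t) _ _ M) => // [|N t tT|t
    tT|N t tT].
  + exact: short_path_v.
  + by apply: dH; exact: s3.
  + by apply: cH; exact: s3.
  + by apply: HM => //=; exact: s3.
Qed.

Lemma approximable_line H (y : R) : -1 <= y <= 0 -> approximable H ->
  cmeasurable setT (fun x => H (x +i* y)).
Proof.
move=> y01 [HN [dH cH bH]].
apply: (@cmeasurable_cvg R _ (fun N x => HN N (x +i* y))) => [N|x _]; last exact: cH.
split; apply: continuous_measurable_fun => x;
  by have [] := continuous_path (short_path_h y) (dH N (x +i* y) y01).
Qed.

Lemma approximable_vline H (x : R) : approximable H ->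
  cintegrable `[(-1), 0] (fun t => H (x +i* t)).
Proof.
move=> [HN [dH cH bH]]; have [M [N0 HM]] := bH `|x|.
have mN N : cmeasurable `[(-1), 0] (fun t => HN N (x +i* t)).
  apply: cintegrable_measurable => //.
  by apply: (@cintegrable_path _ _ _ _ _ (short_path_v x)) => t t1; exact: dH.
have mH : cmeasurable `[(-1), 0] (fun t => H (x +i* t)).
  by apply: (cmeasurable_cvg mN) => t; rewrite /= in_itv/= => t1; exact: cH.
apply: (cintegrable_le (g := fun=> M)) => //; first exact: integrable_itv_cst.
move=> t; rewrite /= in_itv/= => t1.
apply: (cvgr_to_le (cvg_normc_norm (cH (x +i* t) t1))).
by exists N0 => // N /= NN; exact: HM.
Qed.

(** The truncations of [h] to [[-N, N]] are eventually constant at each point and dominated by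
    [g]. *)
Lemma cvg_Cint_expanding (h : R -> R[i]) (g : R -> R) :
  cmeasurable setT h -> mu.-integrable setT (EFin \o g) ->
  (forall x, normc (h x) <= g x) ->
  (fun N : nat => normc (Cint `[- N%:R, N%:R] h - Cint setT h)) @ \oo --> (0 : R).
Proof.
move=> mh ig hg.
pose hN N x := if x \in `[- N%:R, N%:R] then h x else 0.
have E N : Cint `[- N%:R, N%:R] h = Cint setT (hN N).
  rewrite /Cint [in LHS]Rintegral_mkcond [X in _ +i* X = _]Rintegral_mkcond.
  congr (_ +i* _); apply: eq_Rintegral => x _;
  by rewrite /patch /hN mem_setE; case: ifP.
under eq_fun do rewrite E.
apply: (@cvg_Cint R setT hN h g) => //.
- move=> N; have [m1 m2] := mh.
  have p1 : measurable_fun setT ((fun x => Re (h x)) \_ `[- N%:R, N%:R]).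
    by apply/(measurable_restrictT _ _).1 => //; exact: measurable_funTS.
  have p2 : measurable_fun setT ((fun x => Im (h x)) \_ `[- N%:R, N%:R]).
    by apply/(measurable_restrictT _ _).1 => //; exact: measurable_funTS.
  split; [move: p1|move: p2]; apply: eq_measurable_fun => x _;
    by rewrite /patch /hN mem_setE; case: ifP.
- move=> x _; have [n Hn] : exists n : nat, `|x| <= n%:R.
    by exists (Num.bound `|x|); apply/ltW/archi_boundP.
  apply: cvg_near_cst; exists n => // N /= nN.
  rewrite /hN ifT ?subrr ?Normc.normc0//.
  rewrite in_itv/= -ler_norml; apply: (le_trans Hn).
  by rewrite ler_nat.
- move=> N x _; rewrite /hN; case: ifP => // _.
  by rewrite Normc.normc0; exact: le_trans (normc_ge0 _) (hg x).
Qed.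

(** The contour integrals are taken for the holomorphic approximations [HN] and
    pass to the limit, so that no regularity of [H] itself is needed. *)
Lemma strip_shift H K eta : 0 < eta -> approximable H ->
  (forall z, in_strip z -> normc (H z) <= K * bracket (- 1 - eta) (Re z)) ->
  Cint setT (fun x => H (x +i* (-1))) = Cint setT (fun x => H (x +i* 0)).
Proof.
move=> eta0 aH bH.
have ig : mu.-integrable setT (EFin \o (fun x => K * bracket (- 1 - eta) x)).
  by apply: integrableMl => //; exact: integrable_bracket.
have K0 : 0 <= K.
  have := bH 0; rewrite /in_strip /= lexx lerN10 => /(_ isT).
  move=> /(le_trans (normc_ge0 _)).
  by rewrite pmulr_lge0// bracket_gt0.
have c1 : (fun N : nat => normc (Cint `[- N%:R, N%:R] (fun x => H (x +i* (-1))) -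
    Cint setT (fun x => H (x +i* (-1))))) @ \oo --> (0 : R).
  apply: (cvg_Cint_expanding _ ig) => [|x].
    by apply: approximable_line => //; rewrite lexx lerN10.
  by apply: bH; rewrite /in_strip /= lexx lerN10.
have c2 : (fun N : nat => normc (Cint `[- N%:R, N%:R] (fun x => H (x +i* 0)) -
    Cint setT (fun x => H (x +i* 0)))) @ \oo --> (0 : R).
  apply: (cvg_Cint_expanding _ ig) => [|x].
    by apply: approximable_line => //; rewrite lexx lerN10.
  by apply: bH; rewrite /in_strip /= lexx lerN10.
apply: (cvg_normc_unique c1).
(* The two vertical sides of the rectangle over [[-N, N]]; they alone separate the two horizontal
   integrals, and they vanish in the limit. *)
pose V N := Cint `[(-1), 0] (fun t => H (N%:R +i* t)) -
            Cint `[(-1), 0] (fun t => H ((- N%:R) +i* t)).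
have E N : Cint `[- N%:R, N%:R] (fun x => H (x +i* (-1))) =
    Cint `[- N%:R, N%:R] (fun x => H (x +i* 0)) + - 'i * V N.
  have := approximable_rect (ler0n R N) aH; rewrite /rect_int addNr.
  rewrite (_ : - N%:R + (N%:R + N%:R) = N%:R); last by ring.
  rewrite -/(V N) => /eqP; rewrite addrAC subr_eq0 => /eqP <-.
  by rewrite mulNr addrK.
under eq_fun do rewrite E.
have V0 : (fun N => normc (V N - 0)) @ \oo --> (0 : R).
  apply/cvgrPdist_le => e e0.
  (* Each vertical side contributes at most [2 K] times the bracket; the [+ 1] allows [K = 0]. *)
  have K4 : 0 < 4 * K + 1 by rewrite ltr_wpDl// mulr_ge0.
  have [|T HT] := @bracket_cvg0 R (- 1 - eta) (e / (4 * K + 1)) _ (divr_gt0 e0 K4).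
    by rewrite -opprD oppr_lt0 addr_gt0.
  near=> N; rewrite sub0r normrN ger0_norm ?normc_ge0// subr0.
  pose B := bracket (- 1 - eta) (N%:R : R).
  have vb x : `|x| = N%:R ->
      normc (Cint `[(-1), 0] (fun t => H (x +i* t))) <= 2 * (K * B).
    move=> xN.
    have := @normc_Cint_itv_le R (-1) 0 (fun t => H (x +i* t)) (K * B) (lerN10 _)
      (approximable_vline _ aH).
    rewrite sub0r opprK mulr1; apply => t t1; apply: (le_trans (bH (x +i* t) t1)).
    by rewrite /= /B /bracket xN normr_nat.
  apply: (le_trans (normcD _ _)); rewrite normcN.
  apply: (@le_trans _ _ ((4 * K + 1) * B)).
    apply: (le_trans (lerD (vb _ _) (vb _ _))); rewrite ?normrN ?normr_nat//.
    have B0 : 0 < B by exact: bracket_gt0.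
    by rewrite mulrDl mul1r; clear -B0; lra.
  rewrite mulrC -ler_pdivlMr//; apply: HT; rewrite normr_nat.
  by near: N; exact: nbhs_infty_ger.
have := cvg_normcD c2 (cvg_normcMl (- 'i) V0).
by rewrite mulr0 addr0.
Unshelve. all: by end_near. Qed.

End StripShift.

(** * Euler's sequence for Gamma *)

Section InfiniteProduct.
Context {R : realType}.
Implicit Types (p e : nat -> R[i]) (u : nat -> R) (C K : R).

(** The allowed increments telescope: [u n - K / (n + 1)] is nondecreasing and bounded above from
    [n0] on, and the correction tends to 0. *)
Lemma bounded_variation_cvg u K n0 : 0 <= K ->
  (forall n, (n0 <= n)%N -> `|u n.+1 - u n| <= K * (n.+1%:R^-1 - n.+2%:R^-1)) ->
  cvgn u.
Proof.
move=> K0 uK.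
pose v n := u (n + n0)%N - K * (n + n0).+1%:R^-1.
have uv n : u (n + n0)%N = v n + K * (n + n0).+1%:R^-1 by rewrite /v subrK.
have cK : (fun n => K * (n + n0).+1%:R^-1 : R) @ \oo --> (0 : R).
  have : (fun n => K * (n.+1%:R^-1)) @ \oo --> K * (0 : R).
    by apply: cvgM; [exact: cvg_cst|exact: cvg_harmonic].
  by rewrite mulr0 -(cvg_shiftn n0).
have vinc : nondecreasing_seq v.
  apply/nondecreasing_seqP => n; rewrite /v addSn -subr_ge0.
  have := uK (n + n0)%N (leq_addl _ _); rewrite ler_norml => /andP[h _].
  by move: h; move: (n + n0).+1%:R^-1 (n + n0).+2%:R^-1 => x y; lra.
have vb n : v n <= v 0%N + (K + K).
  have H m : u (m + n0)%N <= u n0 + K * (n0.+1%:R^-1 - (m + n0).+1%:R^-1).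
    elim: m => [|m ih]; first by rewrite subrr mulr0 addr0.
    have := uK (m + n0)%N (leq_addl _ _); rewrite ler_norml addSn => /andP[_].
    move: ih; move: (m + n0).+1%:R^-1 (m + n0).+2%:R^-1 n0.+1%:R^-1 => x y z.
    by lra.
  have i0 m : 0 <= (m.+1%:R^-1 : R) <= 1.
    by rewrite invr_ge0 ler0n/= invf_le1// ler1n.
  have := H n; rewrite /v /= add0n.
  have /andP[a1 a2] := i0 n0; have /andP[b1 b2] := i0 (n + n0)%N.
  move: (ler_wpM2l K0 a2) (ler_wpM2l K0 b2) (mulr_ge0 K0 a1) (mulr_ge0 K0 b1).
  by move: (n + n0).+1%:R^-1 n0.+1%:R^-1 => x y; lra.
have cv : cvgn v.
  apply: nondecreasing_is_cvgn => //.
  by exists (v 0%N + (K + K)) => _ [n _ <-]; exact: vb.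
apply/cvg_ex; exists (limn v + 0); rewrite -(cvg_shiftn n0).
rewrite (_ : (fun n => _) = (fun n => v n + K * (n + n0).+1%:R^-1)).
  exact: cvgD.
by apply/funext => n; rewrite -uv.
Qed.

(** As [1 + t <= exp t], the product of the factors is at most the exponential of a telescoping sum,
    which never exceeds [C]. *)
Lemma cprod_bound p e C n0 : 0 <= C ->
  (forall n, (n0 <= n)%N -> p n.+1 = p n * (1 + e n)) ->
  (forall n, (n0 <= n)%N -> normc (e n) <= C * (n.+1%:R^-1 - n.+2%:R^-1)) ->
  forall n, (n0 <= n)%N -> normc (p n) <= normc (p n0) * expR C.
Proof.
move=> C0 pe eC.
have H m : normc (p (m + n0)%N) <=
    normc (p n0) * expR (C * (n0.+1%:R^-1 - (m + n0).+1%:R^-1)).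
  elim: m => [|m ih]; first by rewrite subrr mulr0 expR0 mulr1.
  rewrite addSn pe ?leq_addl// Normc.normcM.
  set d := (m + n0).+1%:R^-1 - (m + n0).+2%:R^-1 : R.
  have -> : C * (n0.+1%:R^-1 - (m + n0).+2%:R^-1) =
      C * (n0.+1%:R^-1 - (m + n0).+1%:R^-1) + C * d by rewrite /d; ring.
  rewrite expRD mulrA ler_pM ?normc_ge0//.
  apply: (le_trans (normcD _ _)); rewrite Normc.normc1.
  apply: le_trans (expR_ge1Dx _); rewrite lerD2l.
  by apply: eC; exact: leq_addl.
move=> n /subnK <-; apply: (le_trans (H _)).
rewrite ler_wpM2l ?normc_ge0// ler_expR ler_piMr//.
rewrite lerBlDr; apply: (@le_trans _ _ 1); first by rewrite invf_le1// ler1n.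
by rewrite lerDl invr_ge0.
Qed.

(** No logarithm is taken, so [p] may vanish, as it eventually does at the poles of Gamma under the
    convention for inverses. *)
Lemma cprod_cvg p e C n0 : 0 <= C ->
  (forall n, (n0 <= n)%N -> p n.+1 = p n * (1 + e n)) ->
  (forall n, (n0 <= n)%N -> normc (e n) <= C * (n.+1%:R^-1 - n.+2%:R^-1)) ->
  exists l, (fun n => normc (p n - l)) @ \oo --> (0 : R).
Proof.
move=> C0 pe eC; pose B := normc (p n0) * expR C.
have B0 : 0 <= B by rewrite mulr_ge0 ?normc_ge0 ?expR_ge0.
have step n : (n0 <= n)%N ->
    normc (p n.+1 - p n) <= B * C * (n.+1%:R^-1 - n.+2%:R^-1).
  move=> nn; rewrite pe// mulrDr mulr1 addrC addKr Normc.normcM -mulrA.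
  by apply: ler_pM; rewrite ?normc_ge0 ?eC//; exact: (cprod_bound C0 pe eC).
have cr : cvgn (fun n => Re (p n)).
  apply: (@bounded_variation_cvg _ (B * C) n0) => [|n nn]; first exact: mulr_ge0.
  by apply: le_trans (step n nn); rewrite -ReB le_Re_normc.
have ci : cvgn (fun n => Im (p n)).
  apply: (@bounded_variation_cvg _ (B * C) n0) => [|n nn]; first exact: mulr_ge0.
  by apply: le_trans (step n nn); rewrite -ImB le_Im_normc.
exists (limn (fun n => Re (p n)) +i* limn (fun n => Im (p n))).
exact: cvg_normc0.
Qed.

Lemma cvg_normcM (u v : nat -> R[i]) (k l : R[i]) :
  (fun n => normc (u n - k)) @ \oo --> (0 : R) ->
  (fun n => normc (v n - l)) @ \oo --> (0 : R) ->
  (fun n => normc (u n * v n - k * l)) @ \oo --> (0 : R).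
Proof.
move=> hu hv.
have H : (fun n => normc (u n - k) * normc (v n) + normc k * normc (v n - l)) @ \oo
    --> (0 * normc l + normc k * 0 : R).
  apply: cvgD; first by apply: cvgM => //; exact: cvg_normc_norm.
  by apply: cvgM => //; exact: cvg_cst.
move: H; rewrite mul0r mulr0 addr0 => H.
apply: (@squeeze_cvgr _ _ _ _ (cst 0) _ _ _ _ (cvg_cst _) H).
apply: nearW => n; rewrite normc_ge0/= -!Normc.normcM.
rewrite (_ : u n * v n - k * l = (u n - k) * v n + k * (v n - l)); last by ring.
exact: normcD.
Qed.

End InfiniteProduct.

(** * Convergence of Euler's approximants and of their inverses; the functional equation *)

Section EulerSequence.
Context {R : realType}.
Implicit Types (z : R[i]) (n : nat) (r x d : R).

(** The term of index [n] in the limit that defines [cGamma]. *)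
Definition gam n z : R[i] :=
  n`!%:R * cexp (z * (ln n%:R)%:C) / \prod_(k < n.+1) (z + k%:R).

Definition lnstep n : R := ln n.+1%:R - ln n%:R.

Lemma lnstep_bounds n : (0 < n)%N -> n.+1%:R^-1 <= lnstep n <= n%:R^-1.
Proof.
move=> n0; have n0' : 0 < n%:R :> R by rewrite ltr0n.
have n1 : 0 < n.+1%:R :> R by rewrite ltr0n.
apply/andP; split.
- have : ln (1 + - n.+1%:R^-1) <= - n.+1%:R^-1 :> R.
    apply: le_ln1Dx; rewrite ltrN2 invf_lt1// ltr1n; exact: n0.
  have -> : 1 + - n.+1%:R^-1 = n%:R / n.+1%:R :> R.
    by rewrite -natr1; field; rewrite natr1 gt_eqF.
  by rewrite ln_div ?posrE// => h; rewrite /lnstep -lerN2 opprB.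
- have : ln (1 + n%:R^-1) <= n%:R^-1 :> R.
    by apply: le_ln1Dx; apply: (@lt_trans _ _ 0) => //; rewrite invr_gt0.
  have -> : 1 + n%:R^-1 = n.+1%:R / n%:R :> R.
    by rewrite -natr1; field; rewrite gt_eqF.
  by rewrite ln_div ?posrE.
Qed.

Lemma gamS n z : (0 < n)%N ->
  gam n.+1 z = gam n z * (n.+1%:R * cexp (z * (lnstep n)%:C) / (z + n.+1%:R)).
Proof.
move=> n0; rewrite /gam big_ord_recr /= factS natrM invfM.
have -> : (ln n.+1%:R)%:C = (ln n%:R)%:C + (lnstep n)%:C :> R[i].
  by rewrite -rmorphD /lnstep addrC subrK.
rewrite mulrDr cexpD; ring.
Qed.

(** Here [x = n], [r] bounds [|z|] and [d = ln (1 + 1 / n)]. The two summands become [6 r^2 d^2] and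
    [2 r (d - 1 / (x + 1))]; for [x >= 1], [(x + 1) (x + 2) <= 6 x^2] and [x + 2 <= 3 x] give the
    constants 36 and 6 and the telescoping form of the bound. *)
Lemma step_error_real r x d : 0 <= r -> 1 <= x -> (x + 1)^-1 <= d <= x^-1 ->
  ((x + 1) * (3 * (r * d) ^+ 2) + r * ((x + 1) * d - 1)) * 2 / (x + 1) <=
  (36 * r ^+ 2 + 6 * r) * ((x + 1)^-1 - (x + 2)^-1).
Proof.
move=> r0 x1 /andP[d1 d2].
have x0 : 0 < x by lra.
have xx1 : 0 < x + 1 by lra.
have xx2 : 0 < x + 2 by lra.
have d0 : 0 <= d by apply: le_trans d1; rewrite invr_ge0 ltW.
have -> : (x + 1)^-1 - (x + 2)^-1 = ((x + 1) * (x + 2))^-1.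
  by field; rewrite !gt_eqF.
rewrite [leLHS](_ : _ = 6 * r ^+ 2 * d ^+ 2 + 2 * r * (d - (x + 1)^-1)); last first.
  by field; rewrite gt_eqF.
rewrite [leRHS]mulrDl; apply: lerD.
- rewrite (_ : 36 * r ^+ 2 / _ = 6 * r ^+ 2 * (6 / ((x + 1) * (x + 2)))); last first.
    by field; rewrite !gt_eqF.
  rewrite ler_wpM2l ?mulr_ge0 ?sqr_ge0//.
  apply: (@le_trans _ _ (x^-1 ^+ 2)); first by rewrite ler_sqr ?nnegrE// invr_ge0 ltW.
  rewrite exprVn ler_pdivlMr ?mulr_gt0// mulrC ler_pdivrMr ?exprn_gt0//.
  by nra.
- rewrite (_ : 6 * r / _ = 2 * r * (3 / ((x + 1) * (x + 2)))); last first.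
    by field; rewrite !gt_eqF.
  rewrite ler_wpM2l ?mulr_ge0//.
  apply: (@le_trans _ _ (x^-1 - (x + 1)^-1)); first by rewrite lerB.
  rewrite (_ : x^-1 - _ = (x * (x + 1))^-1); last by field; rewrite !gt_eqF.
  rewrite ler_pdivlMr ?mulr_gt0// mulrC ler_pdivrMr ?mulr_gt0//.
  by nra.
Qed.

Definition step_const r : R := 36 * r ^+ 2 + 6 * r.

(** With [w = z d], the numerator is [(n + 1) (exp w - 1 - w) + z ((n + 1) d - 1)]. The factor
    [2 / (n + 1)] bounds the inverse of both denominators in use, [z + n + 1] and [(n + 1) exp w],
    so the estimate serves [gam] and its inverse alike. *)
Lemma step_error n z r : normc z <= r -> (0 < n)%N -> 2 * r <= n%:R ->
  normc (n.+1%:R * cexp (z * (lnstep n)%:C) - n.+1%:R - z) * 2 / n.+1%:R <=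
  step_const r * (n.+1%:R^-1 - n.+2%:R^-1).
Proof.
move=> zr n0 rn; have r0 : 0 <= r by exact: le_trans (normc_ge0 _) zr.
have dB := lnstep_bounds n0; set d := lnstep n in dB *.
have x1 : 1 <= n%:R :> R by rewrite ler1n.
have /andP[d1 d2] := dB.
have d0 : 0 <= d by apply: le_trans d1; rewrite invr_ge0.
have S1 : n.+1%:R = n%:R + 1 :> R by rewrite natr1.
have S2 : n.+2%:R = n%:R + 2 :> R by rewrite -addn2 natrD.
rewrite S1 S2.
have dB' : (n%:R + 1)^-1 <= d <= n%:R^-1 by rewrite -S1.
apply: le_trans (step_error_real r0 x1 dB').
rewrite ler_pM2r ?invr_gt0 ?ltr_wpDl// ler_pM2r//.
have zd : normc (z * d%:C) <= r * d.
  by rewrite Normc.normcM normc_real ger0_norm// ler_wpM2r.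
have rd : r * d <= 2^-1.
  apply: (@le_trans _ _ (r * n%:R^-1)); first by rewrite ler_wpM2l.
  by rewrite ler_pdivrMr ?ltr0n//; lra.
have dE : (n.+1%:R * d - 1)%:C = n.+1%:R * d%:C - 1 :> R[i].
  rewrite (rmorphB (real_complex R)) (rmorphM (real_complex R)).
  by rewrite (rmorph_nat (real_complex R)) (rmorph1 (real_complex R)).
rewrite (_ : _ - _ - z = n.+1%:R * (cexp (z * d%:C) - 1 - z * d%:C) +
    z * (n.+1%:R * d - 1)%:C); last by rewrite dE; ring.
apply: (le_trans (normcD _ _)); apply: lerD.
- rewrite Normc.normcM normc_nat S1 ler_wpM2l ?addr_ge0//.
  apply: (le_trans (cexp_quad (le_trans zd rd))).
  by rewrite ler_wpM2l// ler_sqr ?nnegrE ?mulr_ge0 ?normc_ge0.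
- rewrite Normc.normcM normc_real S1 ger0_norm ?ler_wpM2r//.
    by rewrite subr_ge0 mulrC -ler_pdivrMr ?ltr_wpDl// mul1r; case/andP: dB'.
  by rewrite subr_ge0 mulrC -ler_pdivrMr ?ltr_wpDl// mul1r; case/andP: dB'.
Qed.

(** From this index on, [|z| <= r] implies [|z| <= n / 2], and [n] is positive. *)
Definition gam_start r : nat := (Num.bound (2 * r)).+1.

Lemma gam_start_le r n : 0 <= r -> (gam_start r <= n)%N ->
  (0 < n)%N /\ 2 * r <= n%:R.
Proof.
move=> r0 h; split; first exact: leq_trans h.
apply: (@le_trans _ _ (Num.bound (2 * r))%:R); last by rewrite ler_nat ltnW.
by apply/ltW/archi_boundP; rewrite mulr_ge0.
Qed.

Lemma step_const_ge0 r : 0 <= r -> 0 <= step_const r.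
Proof. by move=> r0; rewrite addr_ge0// mulr_ge0// sqr_ge0. Qed.

(** The relative error of one step of [gam]; [gamV_err] plays the same role for the inverses. *)
Definition gam_err n z :=
  (n.+1%:R * cexp (z * (lnstep n)%:C) - n.+1%:R - z) / (z + n.+1%:R).

Definition gamV_err n z :=
  - (n.+1%:R * cexp (z * (lnstep n)%:C) - n.+1%:R - z) /
    (n.+1%:R * cexp (z * (lnstep n)%:C)).

Lemma norm_le_half n z r : normc z <= r -> 2 * r <= n%:R ->
  n.+1%:R / 2 <= normc (z + n.+1%:R).
Proof.
move=> zr rn.
have : normc (n.+1%:R : R[i]) <= normc (z + n.+1%:R) + normc z.
  by rewrite -[X in normc X <= _](addKr z) addrC; apply: le_trans (normcD _ _) _;
    rewrite normcN.
by rewrite normc_nat -natr1; lra.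
Qed.

Lemma gam_errE n z r : normc z <= r -> (gam_start r <= n)%N ->
  gam n.+1 z = gam n z * (1 + gam_err n z).
Proof.
move=> zr h; have r0 := le_trans (normc_ge0 _) zr.
have [n0 rn] := gam_start_le r0 h.
have nz : z + n.+1%:R != 0.
  by rewrite -normc_gt0 (lt_le_trans _ (norm_le_half zr rn))// divr_gt0.
rewrite gamS// /gam_err; congr (_ * _); apply: (mulIf nz).
by rewrite mulrDl !divfK// mul1r; ring.
Qed.

Lemma gam_err_le n z r : normc z <= r -> (gam_start r <= n)%N ->
  normc (gam_err n z) <= step_const r * (n.+1%:R^-1 - n.+2%:R^-1).
Proof.
move=> zr h; have r0 := le_trans (normc_ge0 _) zr.
have [n0 rn] := gam_start_le r0 h.
apply: le_trans (step_error zr n0 rn).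
rewrite /gam_err Normc.normcM Normc.normcV -mulrA ler_wpM2l ?normc_ge0//.
rewrite -[2 / _]invrK lef_pV2 ?posrE.
- by rewrite invfM invrK mulrC (norm_le_half zr rn).
- by rewrite (lt_le_trans _ (norm_le_half zr rn))// divr_gt0.
- by rewrite invr_gt0 divr_gt0.
Qed.

Lemma gamV_errE n z r : normc z <= r -> (gam_start r <= n)%N ->
  (gam n.+1 z)^-1 = (gam n z)^-1 * (1 + gamV_err n z).
Proof.
move=> zr h; have r0 := le_trans (normc_ge0 _) zr.
have [n0 rn] := gam_start_le r0 h.
rewrite gamS// invfM /gamV_err; congr (_ * _).
have nz : n.+1%:R * cexp (z * (lnstep n)%:C) != 0.
  by rewrite mulf_neq0 ?pnatr_eq0 ?cexp_neq0.
rewrite invfM invrK; apply: (mulIf nz).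
by rewrite mulrDl divfK// mul1r mulrAC mulVf// mul1r; ring.
Qed.

Lemma gamV_err_le n z r : normc z <= r -> (gam_start r <= n)%N ->
  normc (gamV_err n z) <= step_const r * (n.+1%:R^-1 - n.+2%:R^-1).
Proof.
move=> zr h; have r0 := le_trans (normc_ge0 _) zr.
have [n0 rn] := gam_start_le r0 h.
apply: le_trans (step_error zr n0 rn).
rewrite /gamV_err Normc.normcM normcN Normc.normcV -mulrA ler_wpM2l ?normc_ge0//.
rewrite Normc.normcM normc_nat normc_cexp.
have /andP[d1 d2] := lnstep_bounds n0; set d := lnstep n in d1 d2 *.
have d0 : 0 <= d by apply: le_trans d1; rewrite invr_ge0.
have e2 : 2^-1 <= expR (Re (z * d%:C)).
  apply: le_trans (expR_ge1Dx _).
  have : `|Re (z * d%:C)| <= 2^-1.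
    apply: (le_trans (le_Re_normc _)); rewrite Normc.normcM normc_real ger0_norm//.
    apply: (@le_trans _ _ (r * n%:R^-1)); first by rewrite ler_pM ?normc_ge0.
    by rewrite ler_pdivrMr ?ltr0n//; lra.
  by rewrite ler_norml => /andP[? _]; lra.
rewrite invfM mulrC ler_pM2r ?invr_gt0//.
by rewrite -[2]invrK lef_pV2 ?posrE ?invr_gt0// expR_gt0.
Qed.

(** The factor depends on [r] alone, so boundedness of the whole tail on a disc reduces to that of
    one elementary function. *)
Lemma gam_bound n z r : normc z <= r -> (gam_start r <= n)%N ->
  normc (gam n z) <= normc (gam (gam_start r) z) * expR (step_const r).
Proof.
move=> zr; have r0 := le_trans (normc_ge0 _) zr.
apply: (@cprod_bound R (gam^~ z) (gam_err^~ z)); first exact: step_const_ge0.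
- by move=> m; exact: gam_errE.
- by move=> m; exact: gam_err_le.
Qed.

Lemma gamV_bound n z r : normc z <= r -> (gam_start r <= n)%N ->
  normc (gam n z)^-1 <= normc (gam (gam_start r) z)^-1 * expR (step_const r).
Proof.
move=> zr; have r0 := le_trans (normc_ge0 _) zr.
apply: (@cprod_bound R (fun n => (gam n z)^-1) (gamV_err^~ z)).
- exact: step_const_ge0.
- by move=> m; exact: gamV_errE.
- by move=> m; exact: gamV_err_le.
Qed.

Lemma gam_cvg z : (fun n => normc (gam n z - cGamma z)) @ \oo --> (0 : R).
Proof.
have [l Hl] : exists l, (fun n => normc (gam n z - l)) @ \oo --> (0 : R).
  apply: (@cprod_cvg R (gam^~ z) (gam_err^~ z) (step_const (normc z))
    (gam_start (normc z))); first exact/step_const_ge0/normc_ge0.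
  - by move=> m; exact: gam_errE.
  - by move=> m; exact: gam_err_le.
have -> : cGamma z = l by exact: cvg_normc.
exact: Hl.
Qed.

Lemma gam_eq0 n z : (gam n z == 0) = [exists k : 'I_n.+1, z + k%:R == 0].
Proof.
have f0 : (n`!%:R : R[i]) != 0 by rewrite pnatr_eq0 -lt0n fact_gt0.
rewrite /gam mulf_eq0 invr_eq0 mulf_eq0 (negbTE f0) (negbTE (cexp_neq0 _))/=.
apply/idP/existsP => [/prodf_eq0[k _ zk]|[k zk]]; first by exists k.
by apply/prodf_eq0; exists k.
Qed.

(** The inverses converge by their own product estimate. At a pole all late terms and [cGamma z] are
    0, and [0^-1 = 0]; elsewhere the product of the two sequences is constantly 1, which identifies
    the limit. *)
Lemma gamV_cvg z : (fun n => normc ((gam n z)^-1 - (cGamma z)^-1)) @ \oo --> (0 : R).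
Proof.
have [l Hl] : exists l, (fun n => normc ((gam n z)^-1 - l)) @ \oo --> (0 : R).
  apply: (@cprod_cvg R (fun n => (gam n z)^-1) (gamV_err^~ z) (step_const (normc z))
    (gam_start (normc z))); first exact/step_const_ge0/normc_ge0.
  - by move=> m; exact: gamV_errE.
  - by move=> m; exact: gamV_err_le.
suff -> : (cGamma z)^-1 = l by exact: Hl.
have [[k zk]|nz] := pselect (exists k : nat, z + k%:R = 0).
  have g0 n : (k <= n)%N -> gam n z = 0.
    move=> kn; apply/eqP; rewrite gam_eq0; apply/existsP.
    by exists (Ordinal (kn : k < n.+1)%N) => /=; rewrite zk.
  have -> : cGamma z = 0.
    apply: (cvg_normc_unique (@gam_cvg z)); apply: cvg_near_cst; exists k => // n /= kn.
    by rewrite g0// subrr Normc.normc0.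
  apply: (@cvg_normc_unique R (fun n => (gam n z)^-1)) => //.
  apply: cvg_near_cst; exists k => // n /= kn.
  by rewrite g0// invr0 subrr Normc.normc0.
have gn0 n : gam n z != 0.
  rewrite gam_eq0; apply/existsP => -[j /eqP zj]; apply: nz; by exists j.
have gl : cGamma z * l = 1.
  apply: (@cvg_normc_unique R (fun n => gam n z * (gam n z)^-1)); last first.
    by under eq_fun do rewrite divff// subrr Normc.normc0; exact: cvg_cst.
  exact: (cvg_normcM (@gam_cvg z) Hl).
have G0 : cGamma z != 0 by apply/eqP => G0; move: gl; rewrite G0 mul0r => /eqP;
  rewrite eq_sym oner_eq0.
by rewrite -[l]mul1r -(mulVf G0) -mulrA gl mulr1.
Qed.

(** If [cGamma z] were 0, the approximants and their inverses would both tend to 0, although their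
    product is 1. *)
Lemma cGamma_neq0 z : (forall k : nat, z + k%:R != 0) -> cGamma z != 0.
Proof.
move=> nz; apply/eqP => G0; have := @gam_cvg z; have := @gamV_cvg z.
rewrite G0 invr0 => H1 H2.
have := cvg_normcM H2 H1; rewrite mulr0 => H3.
have : (0 : R[i]) = 1.
  apply: (cvg_normc_unique H3); apply: cvg_near_cst; apply: nearW => n.
  rewrite divff ?subrr ?Normc.normc0//.
  by rewrite gam_eq0; apply/existsP => -[k /eqP zk]; have := nz k; rewrite zk eqxx.
by move/eqP; rewrite eq_sym oner_eq0.
Qed.

(** The index 0 is set apart because [ln 0 = 0] by convention, so that [exp (ln n) = n] fails
    there. *)
Lemma gam_shift n z : z != 0 ->
  gam n (z + 1) = z * gam n z * (n%:R / (z + n.+1%:R)) \/ n = 0%N.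
Proof.
move=> z0; have [->|n0] := eqVneq n 0%N; [by right|left].
rewrite /gam mulrDl mul1r cexpD.
have -> : cexp (ln n%:R)%:C = n%:R :> R[i].
  rewrite /cexp /= cos0 sin0 mulr1 mulr0 lnK ?posrE ?ltr0n ?lt0n//.
  by rewrite -(rmorph_nat (real_complex R)).
have -> : \prod_(k < n.+1) (z + 1 + k%:R) = \prod_(k < n) (z + k.+1%:R) * (z + n.+1%:R).
  rewrite big_ord_recr /= -addrA nat1r; congr (_ * _).
  by apply: eq_bigr => k _; rewrite -addrA nat1r.
rewrite big_ord_recl /= addr0 !invfM.
rewrite (_ : \prod_(i < n) (z + (bump 0 i)%:R) = \prod_(k < n) (z + k.+1%:R)) //.
rewrite ![z^-1 * _]mulrC; set P := (\prod_(k < n) _)^-1.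
rewrite (_ : z * (_ * (P * z^-1)) = (z / z) * (n`!%:R * cexp (z * (ln n%:R)%:C) *
  P)); last by ring.
by rewrite divff//; ring.
Qed.

(** The limit of [gam_shift], as [n / (z + n + 1)] tends to 1. At a pole [z] other than 0 both sides
    have the default value 0. *)
Lemma cGammaS z : z != 0 -> cGamma (z + 1) = z * cGamma z.
Proof.
move=> z0; apply: (cvg_normc_unique (@gam_cvg (z + 1))).
have r1 : (fun n => normc (n%:R / (z + n.+1%:R) - 1)) @ \oo --> (0 : R).
  have H : (fun n => normc (z + 1) * 2 * n.+1%:R^-1) @ \oo --> (normc (z + 1) * 2 *
    0 : R).
    by apply: cvgM; [exact: cvg_cst|exact: cvg_harmonic].
  rewrite mulr0 in H; apply: (@squeeze_cvgr _ _ _ _ (cst 0) _ _ _ _ (cvg_cst _) H).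
  exists (gam_start (normc z)) => // n /= h; rewrite normc_ge0/=.
  have [n0 rn] := gam_start_le (normc_ge0 z) h.
  have hz := norm_le_half (lexx (normc z)) rn.
  have p0 : 0 < n.+1%:R / 2 :> R by rewrite divr_gt0.
  have nz : z + n.+1%:R != 0 by rewrite -normc_gt0 (lt_le_trans p0).
  rewrite (_ : _ - 1 = - (z + 1) / (z + n.+1%:R)); last first.
    by apply: (mulIf nz); rewrite mulrBl !divfK// mul1r -natr1; ring.
  rewrite Normc.normcM normcN Normc.normcV -mulrA ler_wpM2l ?normc_ge0//.
  rewrite -[2 / _]invrK lef_pV2 ?posrE.
  - by rewrite invfM invrK mulrC.
  - exact: lt_le_trans hz.
  - by rewrite invr_gt0 divr_gt0.
have := cvg_normcM (cvg_normcMl z (@gam_cvg z)) r1; rewrite mulr1.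
apply: cvg_trans; apply: near_eq_cvg; exists 1%N => // n /= n1.
have [->//|n0] := gam_shift n z0.
by move: n1; rewrite n0.
Qed.

End EulerSequence.

(** * Holomorphy and local bounds of Euler's approximants *)

Section EulerSequenceHolomorphic.
Context {R : realType}.
Implicit Types (z : R[i]) (n : nat) (r : R).

Lemma derivable_cstc (k z : R[i]) : (fun=> k) \dat z.
Proof. exact: (@derivable_cst R[i] R[i]^o R[i]^o k z 1). Qed.

Lemma derivable_addc (k z : R[i]) : (fun w => w + k) \dat z.
Proof.
have := @derivable_linear R k 1 z.
by rewrite (_ : (fun v => 1 * v + k) = (fun w => w + k))//; apply/funext => w;
  rewrite mul1r.
Qed.

Lemma derivable_cexpM (k z : R[i]) : (fun w => cexp (w * k)) \dat z.
Proof.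
have := @derivable_affine R k 0 (@cexp R) z (@derivable_cexp R _).
by rewrite (_ : (fun w => _) = (fun w => cexp (w * k)))//; apply/funext => w;
  rewrite addr0 mulrC.
Qed.

(** The inverse is a product of entire functions of [z], and the identity persists at the poles of
    [gam], where both sides are 0. *)
Lemma gamVE n z : (gam n z)^-1 =
  (n`!%:R)^-1 * cexp (z * - (ln n%:R)%:C) * \prod_(k < n.+1) (z + k%:R).
Proof. by rewrite /gam invfM invrK invfM mulrN cexpN. Qed.

Lemma derivable_gamV n z : (fun w => (gam n w)^-1) \dat z.
Proof.
rewrite (_ : (fun w => _) = (fun w => (n`!%:R)^-1 * cexp (w * - (ln n%:R)%:C) *
   \prod_(k <- index_enum 'I_n.+1) (w + (nat_of_ord k)%:R))); last first.
  by apply/funext => w; rewrite gamVE.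
apply: derivable_mulc.
  apply: derivable_mulc; first exact: derivable_cstc.
  exact: derivable_cexpM.
apply: (@derivable_prod R _ _ (fun k w => w + (nat_of_ord k)%:R)) => k.
exact: derivable_addc.
Qed.

Lemma derivable_gam n z : 0 < Re z -> gam n \dat z.
Proof.
move=> z0.
have nz : (gam n z)^-1 != 0.
  rewrite invr_eq0 gam_eq0; apply/existsP => -[k /eqP zk].
  have : Re (z + k%:R) = Re z + k%:R.
    by rewrite -(rmorph_nat (real_complex R)); case: (z).
  by rewrite zk /= => /esym/eqP; rewrite gt_eqF// ltr_wpDr.
have := @derivable_invc R (fun w => (gam n w)^-1) z nz (@derivable_gamV n z).
by rewrite (_ : (fun w => _) = gam n)//; apply/funext => w; rewrite invrK.
Qed.

Lemma expR_lnM_le n z r : normc z <= r ->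
  expR (Re (z * (ln n%:R)%:C)) <= expR (r * `|ln n%:R|).
Proof.
move=> zr; rewrite ler_expR; apply: (le_trans (ler_norm _)).
apply: (le_trans (le_Re_normc _)); rewrite Normc.normcM normc_real.
by rewrite ler_wpM2r.
Qed.

(** Only the approximant of index [m = gam_start r] remains to be bounded; each of its [m + 1]
    denominators has modulus at least [Re z >= q]. *)
Lemma gam_bounded (r q : R) : 0 < q -> exists M : R, forall n z,
  (gam_start r <= n)%N -> normc z <= r -> q <= Re z -> normc (gam n z) <= M.
Proof.
move=> q0; set m := gam_start r.
exists (m`!%:R * expR (r * `|ln m%:R|) * (q ^+ m.+1)^-1 * expR (step_const r)).
move=> n z mn zr qz; apply: (le_trans (gam_bound zr mn)).
rewrite ler_wpM2r ?expR_ge0// -/m /gam !Normc.normcM Normc.normcV.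
rewrite normc_nat normc_cexp normc_prod.
apply: ler_pM => //.
- by rewrite invr_ge0 prodr_ge0// => k _; exact: normc_ge0.
- by rewrite ler_wpM2l// expR_lnM_le.
rewrite lef_pV2 ?posrE ?exprn_gt0//; last first.
  apply: prodr_gt0 => k _; apply: (lt_le_trans q0); apply: (le_trans qz).
  apply: le_trans (le_Re_normc _); apply: le_trans (ler_norm _).
  by rewrite -(rmorph_nat (real_complex R)); case: (z) => x y /=; rewrite lerDl.
rewrite -[X in q ^+ X]card_ord -prodr_const ler_prod// => k _.
rewrite ltW//=; apply: (le_trans qz).
apply: le_trans (le_Re_normc _); apply: le_trans (ler_norm _).
by rewrite -(rmorph_nat (real_complex R)); case: (z) => x y /=; rewrite lerDl.
Qed.

Lemma gamV_bounded r : exists M : R, forall n z,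
  (gam_start r <= n)%N -> normc z <= r -> normc (gam n z)^-1 <= M.
Proof.
set m := gam_start r.
exists ((m`!%:R)^-1 * expR (r * `|ln m%:R|) * (\prod_(k < m.+1) (r + k%:R)) *
  expR (step_const r)).
move=> n z mn zr; apply: (le_trans (gamV_bound zr mn)).
rewrite ler_wpM2r ?expR_ge0// -/m gamVE !Normc.normcM Normc.normcV.
rewrite normc_nat normc_cexp normc_prod.
apply: ler_pM => //.
- by rewrite prodr_ge0// => k _; exact: normc_ge0.
- rewrite ler_wpM2l ?invr_ge0// mulrN -mulNr expR_lnM_le//.
  by rewrite normcN.
- apply: ler_prod => k _; rewrite normc_ge0/=.
  by apply: (le_trans (normcD _ _)); rewrite normc_nat lerD2r.
Qed.

End EulerSequenceHolomorphic.

(** * Stirling's estimate in vertical strips *)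

Section Trapezoid.
Context {R : realType}.
Implicit Types (t u v h : R) (n : nat).

(** This is [ln |u + i t|]. *)
Definition lnmod t u : R := ln (u ^+ 2 + t ^+ 2) / 2.

(** For [t > 0] and up to the constant [t pi / 2], the real part of [w log w - w] at
    [w = u + i t]. *)
Definition lnmod_prim t u : R := u * lnmod t u - u + t * atan (u / t).

Lemma sqD_gt0 t u : 0 < t -> 0 < u ^+ 2 + t ^+ 2.
Proof. by move=> t0; rewrite ltr_wpDl ?sqr_ge0// exprn_gt0. Qed.

Lemma is_derive_lnmod t u : 0 < t ->
  is_derive u 1 (lnmod t) (u / (u ^+ 2 + t ^+ 2)).
Proof.
move=> t0; have s0 := sqD_gt0 u t0.
have d1 : is_derive u 1 (fun v => v ^+ 2 + t ^+ 2) (2 * u).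
  apply: is_derive_eq; rewrite /GRing.scale/=. by ring.
have d2 := @is_derive1_comp R (@ln R) _ u _ _ (is_derive1_ln s0) d1.
have d3 := is_deriveZ (2^-1) d2.
rewrite (_ : lnmod t = 2^-1 \*: (@ln R \o (fun v => v ^+ 2 + t ^+ 2))).
  by apply: (is_derive_eq d3); rewrite -[LHS]/(2^-1 * _); field; rewrite gt_eqF.
by apply/funext => v; rewrite /lnmod mulrC.
Qed.

Lemma is_derive_lnmod' t u : 0 < t ->
  is_derive u 1 (fun v => v / (v ^+ 2 + t ^+ 2))
    ((t ^+ 2 - u ^+ 2) / (u ^+ 2 + t ^+ 2) ^+ 2).
Proof.
move=> t0; have s0 := sqD_gt0 u t0.
have d1 : is_derive u 1 (fun v => v ^+ 2 + t ^+ 2) (2 * u).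
  apply: is_derive_eq; rewrite /GRing.scale/=. by ring.
have d2 := @is_deriveV R (fun v => v ^+ 2 + t ^+ 2) u _ 1 (lt0r_neq0 s0) d1.
have d3 := is_deriveM (is_derive_id u 1) d2.
apply: (is_derive_eq d3); rewrite /GRing.scale/= mulr1; field.
by rewrite gt_eqF.
Qed.

Lemma is_derive_lnmod_prim t u : 0 < t ->
  is_derive u 1 (lnmod_prim t) (lnmod t u).
Proof.
move=> t0; have s0 := sqD_gt0 u t0.
have d1 := is_deriveM (is_derive_id u 1) (is_derive_lnmod u t0).
have d2 := is_deriveB d1 (is_derive_id u 1).
have d3 : is_derive u 1 (fun v => v / t) t^-1.
  have := is_deriveZ t^-1 (is_derive_id u 1).
  rewrite (_ : t^-1 \*: _ = fun v => v / t); last by apply/funext => v /=;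
    rewrite mulrC.
  by move=> h; apply: (is_derive_eq h); rewrite -[LHS]/(_ * _) mulr1.
have d4 := @is_derive1_comp R (@atan R) _ u _ _ (is_derive1_atan (u / t)) d3.
have d5 := is_deriveD d2 (is_deriveZ t d4).
apply: (is_derive_eq d5); rewrite /GRing.scale/= mulr1; field.
by rewrite !gt_eqF// addrC.
Qed.

Lemma MVT_bound (f df : R -> R) (a b M : R) : a <= b ->
  (forall x, a <= x <= b -> is_derive x 1 f (df x)) ->
  (forall x, a <= x <= b -> `|df x| <= M) -> `|f b - f a| <= M * (b - a).
Proof.
move=> ab fd fM.
have [||x] := @MVT_segment R f df a b ab.
- by move=> x; rewrite in_itv/= => /andP[? ?]; apply: fd; rewrite !ltW.
- apply: continuous_in_subspaceT => x; rewrite inE/= in_itv/= => /fd[].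
  by move=> /derivable1_diffP/differentiable_continuous.
- rewrite in_itv/= => xab ->; rewrite normrM (ger0_norm (_ : 0 <= b - a)) ?subr_ge0//.
  by rewrite ler_wpM2r ?subr_ge0// fM.
Qed.

(** Turns a second-derivative bound into a telescoping one: the increment of [atan] is
    [1 / (1 + x^2)] at some [x] with [|x - v| <= 1], and then [1 + x^2 <= 3 (1 + v^2)]. *)
Lemma atan_step u v : u <= v <= u + 1 ->
  (v ^+ 2 + 1)^-1 <= 3 * (atan (u + 1) - atan u).
Proof.
move=> /andP[uv vu].
have uu : u <= u + 1 by rewrite lerDl.
have [|x] := @MVT_segment R atan (fun x => (1 + x ^+ 2)^-1) u (u + 1) uu
  (fun x _ => is_derive1_atan x).
  by apply: continuous_subspaceT => x; exact: continuous_atan.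
rewrite in_itv/= => /andP[ux xu] ->.
have -> : u + 1 - u = 1 by ring.
rewrite mulr1.
have p1 : 0 < v ^+ 2 + 1 by rewrite ltr_wpDl// sqr_ge0.
have p2 : 0 < 1 + x ^+ 2 by rewrite ltr_pwDl// sqr_ge0.
rewrite ler_pdivlMr// mulrC ler_pdivrMr//.
have : 0 <= (1 - (x - v)) * (1 + (x - v)) by rewrite mulr_ge0//; lra.
by have := sqr_ge0 (v - (x - v)); nra.
Qed.

(** The second derivative of [lnmod t] is at most [1 / (v^2 + t^2) <= 1 / (v^2 + 1)] since [t >= 1],
    hence at most [S] on the interval. The error over [[u, u + h]], as a function [G] of [h],
    vanishes at 0, so a bound on its derivative suffices. *)
Lemma trapezoid_step t u : 1 <= t ->
  `|(lnmod t u + lnmod t (u + 1)) / 2 - (lnmod_prim t (u + 1) - lnmod_prim t u)|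
  <= 3 * (atan (u + 1) - atan u).
Proof.
move=> t1; have t0 : 0 < t by apply: lt_le_trans t1.
set S := 3 * _.
pose l' v := v / (v ^+ 2 + t ^+ 2).
have D2 v : u <= v <= u + 1 ->
    `|(t ^+ 2 - v ^+ 2) / (v ^+ 2 + t ^+ 2) ^+ 2| <= S.
  move=> uv; apply: le_trans (atan_step uv).
  have v0 := sqr_ge0 v; have tt : 1 <= t ^+ 2 by rewrite exprn_ege1.
  have s0 : 0 < v ^+ 2 + t ^+ 2 by rewrite ltr_wpDl// exprn_gt0.
  apply: (@le_trans _ _ (v ^+ 2 + t ^+ 2)^-1); last first.
    by rewrite lef_pV2 ?posrE// ?lerD2l// ltr_wpDl.
  have s1 := ltW s0.
  rewrite normrM [X in _ * X]ger0_norm ?invr_ge0 ?exprn_ge0//.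
  rewrite [X in _ / X]expr2 invfM mulrA ler_piMl ?invr_ge0//.
  rewrite ler_pdivrMr// mul1r ler_norml; apply/andP; split; lra.
have S0 : 0 <= S.
  by have := D2 u; rewrite lexx lerDl ler01 => /(_ isT); exact: le_trans.
pose G h := lnmod_prim t (u + h) - lnmod_prim t u - h / 2 * (lnmod t u + lnmod t (u
  + h)).
pose G' h := lnmod t (u + h) - (lnmod t u + lnmod t (u + h)) / 2 - h / 2 * l' (u + h).
have dS h : is_derive h 1 (fun x : R => u + x) 1.
  by apply: (is_derive_eq (is_deriveD (is_derive_cst u h 1) (is_derive_id h 1)));
    rewrite add0r.
have dG h : is_derive h 1 G (G' h).
  have d1 := @is_derive1_comp R (lnmod_prim t) _ h _ _ (is_derive_lnmod_prim (u +
    h) t0) (dS h).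
  have d2 := @is_derive1_comp R (lnmod t) _ h _ _ (is_derive_lnmod (u + h) t0) (dS h).
  have d3 : is_derive h 1 (fun x : R => x / 2) 2^-1.
    have := is_deriveZ 2^-1 (is_derive_id h 1).
    rewrite (_ : 2^-1 \*: _ = fun v => v / 2); last by apply/funext => v /=;
      rewrite mulrC.
    by move=> H; apply: (is_derive_eq H); rewrite -[LHS]/(_ * _) mulr1.
  have d4 := is_deriveM d3 (is_deriveD (is_derive_cst (lnmod t u) h 1) d2).
  have d5 := is_deriveB (is_deriveB d1 (is_derive_cst (lnmod_prim t u) h 1)) d4.
  apply: (is_derive_eq d5);
    rewrite /GRing.scale/= /G' /l' -[(cst _ + _) h]/(lnmod t u + lnmod t (u + h));
      field.
  by rewrite gt_eqF// sqD_gt0.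
have G'le h : 0 <= h <= 1 -> `|G' h| <= S.
  move=> /andP[h0 h1].
  have -> : G' h = ((lnmod t (u + h) - lnmod t u) - h * l' (u + h)) / 2.
    by rewrite /G'; field.
  (* Twice [G' h] is the error of the tangent taken at [u + h], that is, an increment of
     [lnmod t v - v l' (u + h)], whose derivative is controlled by a second use of the mean value
     bound. *)
  have := @MVT_bound (fun v => lnmod t v - v * l' (u + h)) (fun v => l' v - l' (u + h))
    u (u + h) S.
  rewrite lerDl h0 => /(_ isT) H.
  have {}H : `|lnmod t (u + h) - (u + h) * l' (u + h) -
             (lnmod t u - u * l' (u + h))| <= S * (u + h - u).
    apply: H => v /andP[uv vuh].
      have e1 := is_deriveB (is_derive_lnmod v t0)
        (is_deriveM (is_derive_id v 1) (is_derive_cst (l' (u + h)) v 1)).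
      by apply: (is_derive_eq e1); rewrite /GRing.scale/= mulr0 mulr1 add0r.
    rewrite distrC; have := @MVT_bound l' _ v (u + h) S vuh.
    have K x : v <= x <= u + h -> is_derive x 1 l' ((t ^+ 2 - x ^+ 2) / (x ^+ 2 + t
      ^+ 2) ^+ 2).
      by move=> _; exact: is_derive_lnmod'.
    move=> /(_ _ K) H2; apply: (le_trans (H2 _)).
      by move=> x /andP[? ?]; apply: D2; apply/andP; split; lra.
    by rewrite ler_piMr//; lra.
  have e : u + h - u = h by ring.
  rewrite e in H.
  rewrite (_ : lnmod t (u + h) - lnmod t u - h * l' (u + h) =
    lnmod t (u + h) - (u + h) * l' (u + h) - (lnmod t u - u * l' (u + h)));
      last by ring.
  rewrite normrM [X in _ * X]ger0_norm// ler_pdivrMr//; apply: (le_trans H).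
  by rewrite ler_wpM2l//; lra.
have := @MVT_bound G G' 0 1 S ler01 (fun x _ => dG x) G'le.
rewrite /G addr0 !mul0r subrr !subr0 mulr1 => H.
rewrite distrC (_ : _ - _ / 2 = lnmod_prim t (u + 1) - lnmod_prim t u -
  1 / 2 * (lnmod t u + lnmod t (u + 1))); first exact: H.
by field.
Qed.

(** The errors telescope in [atan], so they stay below [3 pi] whatever [n] is. *)
Lemma trapezoid_sum t u n : 1 <= t ->
  `|\sum_(k < n.+1) lnmod t (u + k%:R) - (lnmod t u + lnmod t (u + n%:R)) / 2 -
    (lnmod_prim t (u + n%:R) - lnmod_prim t u)| <= 3 * (atan (u + n%:R) - atan u).
Proof.
move=> t1; elim: n => [|n ih].
  rewrite big_ord1 addr0 !subrr mulr0 subr0 (_ : _ - _ = 0) ?normr0//.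
  by field.
rewrite big_ord_recr /= -natr1 addrA.
have st := trapezoid_step (u + n%:R) t1.
set s := \sum_(_ < _) _ in ih *.
rewrite (_ : 3 * (atan (u + n%:R + 1) - atan u) = 3 * (atan (u + n%:R) - atan u) +
  3 * (atan (u + n%:R + 1) - atan (u + n%:R))); last by ring.
apply: le_trans (lerD ih st); apply: le_trans (ler_normD _ _).
rewrite le_eqVlt; apply/orP; left; apply/eqP; congr (`|_|); by field.
Qed.

End Trapezoid.

(** * Asymptotics of the logarithm of Euler's product *)

Section Stirling.
Context {R : realType}.
Implicit Types (t u v B s : R) (n : nat) (z : R[i]).

Lemma norm_ln1D_le v : `|v| <= 2^-1 -> `|ln (1 + v)| <= 2 * `|v|.
Proof.
move=> v2; have := v2; rewrite ler_norml => /andP[va vb].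
have p0 : 0 < 1 + v by lra.
have up : ln (1 + v) <= v by apply: le_ln1Dx; lra.
have lo : - ln (1 + v) <= - (v / (1 + v)).
  rewrite -lnV ?posrE//.
  rewrite [X in ln X](_ : _ = 1 + - (v / (1 + v))); last by field; rewrite gt_eqF.
  apply: le_ln1Dx; rewrite ltrN2 ltr_pdivrMr//; lra.
have vv : `|v / (1 + v)| <= 2 * `|v|.
  rewrite normrM mulrC ler_wpM2r// ger0_norm ?invr_ge0 ?(ltW p0)//.
  by rewrite invf_ple ?posrE//; lra.
have := ler_norm v; have := ler_norm (- (v / (1 + v))); rewrite normrN => *.
by rewrite ler_norml; apply/andP; split; lra.
Qed.

Lemma norm_atan_le v : `|atan v| <= `|v|.
Proof.
wlog v0 : v / 0 <= v.
  move=> H; have [/H//|/ltW v0] := leP 0 v.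
  by rewrite -(normrN v) -(normrN (atan v)) -atanN H// oppr_ge0.
have := @MVT_bound R atan (fun x => (1 + x ^+ 2)^-1) 0 v 1 v0.
rewrite atan0 !subr0 mul1r => H; rewrite (ger0_norm v0).
apply: H => x _.
have p : 1 <= 1 + x ^+ 2 by rewrite lerDl sqr_ge0.
by rewrite ger0_norm ?invr_ge0 ?(le_trans ler01 p)// invf_le1// (lt_le_trans _ p).
Qed.

Lemma lnmodE t u : 0 < t -> lnmod t u = ln t + ln (1 + (u / t) ^+ 2) / 2.
Proof.
move=> t0; rewrite /lnmod.
have -> : u ^+ 2 + t ^+ 2 = t ^+ 2 * (1 + (u / t) ^+ 2) by field; rewrite gt_eqF.
rewrite lnM ?posrE ?exprn_gt0//; last by rewrite ltr_pwDl// sqr_ge0.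
by rewrite lnXn// -mulr_natr; field.
Qed.

Lemma lnmodC t u : lnmod t u = lnmod u t.
Proof. by rewrite /lnmod addrC. Qed.

Lemma ln1D_sq_bounds v : 0 <= ln (1 + v ^+ 2) / 2 <= v ^+ 2 / 2.
Proof.
rewrite divr_ge0 ?ln_ge0 ?lerDl ?sqr_ge0//= ler_pM2r//.
by apply: le_ln1Dx; apply: lt_le_trans (sqr_ge0 _).
Qed.

(** The lower end of the trapezoidal sum, source of the power [t^(s - 1/2)]: with
    [lnmod t s = ln t + d], what is left is [(s - 1/2) d - s + t atan (s / t)], bounded because
    [0 <= d <= B^2] and [|atan v| <= |v|]. *)
Lemma lnmod_bottom B t s : `|s| <= B -> 1 <= t ->
  `|lnmod_prim t s - lnmod t s / 2 - (s - 2^-1) * ln t| <= (B + 1) * B ^+ 2 + 2 * B.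
Proof.
move=> sB t1; have t0 : 0 < t by apply: lt_le_trans t1.
have B0 : 0 <= B by apply: le_trans sB.
rewrite /lnmod_prim lnmodE//; set d := ln (1 + _) / 2.
have dB : `|d| <= B ^+ 2.
  have /andP[d0 d1] := ln1D_sq_bounds (s / t); rewrite ger0_norm//.
  apply: (le_trans d1); apply: (@le_trans _ _ ((s / t) ^+ 2)).
    by rewrite ler_pdivrMr// ler_peMr ?sqr_ge0// ler1n.
  rewrite -real_normK ?num_real// ler_sqr ?nnegrE// normrM.
  rewrite normfV (gtr0_norm t0) ler_pdivrMr//; apply: (le_trans sB).
  by rewrite ler_peMr.
rewrite (_ : _ - _ - _ = (s - 2^-1) * d + (- s + t * atan (s / t))); last by field.
apply: (le_trans (ler_normD _ _)); apply: lerD.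
  rewrite normrM; apply: ler_pM => //.
  apply: (le_trans (ler_normB _ _)); rewrite [X in _ + X]ger0_norm//.
  by rewrite lerD// invf_le1// ler1n.
rewrite mulr_natl mulr2n; apply: (le_trans (ler_normD _ _)); rewrite normrN lerD//.
rewrite normrM (gtr0_norm t0); apply: (@le_trans _ _ (t * `|s / t|)).
  by rewrite ler_wpM2l ?(ltW t0)// norm_atan_le.
by rewrite normrM normfV (gtr0_norm t0) mulrC divfK// gt_eqF.
Qed.

(** The upper end, with [t] fixed and [u] large: the limit [pi / 2] of [atan] is the source of the
    decay [exp (- t pi / 2)]. *)
Lemma lnmod_top t : 1 <= t -> exists U : R, forall u, U <= u ->
  `|lnmod t u / 2 + lnmod_prim t u - ((u + 2^-1) * ln u - u + t * (pi / 2))| <= 2.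
Proof.
move=> t1; have t0 : 0 < t by apply: lt_le_trans t1.
have [V HV] : exists V : R, forall v, V <= v -> t * (pi / 2 - atan v) <= 1.
  have /cvgrPdist_le /(_ t^-1) := @cvgy_atan R.
  rewrite invr_gt0 => /(_ t0)[V [_ HV]]; exists (V + 1) => v Vv.
  have := HV v; have Vv' : V < v by lra.
  move=> /(_ Vv') h; rewrite mulrC -ler_pdivlMr// mul1r.
  exact: le_trans (ler_norm _) h.
(* For [u >= t^2] the term [(u + 1/2) d], with [d <= (t / u)^2 / 2], is at most 1; for [u >= t V]
   the deficit of [atan (u / t)] costs at most 1. *)
exists (Num.max (t ^+ 2) (t * V)) => u; rewrite ge_max => /andP[tu Vu].
have u1 : 1 <= u by apply: le_trans tu; rewrite exprn_ege1.
have u0 : 0 < u by apply: lt_le_trans u1.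
rewrite /lnmod_prim lnmodC (lnmodE _ u0); set d := ln (1 + _) / 2.
have /andP[d0 d1] := ln1D_sq_bounds (t / u).
have dB : 0 <= (u + 2^-1) * d <= 1.
  rewrite mulr_ge0 ?addr_ge0 ?(ltW u0)//=.
  apply: (@le_trans _ _ ((u + 2^-1) * ((t / u) ^+ 2 / 2))).
    by rewrite ler_wpM2l// addr_ge0// ltW.
  rewrite (_ : _ * _ = ((u + 2^-1) * t ^+ 2) / (2 * u ^+ 2)); last by field;
    rewrite gt_eqF.
  rewrite ler_pdivrMr ?mulr_gt0 ?exprn_gt0// mul1r.
  by nra.
have aB : 0 <= t * (pi / 2 - atan (u / t)) <= 1.
  rewrite mulr_ge0 ?(ltW t0) ?subr_ge0 ?(ltW (atan_ltpi2 _))//=.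
  by apply: HV; rewrite ler_pdivlMr// mulrC.
rewrite (_ : _ - _ = (u + 2^-1) * d - t * (pi / 2 - atan (u / t))); last by field.
move: dB aB => /andP[? ?] /andP[? ?].
by rewrite ler_norml; apply/andP; split; lra.
Qed.

(** Replacing [ln (s + n)] by [ln n] leaves the [s]-dependence of the upper end in the single term
    [s ln n], which cancels the factor [n^s] of Euler's product. *)
Lemma stirling_shift B s n : `|s| <= B -> 2 * B + 1 <= n%:R ->
  `|(s + n%:R + 2^-1) * ln (s + n%:R) - (s + n%:R) -
    ((s + n%:R + 2^-1) * ln n%:R - n%:R)| <= 5 * B.
Proof.
move=> sB nB; have B0 : 0 <= B by apply: le_trans sB.
have n1 : 1 <= n%:R :> R by lra.
have n0 : 0 < n%:R :> R by lra.
have := sB; rewrite ler_norml => /andP[s1 s2].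
have -> : s + n%:R = n%:R * (1 + s / n%:R) by field; rewrite gt_eqF.
have sn : `|s / n%:R| <= B / n%:R.
  by rewrite normrM normfV (gtr0_norm n0) ler_pM2r// invr_gt0.
have snh : `|s / n%:R| <= 2^-1.
  by apply: (le_trans sn); rewrite ler_pdivrMr//; lra.
have lB := norm_ln1D_le snh.
have := snh; rewrite ler_norml => /andP[s3 s4].
rewrite lnM ?posrE//; last by lra.
set l := ln (1 + _) in lB *.
rewrite (_ : _ - _ = (n%:R * (1 + s / n%:R) + 2^-1) * l - s); last by field;
  rewrite gt_eqF.
apply: (le_trans (ler_normB _ _)).
rewrite (_ : 5 * B = 4 * B + B); last by ring.
apply: lerD => //; rewrite normrM.
have e : n%:R * (1 + s / n%:R) = n%:R + s by field; rewrite gt_eqF.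
rewrite e; apply: (@le_trans _ _ ((2 * n%:R) * (2 * (B / n%:R)))); last first.
  by rewrite le_eqVlt; apply/orP; left; apply/eqP; field; rewrite gt_eqF.
apply: ler_pM => //.
  by rewrite ger0_norm; lra.
by apply: (le_trans lB); rewrite ler_wpM2l.
Qed.

(** The logarithm of [|gam n z| / n!] for [s = Re z] and [t = |Im z|]. *)
Definition gam_log t s n : R :=
  s * ln n%:R - \sum_(k < n.+1) lnmod t (s + k%:R).

(** [C] depends on [B] only and adds up four errors: trapezoidal rule, lower end, upper end and
    shift. The index [N] may depend on [t] and [s], since [n] goes to infinity at a fixed point. *)
Lemma gam_log_asymp B : exists C : R, forall t s, `|s| <= B -> 1 <= t ->
  exists N : nat, forall n, (N <= n)%N ->
  `|gam_log t s n - (n%:R - (n%:R + 2^-1) * ln n%:R) -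
    ((s - 2^-1) * ln t - t * (pi / 2))| <= C.
Proof.
exists (3 * pi + ((B + 1) * B ^+ 2 + 2 * B) + 2 + 5 * B) => t s sB t1.
have B0 : 0 <= B by apply: le_trans sB.
have [U HU] := lnmod_top t1.
exists (Num.bound (Num.max (U + B) (2 * B + 1))).+1 => n Nn.
have Hn : Num.max (U + B) (2 * B + 1) <= n%:R.
  apply: (@le_trans _ _ (Num.bound (Num.max (U + B) (2 * B + 1)))%:R); last first.
    by rewrite ler_nat ltnW.
  apply/ltW/archi_boundP; rewrite le_max; apply/orP; right; lra.
move: Hn; rewrite ge_max => /andP[n1 n2].
have := sB; rewrite ler_norml => /andP[s1 s2].
have h1 := trapezoid_sum s n t1.
have h2 := lnmod_bottom sB t1.
have h3 : U <= s + n%:R by lra.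
have {}h3 := HU _ h3.
have h4 := stirling_shift sB n2.
have h5 : `|\sum_(k < n.+1) lnmod t (s + k%:R) - (lnmod t s + lnmod t (s + n%:R)) / 2 -
    (lnmod_prim t (s + n%:R) - lnmod_prim t s)| <= 3 * pi.
  apply: (le_trans h1); rewrite ler_wpM2l//.
  have := atan_gtNpi2 s; have := atan_ltpi2 (s + n%:R).
  by lra.
rewrite /gam_log; set S := \sum_(_ < _) _ in h5 *.
rewrite (_ : _ - _ = - (S - (lnmod t s + lnmod t (s + n%:R)) / 2 -
    (lnmod_prim t (s + n%:R) - lnmod_prim t s)) +
  (lnmod_prim t s - lnmod t s / 2 - (s - 2^-1) * ln t) -
  (lnmod t (s + n%:R) / 2 + lnmod_prim t (s + n%:R) -
    ((s + n%:R + 2^-1) * ln (s + n%:R) - (s + n%:R) + t * (pi / 2))) -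
  ((s + n%:R + 2^-1) * ln (s + n%:R) - (s + n%:R) -
    ((s + n%:R + 2^-1) * ln n%:R - n%:R))); last by field.
apply: (le_trans (ler_normB _ _)); apply: lerD => //.
apply: (le_trans (ler_normB _ _)); apply: lerD => //.
apply: (le_trans (ler_normD _ _)); rewrite normrN; exact: lerD.
Qed.

End Stirling.

(** * Bounds for Gamma and its inverse along horizontal lines of the strip *)

Section GammaBounds.
Context {R : realType}.
Implicit Types (t u x y B : R) (n : nat) (z al : R[i]).

Lemma normc_lnmod z n : Im z != 0 ->
  normc (z + n%:R) = expR (lnmod `|Im z| (Re z + n%:R)).
Proof.
move=> z0; rewrite -(rmorph_nat (real_complex R)); case: z z0 => a b /= b0.
rewrite addr0 /lnmod real_normK ?num_real//.
have p0 : 0 < (a + n%:R) ^+ 2 + b ^+ 2 by rewrite ltr_wpDl ?sqr_ge0// exprn_even_gt0.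
set p := _ + _ in p0 *.
have e : p = expR (ln p / 2) ^+ 2.
  by rewrite -expRM_natl -mulrC divfK// lnK.
by rewrite {1}e sqrtr_sqr ger0_norm// expR_ge0.
Qed.

Lemma normc_gam n z : (0 < n)%N -> Im z != 0 ->
  normc (gam n z) = n`!%:R * expR (gam_log `|Im z| (Re z) n).
Proof.
move=> n0 z0; rewrite /gam !Normc.normcM Normc.normcV normc_nat normc_cexp normc_prod.
rewrite -mulrA; congr (_ * _).
have -> : Re (z * (ln n%:R)%:C) = Re z * ln n%:R.
  by case: (z) => a b /=; rewrite mulr0 subr0.
rewrite /gam_log expRD expRN; congr (_ * _^-1).
rewrite expR_sum; apply: eq_bigr => k _; exact: normc_lnmod.
Qed.

(** Stirling's main term [|Im z|^(Re z - 1/2) exp (- pi |Im z| / 2)], without its constant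
    factor. *)
Definition stirling_size z : R :=
  expR ((Re z - 2^-1) * ln `|Im z| - `|Im z| * (pi / 2)).

(** The part of [gam_log] that grows with [n] does not depend on [z], so it
    cancels in the comparison with [z = 1 + i] and no estimate of [n`!] is
    needed. *)
Lemma stirling_strip B : exists c1 c2 : R, [/\ 0 < c1, 0 < c2 &
  forall z, `|Re z| <= B -> 1 <= `|Im z| ->
  c1 * stirling_size z <= normc (cGamma z) <= c2 * stirling_size z].
Proof.
(* The maximum with 1 also covers the real part of the reference point [1 + i]. *)
have [C HC] := @gam_log_asymp R (Num.max B 1).
pose z0 : R[i] := 1 +i* 1.
have G0 : 0 < normc (cGamma z0).
  rewrite normc_gt0 cGamma_neq0// => k.
  rewrite -(rmorph_nat (real_complex R)) -normc_gt0.
  apply: lt_le_trans (le_Im_normc _).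
  by rewrite /= addr0 normr1.
set G := normc (cGamma z0) in G0.
(* The error [C] occurs once at [z] and once at [z0]; [pi / 2] undoes the main term [- pi / 2] of
   the reference point. *)
exists (G * expR (pi / 2 - 2 * C)), (G * expR (pi / 2 + 2 * C)).
split; [by rewrite mulr_gt0 ?expR_gt0|by rewrite mulr_gt0 ?expR_gt0|].
move=> z zB z1; rewrite /stirling_size.
have iz : Im z != 0 by rewrite -normr_gt0 (lt_le_trans _ z1).
have [|//|N1 HN1] := HC `|Im z| (Re z); first by rewrite le_max zB.
have [|//|N2 HN2] := HC 1 1; first by rewrite le_max normr1 lexx orbT.
set L := _ - _ * (pi / 2); set E := expR L.
have K n : (maxn (maxn N1 N2) 1 <= n)%N ->
  normc (gam n z0) * expR (pi / 2 - 2 * C) * E <= normc (gam n z) /\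
  normc (gam n z) <= normc (gam n z0) * expR (pi / 2 + 2 * C) * E.
  rewrite !geq_max => /andP[/andP[n1 n2] n0].
  have := HN1 n n1; have := HN2 n n2.
  rewrite !normc_gam//= ?oner_eq0// normr1 ln1 mulr0 sub0r.
  rewrite -/L; set A := n%:R - _ * _.
  move: (gam_log `|Im z| (Re z) n) (gam_log 1 1 n) => g1 g2.
  rewrite !ler_norml => /andP[? ?] /andP[? ?].
  rewrite -!mulrA -!expRD !ler_pM2l ?ltr0n ?fact_gt0// !ler_expR.
  by split; lra.
have cz := cvg_normc_norm (gam_cvg z); have cz0 := cvg_normc_norm (gam_cvg z0).
have cE (k : R) : (fun n => normc (gam n z0) * k * E) @ \oo --> G * k * E.
  by apply: cvgM; [apply: cvgM => //; exact: cvg_cst|exact: cvg_cst].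
apply/andP; split.
- apply: (ler_cvg_to (cE _) cz); exists (maxn (maxn N1 N2) 1) => // n /= /K[]//.
- apply: (ler_cvg_to cz (cE _)); exists (maxn (maxn N1 N2) 1) => // n /= /K[]//.
Qed.

(** Stirling's size in terms of [x = Re z] for the argument [al + i z], made positive and continuous
    at 0 by the bracket. *)
Definition gamma_size p x : R := bracket p x * expR (- (pi / 2 * `|x|)).

Lemma gamma_size_gt0 p x : 0 < gamma_size p x.
Proof. by rewrite mulr_gt0 ?expR_gt0 ?bracket_gt0. Qed.

Lemma bracketE p x : bracket p x = expR (p * ln (1 + `|x|)).
Proof. by rewrite /bracket /powR gt_eqF// bracket_base. Qed.

Lemma Re_shift al x y : Re (al + 'i * (x +i* y)) = Re al - y.
Proof. by case: al => a b /=; simpc. Qed.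

Lemma Im_shift al x y : Im (al + 'i * (x +i* y)) = Im al + x.
Proof. by case: al => a b /=; simpc. Qed.

(** Transfers Stirling's bound from [t = |Im al + x|] to [|x|]. The threshold [2 |Im al| + 2] gives
    [|x| / 2 <= t <= 2 |x|] and [t >= 1], so [t] and [1 + |x|] agree up to a factor 4. *)
Lemma gamma_large al : exists c1 c2 X : R, [/\ 0 < c1, 0 < c2 &
  forall x y, -1 <= y <= 0 -> X <= `|x| ->
  c1 * gamma_size (Re al - y - 2^-1) x <= normc (cGamma (al + 'i * (x +i* y)))
  <= c2 * gamma_size (Re al - y - 2^-1) x].
Proof.
have [c1 [c2 [c10 c20 H]]] := stirling_strip (`|Re al| + 1).
(* The power changes by at most [|p| ln 4] in the exponent, where [|p| <= |Re al| + 2], and the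
   exponential by at most [|Im al| pi / 2]. *)
pose D : R := (`|Re al| + 2) * ln 4 + `|Im al| * (pi / 2).
exists (c1 * expR (- D)), (c2 * expR D), (2 * `|Im al| + 2).
split; [by rewrite mulr_gt0 ?expR_gt0|by rewrite mulr_gt0 ?expR_gt0|].
move=> x y /andP[y1 y2] Xx; set T := gamma_size _ _.
have := H (al + 'i * (x +i* y)); rewrite /stirling_size Re_shift Im_shift.
set p := Re al - y - 2^-1.
have yB : `|Re al - y| <= `|Re al| + 1.
  by apply: (le_trans (ler_normB _ _)); rewrite lerD2l ler_norml; apply/andP;
    split; lra.
have i0 := normr_ge0 (Im al).
have t1 : `|x| / 2 <= `|Im al + x|.
  have := ler_normB (Im al + x) (Im al); rewrite addrC addKr; lra.
have t2 : `|Im al + x| <= 2 * `|x|.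
  by apply: (le_trans (ler_normD _ _)); lra.
move=> /(_ yB) H'; have {}H' := H' _.
have t3 : 1 <= `|Im al + x| by lra.
move: (H' t3); rewrite -/p => /andP[l1 l2].
set t := `|Im al + x| in t1 t2 t3 l1 l2.
have t0 : 0 < t by apply: lt_le_trans t3.
have b0 : 0 < 1 + `|x| by exact: bracket_base.
have lnB : `|ln t - ln (1 + `|x|)| <= ln 4.
  rewrite ler_norml; apply/andP; split.
    rewrite lerNl opprB lerBlDr -lnM ?posrE// ler_ln ?posrE ?mulr_gt0//; lra.
  by rewrite lerBlDr -lnM ?posrE// ler_ln ?posrE ?mulr_gt0//; lra.
have ln40 : 0 <= ln 4 :> R by rewrite ln_ge0// ler1n.
have pB : `|p| <= `|Re al| + 2.
  by apply: (le_trans (ler_normB _ _)); rewrite [X in _ + X]ger0_norm//; lra.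
have DB : `|(p * ln t - t * (pi / 2)) - (p * ln (1 + `|x|) - pi / 2 * `|x|)| <= D.
  rewrite (_ : _ - _ = p * (ln t - ln (1 + `|x|)) - (t - `|x|) * (pi / 2));
    last by ring.
  apply: (le_trans (ler_normB _ _)); rewrite normrM [X in _ + X]normrM; apply: lerD.
    by apply: ler_pM.
  have pi0 : 0 <= pi / 2 :> R by rewrite divr_ge0// pi_ge0.
  rewrite (ger0_norm pi0) ler_wpM2r// /t.
  by apply: (le_trans (ler_dist_dist _ _)); rewrite addrK.
have TE : T = expR (p * ln (1 + `|x|) - pi / 2 * `|x|).
  by rewrite /T /gamma_size bracketE expRD.
move: DB; rewrite ler_norml => /andP[d1 d2].
rewrite TE -!mulrA -!expRD; apply/andP; split.
- apply: le_trans l1; rewrite ler_pM2l// ler_expR; lra.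
- apply: (le_trans l2); rewrite ler_pM2l// ler_expR; lra.
Qed.

Lemma normc_shift_le al x y X : -1 <= y <= 0 -> `|x| <= X ->
  normc (al + 'i * (x +i* y)) <= normc al + (X + 1).
Proof.
move=> /andP[y1 y2] xX; apply: (le_trans (normcD _ _)); rewrite lerD2l.
rewrite Normc.normcM normc_i mul1r; apply: (le_trans (normc_le_ReIm _)).
by rewrite /= lerD// ler_norml; apply/andP; split; lra.
Qed.

Lemma gamma_size_compact q X : exists k : R, 0 < k /\ forall p x,
  `|p| <= q -> `|x| <= X -> k <= gamma_size p x /\ gamma_size p x <= k^-1.
Proof.
exists (expR (- (q * ln (1 + X) + pi / 2 * X))); split; first exact: expR_gt0.
move=> p x pq xX; rewrite -expRN opprK.
rewrite /gamma_size bracketE -expRD !ler_expR.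
have l0 : 0 <= ln (1 + `|x|) by rewrite ln_ge0// lerDl.
have X0 : 0 <= X by apply: le_trans xX.
have l1 : ln (1 + `|x|) <= ln (1 + X).
  by rewrite ler_ln ?posrE ?bracket_base ?lerD2l// ltr_pwDl.
have : `|p * ln (1 + `|x|)| <= q * ln (1 + X).
  by rewrite normrM (ger0_norm l0) ler_pM.
rewrite ler_norml => /andP[? ?].
have pi0 : 0 <= pi / 2 :> R by rewrite divr_ge0// pi_ge0.
have h1 := ler_wpM2l pi0 xX; have h2 := mulr_ge0 pi0 (normr_ge0 x).
by split; lra.
Qed.

(** Stirling covers large [|x|]. On the compact rest the approximants are uniformly bounded, as
    [Re al - y >= Re al > 0] keeps the poles away, and [gamma_size] is bounded below. *)
Lemma normc_cGamma_le al : 0 < Re al -> exists c : R, 0 <= c /\ forall x y,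
  -1 <= y <= 0 -> normc (cGamma (al + 'i * (x +i* y))) <=
    c * gamma_size (Re al - y - 2^-1) x.
Proof.
move=> al0; have [c1 [c2 [X [c10 c20 H]]]] := gamma_large al.
have [M HM] := gam_bounded (normc al + (X + 1)) al0.
have [k [k0 Hk]] := gamma_size_compact (`|Re al| + 2) X.
exists (Num.max c2 (`|M| / k)); split; first by rewrite le_max ltW.
move=> x y y01; have /andP[y1 y2] := y01; set T := gamma_size _ _.
have T0 : 0 < T by exact: gamma_size_gt0.
have [Xx|xX] := leP X `|x|.
  have /andP[_ h] := H x y y01 Xx; apply: (le_trans h).
  by rewrite ler_pM2r// le_max lexx.
apply: (@le_trans _ _ M).
  apply: (cvgr_to_le (cvg_normc_norm (gam_cvg _))).
  exists (gam_start (normc al + (X + 1))) => // n /= hn.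
  apply: HM => //; first by apply: normc_shift_le => //; exact: ltW.
  by rewrite Re_shift; lra.
apply: (@le_trans _ _ (`|M| / k * T)); last by rewrite ler_pM2r// le_max lexx orbT.
apply: (le_trans (ler_norm M)); rewrite mulrAC ler_pdivlMr// ler_wpM2l//.
have [] := Hk (Re al - y - 2^-1) x _ (ltW xX) => //.
rewrite -addrA; apply: (le_trans (ler_normD _ _)); rewrite lerD2l.
by rewrite ler_norml; apply/andP; split; lra.
Qed.

(** The lower Stirling bound covers large [|x|]; on the compact rest the inverses of the
    approximants are bounded on whole discs, because [1 / Gamma] is entire. *)
Lemma normc_cGammaV_le al : exists c : R, 0 <= c /\ forall x y,
  -1 <= y <= 0 -> normc (cGamma (al + 'i * (x +i* y)))^-1 <=
    c * (gamma_size (Re al - y - 2^-1) x)^-1.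
Proof.
have [c1 [c2 [X [c10 c20 H]]]] := gamma_large al.
have [M HM] := gamV_bounded (normc al + (X + 1)).
have [k [k0 Hk]] := gamma_size_compact (`|Re al| + 2) X.
exists (Num.max c1^-1 (`|M| / k)); split; first by rewrite le_max invr_ge0 ltW.
move=> x y y01; have /andP[y1 y2] := y01; set T := gamma_size _ _.
have T0 : 0 < T by exact: gamma_size_gt0.
have [Xx|xX] := leP X `|x|.
  have /andP[h _] := H x y y01 Xx.
  apply: (@le_trans _ _ (c1^-1 * T^-1)); last first.
    by rewrite ler_pM2r ?invr_gt0// le_max lexx.
  have cT : 0 < c1 * T by exact: mulr_gt0.
  by rewrite Normc.normcV -invfM lef_pV2 ?posrE// (lt_le_trans cT h).
apply: (@le_trans _ _ M).
  apply: (cvgr_to_le (cvg_normc_norm (gamV_cvg _))).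
  exists (gam_start (normc al + (X + 1))) => // n /= hn.
  by apply: HM => //; apply: normc_shift_le => //; exact: ltW.
apply: (@le_trans _ _ (`|M| / k * T^-1)); last first.
  by rewrite ler_pM2r ?invr_gt0// le_max lexx orbT.
apply: (le_trans (ler_norm M)); rewrite -mulrA ler_peMr//.
have pB : `|Re al - y - 2^-1| <= `|Re al| + 2.
  rewrite -addrA; apply: (le_trans (ler_normD _ _)); rewrite lerD2l.
  by rewrite ler_norml; apply/andP; split; lra.
have [_] := Hk _ _ pB (ltW xX).
rewrite -/T => TK; rewrite -[X in X <= _](mulVf (lt0r_neq0 k0)) ler_pM2l ?invr_gt0//.
by rewrite -[k]invrK lef_pV2 ?posrE ?invr_gt0.
Qed.

End GammaBounds.

(** * The weight and its growth *)

Section Approximable.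
Context {R : realType}.
Implicit Types (F G H : R[i] -> R[i]) (z al : R[i]).

(** Compactness is taken in [R * R], where the rectangle is a product of segments. *)
Lemma rect_bounded F (x y w h : R) : (forall z, in_rect x y w h z -> F \dat z) ->
  exists M : R, forall z, in_rect x y w h z -> normc (F z) <= M.
Proof.
move=> dF.
pose A : set (R * R) := `[x, x + w] `*` `[y, y + h].
pose g (p : R * R) : R := normc (F (p.1 +i* p.2)).
have cA : compact A by apply: compact_setX; exact: segment_compact.
have cg : {within A, continuous g}.
  apply: continuous_in_subspaceT => p; rewrite inE => -[/=].
  rewrite !in_itv/= => px py.
  have dp : F \dat (p.1 +i* p.2) by apply: dF.
  apply/cvgrPdist_lt => e e0.
  have [d d0 Hd] := derivable_continuous_normc dp e0.
  have d2 : 0 < d / 2 by rewrite divr_gt0.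
  exists (ball p.1 (d / 2), ball p.2 (d / 2)); first by split; exact: nbhsx_ballx.
  move=> q [/= q1 q2]; rewrite /ball/= in q1 q2.
  have hq : normc (q.1 +i* q.2 - p.1 +i* p.2) < d.
    apply: (le_lt_trans (normc_le_ReIm _)); rewrite ReB ImB /= (splitr d).
    by rewrite ltrD// distrC.
  apply: le_lt_trans (Hd _ hq); rewrite /g ler_norml lerNl opprB !lerBlDr.
  apply/andP; split.
  - by rewrite -[X in normc X <= _](subrK (F (p.1 +i* p.2))) normcD.
  - by rewrite distcC -[X in normc X <= _](subrK (F (q.1 +i* q.2))) normcD.
have := compact_bounded (continuous_compact cg cA).
move=> [M [_ HM]]; exists (M + 1) => z [zx zy].
have := HM (M + 1); rewrite ltrDl ltr01 => /(_ isT (g (Re z, Im z))).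
rewrite /g /=.
have -> : Re z +i* Im z = z by case: (z).
rewrite ger0_norm ?normc_ge0//; apply.
exists (Re z, Im z); last by rewrite /=; case: (z).
by split; rewrite /= in_itv.
Qed.

Lemma approximable_holo F : (forall z, in_strip z -> F \dat z) -> approximable F.
Proof.
move=> dF; exists (fun=> F); split=> // [z _|T].
  by under eq_fun do rewrite subrr Normc.normc0; exact: cvg_cst.
(* The proof term only rewrites the upper edge [-1 + 1] of the rectangle into the upper edge 0 of
   the strip. *)
have [M HM] := @rect_bounded F (- T) (-1) (T + T) 1 (fun z zr => dF z (eq_ind _
  (fun u => -1 <= Im z <= u) (proj2 zr) _ (addNr _))).
exists M, 0%N => N z _ zs zT; apply: HM; split; last by rewrite addNr.
by rewrite addrA addNr add0r -ler_norml.
Qed.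

Lemma approximable_mul F G :
  approximable F -> approximable G -> approximable (fun z => F z * G z).
Proof.
move=> [FN [dF cF bF]] [GN [dG cG bG]]; exists (fun N z => FN N z * GN N z); split.
- by move=> N z zs; apply: derivable_mulc; [exact: dF|exact: dG].
- by move=> z zs; apply: cvg_normcM; [exact: cF|exact: cG].
- move=> T; have [M1 [N1 H1]] := bF T; have [M2 [N2 H2]] := bG T.
  exists (M1 * M2), (maxn N1 N2) => N z; rewrite geq_max => /andP[n1 n2] zs zT.
  by rewrite Normc.normcM ler_pM ?normc_ge0 ?H1 ?H2.
Qed.

Lemma approximable_cst (k : R[i]) : approximable (fun=> k).
Proof. by apply: approximable_holo => z _; exact: derivable_cstc. Qed.

Lemma approximable_prod (I : Type) (r : seq I) (F : I -> R[i] -> R[i]) :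
  (forall i, approximable (F i)) -> approximable (fun z => \prod_(i <- r) F i z).
Proof.
move=> aF; elim: r => [|i r ih].
  rewrite (_ : (fun z => _) = (fun=> 1)); first exact: approximable_cst.
  by apply/funext => z; rewrite big_nil.
rewrite (_ : (fun z => _) = (fun z => F i z * \prod_(j <- r) F j z)).
  exact: approximable_mul.
by apply/funext => z; rewrite big_cons.
Qed.

(** The reflection in the centre line [Im z = -1/2] preserves the strip; from [mu] it produces
    [nu (. + i)]. *)
Lemma approximable_conj H :
  approximable H -> approximable (fun z => (H (z + 'i)^*)^*).
Proof.
have st z : in_strip z -> in_strip (z + 'i)^*.
  by case: z => a b; rewrite /in_strip/= => /andP[? ?]; apply/andP; split; lra.
move=> [HN [dH cH bH]]; exists (fun N z => (HN N (z + 'i)^*)^*); split.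
- move=> N z zs.
  have := @derivable_affine R 1 'i (fun w => (HN N w^*)^*) z.
  rewrite (_ : (fun w => (HN N (1 * w + 'i)^*)^*) = (fun w => (HN N (w +
    'i)^*)^*)); last first.
    by apply/funext => w; rewrite mul1r.
  by apply; rewrite mul1r; apply: derivable_conj; apply: dH; exact: st.
- move=> z /st/cH; rewrite (_ : (fun N => normc (_ - _)) =
      (fun N => normc ((HN N (z + 'i)^*)^* - (H (z + 'i)^*)^*)))//.
  by apply/funext => N; rewrite -rmorphB normc_conj.
- move=> T; have [M [N0 HM]] := bH T; exists M, N0 => N z NN /st zs zT.
  by rewrite normc_conj; apply: HM => //; move: zT; case: (z) => a b; rewrite /= addr0.
Qed.

Lemma Re_rot al z : Re (al + 'i * z) = Re al - Im z.
Proof. by case: z => x y; rewrite Re_shift. Qed.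

Lemma normc_rot_le al z (T : R) : in_strip z -> `|Re z| <= T ->
  normc (al + 'i * z) <= normc al + (T + 1).
Proof. by case: z => x y; exact: normc_shift_le. Qed.

Lemma derivable_rot F al z : F \dat (al + 'i * z) -> (fun w => F (al + 'i * w)) \dat z.
Proof.
move=> dF; have := @derivable_affine R 'i al F z.
rewrite (_ : (fun w => F ('i * w + al)) = (fun w => F (al + 'i * w))); last first.
  by apply/funext => w; rewrite addrC.
by apply; rewrite addrC.
Qed.

Lemma approximable_gamma al : 0 < Re al -> approximable (fun z => cGamma (al + 'i * z)).
Proof.
move=> al0; exists (fun N z => gam N (al + 'i * z)); split.
- move=> N z /andP[_ z0]; apply: derivable_rot.
  by apply: derivable_gam; rewrite Re_rot subr_gt0 (le_lt_trans z0).
- by move=> z _; exact: gam_cvg.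
- move=> T; have [M HM] := gam_bounded (normc al + (T + 1)) al0.
  exists M, (gam_start (normc al + (T + 1))) => N z NN zs zT; apply: HM => //.
    exact: normc_rot_le.
  by move: zs => /andP[_ z0]; rewrite Re_rot lerDl oppr_ge0.
Qed.

Lemma approximable_gammaV al : approximable (fun z => (cGamma (al + 'i * z))^-1).
Proof.
exists (fun N z => (gam N (al + 'i * z))^-1); split.
- by move=> N z _; apply: (@derivable_rot (fun w => (gam N w)^-1));
    exact: derivable_gamV.
- by move=> z _; exact: gamV_cvg.
- move=> T; have [M HM] := @gamV_bounded R (normc al + (T + 1)).
  exists M, (gam_start (normc al + (T + 1))) => N z NN zs zT; apply: HM => //.
  exact: normc_rot_le.
Qed.

Lemma approximable_mu m n (c : R) (a : 'I_m -> R[i]) (b : 'I_n -> R[i]) :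
  (forall k, 0 < Re (a k)) -> approximable (mu c a b).
Proof.
move=> a0.
rewrite (_ : mu c a b = fun s => cexp (c%:C * s) *
  (\prod_(k <- index_enum 'I_m) cGamma (a k + 'i * s) *
   \prod_(l <- index_enum 'I_n) (cGamma (b l + 'i * s))^-1)); last first.
  by apply/funext => s; rewrite /mu prodfV.
apply: approximable_mul.
  apply: approximable_holo => z _.
  have := @derivable_cexpM R c%:C z.
  by rewrite (_ : (fun w => cexp (w * c%:C)) = (fun w => cexp (c%:C * w)))//;
    apply/funext => w; rewrite mulrC.
apply: approximable_mul.
  by apply: (@approximable_prod _ _ (fun k s => cGamma (a k + 'i * s))) => k;
    exact: approximable_gamma.
by apply: (@approximable_prod _ _ (fun l s => (cGamma (b l + 'i * s))^-1)) => l;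
  exact: approximable_gammaV.
Qed.

End Approximable.

(** * Size of the weight factor and of the functions in the domain *)

Section Growth.
Context {R : realType} (m n : nat) (c : R) (a : 'I_m -> R[i]) (b : 'I_n -> R[i]).
Implicit Types (x y : R) (f : R[i] -> R[i]).

Definition growth_exponent : R :=
  \sum_(k < m) (2 * Re (a k) - 1) - \sum_(l < n) (2 * Re (b l) - 1).

(** Half of the exponent in [Psi]. *)
Definition growth_rate x : R := c * x + (n%:R - m%:R) * (pi / 2 * `|x|).

(** The square root of [Psi] on the real line, made smooth at the origin by
    replacing [|x|] with [1 + |x|] in the power. *)
Definition growth x : R := bracket (growth_exponent / 2) x * expR (growth_rate x).

Lemma growth_gt0 x : 0 < growth x.
Proof. by rewrite mulr_gt0 ?bracket_gt0 ?expR_gt0. Qed.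

Lemma prod_gamma_size (N : nat) (p : 'I_N -> R) x :
  \prod_(k < N) gamma_size (p k) x =
  bracket (\sum_(k < N) p k) x * expR (- (N%:R * (pi / 2 * `|x|))).
Proof.
rewrite /gamma_size big_split /=; congr (_ * _).
  rewrite bracketE mulr_suml expR_sum; apply: eq_bigr => k _.
  by rewrite bracketE.
by rewrite -expR_sum sumr_const card_ord -[X in expR X = _]mulr_natl mulrN.
Qed.

Lemma sum_shift (N : nat) (al : 'I_N -> R[i]) y :
  \sum_(k < N) (Re (al k) - y - 2^-1) =
  (\sum_(k < N) (2 * Re (al k) - 1)) / 2 - N%:R * y.
Proof.
rewrite mulr_suml (_ : N%:R * y = \sum_(k < N) y); last first.
  by rewrite sumr_const card_ord -[RHS]mulr_natl.
by rewrite -sumrB; apply: eq_bigr => k _; field.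
Qed.

(** Each Gamma factor contributes the power [Re a_k - y - 1/2] or the negative of
    [Re b_l - y - 1/2]; the sums give half of the exponent of [Psi] and the extra [- y (m - n)]. The
    exponentials [exp (- pi |x| / 2)] combine to the rate [(n - m) pi |x| / 2]. *)
Lemma normc_mu_le : (forall k, 0 < Re (a k)) -> exists C : R, 0 <= C /\
  forall x y, -1 <= y <= 0 ->
  normc (mu c a b (x +i* y)) <= C * (growth x * bracket (- y * (m%:R - n%:R)) x).
Proof.
move=> a0.
have /choice[ca Hca] : forall k, exists C : R, 0 <= C /\ forall x y, -1 <= y <= 0 ->
    normc (cGamma (a k + 'i * (x +i* y))) <= C * gamma_size (Re (a k) - y - 2^-1) x.
  by move=> k; exact: normc_cGamma_le.
have /choice[cb Hcb] : forall l, exists C : R, 0 <= C /\ forall x y, -1 <= y <= 0 ->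
    normc (cGamma (b l + 'i * (x +i* y)))^-1 <= C * (gamma_size (Re (b l) - y -
      2^-1) x)^-1.
  by move=> l; exact: normc_cGammaV_le.
exists (\prod_(k < m) ca k * \prod_(l < n) cb l); split.
  by rewrite mulr_ge0// prodr_ge0// => k _; [case: (Hca k)|case: (Hcb k)].
move=> x y y01.
have g1 : normc (\prod_(k < m) cGamma (a k + 'i * (x +i* y))) <=
    \prod_(k < m) ca k * \prod_(k < m) gamma_size (Re (a k) - y - 2^-1) x.
  rewrite normc_prod -big_split /=; apply: ler_prod => k _.
  by rewrite normc_ge0/=; have [_] := Hca k; exact.
have g2 : normc (\prod_(l < n) cGamma (b l + 'i * (x +i* y)))^-1 <=
    \prod_(l < n) cb l * (\prod_(l < n) gamma_size (Re (b l) - y - 2^-1) x)^-1.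
  rewrite -!prodfV normc_prod -big_split /=; apply: ler_prod => k _.
  by rewrite normc_ge0/=; have [_] := Hcb k; exact.
rewrite /mu !Normc.normcM normc_cexp.
have -> : Re (c%:C * (x +i* y)) = c * x by rewrite /= mul0r subr0.
apply: (le_trans (ler_wpM2l (expR_ge0 _) (ler_pM (normc_ge0 _) (normc_ge0 _) g1 g2))).
set G1 := \prod_(k < m) gamma_size _ x; set G2 := \prod_(l < n) gamma_size _ x.
have E : expR (c * x) * (G1 * G2^-1) = growth x * bracket (- y * (m%:R - n%:R)) x.
  rewrite /G1 /G2 !prod_gamma_size !sum_shift /growth /growth_rate !bracketE.
  rewrite invfM -!expRN -!expRD; congr expR; rewrite /growth_exponent.
  by field.
by rewrite -E le_eqVlt; apply/orP; left; apply/eqP; ring.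
Qed.

(** In the strip with [|x| >= 1], [|x| <= |z| <= 1 + |x| <= 2 |z|], which handles exponents of
    either sign. *)
Lemma powR_normc_le (p x y : R) : `|y| <= 1 -> 1 <= `|x| ->
  normc (x +i* y) `^ p <= expR (`|p| * ln 2) * bracket p x.
Proof.
move=> y1 x1; set r := normc _.
have r1 : `|x| <= r by exact: le_Re_normc (x +i* y).
have r2 : r <= `|x| + 1.
  by apply: (le_trans (normc_le_ReIm _)); rewrite lerD2l.
have r0 : 0 < r by lra.
rewrite /powR gt_eqF// bracketE -expRD ler_expR.
have ln20 : 0 <= ln 2 :> R by rewrite ln_ge0// ler1n.
have b0 : 0 < 1 + `|x| by exact: bracket_base.
have l1 : ln r <= ln (1 + `|x|) by rewrite ler_ln ?posrE//; lra.
have l2 : ln (1 + `|x|) <= ln 2 + ln r.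
  by rewrite -lnM ?posrE// ler_ln ?posrE ?mulr_gt0//; lra.
rewrite -lerBlDr -mulrBr; apply: (le_trans (ler_norm _)); rewrite normrM.
by rewrite ler_wpM2l// ler_norml; apply/andP; split; lra.
Qed.

(** Turns the condition at infinity into a bound on the whole closed strip in terms of the real
    part: the remaining rectangle is compact and [f] is holomorphic around it. *)
Lemma normc_spaceH_le f : spaceH c a b f -> exists eps K : R, [/\ 0 < eps, 0 <= K &
  forall x y, `|y| <= 1 ->
  normc (f (x +i* y)) <= K * ((growth x)^-1 * bracket (- m%:R - 2^-1 - eps) x)].
Proof.
move=> [[delta d0 hf] [eps e0 [K [M H]]]].
pose q : R := - m%:R - 2^-1 - eps.
pose P : R := q - growth_exponent / 2.
pose X := Num.max M 1.
have TE x : (growth x)^-1 * bracket q x = expR (P * ln (1 + `|x|) - growth_rate x).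
  rewrite /growth !bracketE invfM -!expRN -!expRD; congr expR; rewrite /P; ring.
have [M0 HM0] : exists M0 : R, forall z, in_rect (- X) (-1) (X + X) 2 z -> normc (f
  z) <= M0.
  apply: rect_bounded => z [_ /andP[z1 z2]]; apply: hf => /=.
  by apply: (@le_lt_trans _ _ 1); [rewrite ler_norml; apply/andP; split;
    lra|rewrite ltrDl].
(* A bound for the absolute value of the exponent in [TE] when [|x| <= X], so that the right-hand
   side stays above a positive constant there. *)
pose W := `|P| * ln (1 + X) + (`|c| * X + `|n%:R - m%:R| * (pi / 2 * X)).
exists eps, (Num.max (`|K| * expR (`|P| * ln 2)) (`|M0| * expR W)); split; first by [].
  by rewrite le_max mulr_ge0// expR_ge0.
move=> x y y1; rewrite -/q TE.
have X1 : 1 <= X by rewrite /X le_max lexx orbT.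
have [Xx|xX] := leP X `|x|.
  have xM : M <= normc (x +i* y).
    apply: le_trans (le_Re_normc (x +i* y)); apply: le_trans Xx.
    by rewrite /X le_max lexx.
  apply: (le_trans (H (x +i* y) y1 xM)).
  apply: (@le_trans _ _ (`|K| * expR (`|P| * ln 2) *
      expR (P * ln (1 + `|x|) - growth_rate x))); last first.
    by rewrite ler_pM2r ?expR_gt0// le_max lexx.
  have pr : normc (x +i* y) `^ P <= expR (`|P| * ln 2) * bracket P x.
    by apply: powR_normc_le => //; apply: le_trans Xx.
  have r0 : 0 < normc (x +i* y).
    apply: (lt_le_trans ltr01); apply: (le_trans X1); apply: (le_trans Xx).
    exact: le_Re_normc (x +i* y).
  have E1 : Psi c a b (x +i* y) `^ (- 2^-1) * normc (x +i* y) `^ q =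
      normc (x +i* y) `^ P * expR (- growth_rate x).
    rewrite /Psi powRM ?powR_ge0 ?expR_ge0// -powRrM -expRM mulrAC -powRD; last first.
      by rewrite (gt_eqF r0) implybT.
    by congr (_ `^ _ * expR _); rewrite /= /P /growth_exponent /growth_rate; field.
  rewrite E1; apply: (@le_trans _ _ (`|K| * (normc (x +i* y) `^ P * expR (-
    growth_rate x)))).
    by rewrite ler_wpM2r ?ler_norm// mulr_ge0 ?powR_ge0 ?expR_ge0.
  rewrite -!mulrA ler_wpM2l// expRD mulrA ler_pM2r ?expR_gt0//.
  by rewrite -bracketE.
apply: (@le_trans _ _ (`|M0| * expR W * expR (P * ln (1 + `|x|) - growth_rate x)));
  last first.
  by rewrite ler_pM2r ?expR_gt0// le_max lexx orbT.
apply: (@le_trans _ _ `|M0|).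
  apply: (le_trans (HM0 _ _)); last exact: ler_norm.
  move: (ltW xX) y1; rewrite !ler_norml => /andP[? ?] /andP[? ?].
  by split; rewrite /=; apply/andP; split; lra.
rewrite -mulrA ler_peMr// -expRD -[X in X <= _]expR0 ler_expR.
have l0 : 0 <= ln (1 + `|x|) by rewrite ln_ge0// lerDl.
have l1 : ln (1 + `|x|) <= ln (1 + X).
  by rewrite ler_ln ?posrE ?bracket_base ?lerD2l ?(ltW xX)// ltr_pwDl// (le_trans
    ler01).
have h1 : `|P * ln (1 + `|x|)| <= `|P| * ln (1 + X).
  by rewrite normrM (ger0_norm l0) ler_wpM2l.
have pi0 : 0 <= pi / 2 :> R by rewrite divr_ge0// pi_ge0.
have h2 : `|growth_rate x| <= `|c| * X + `|n%:R - m%:R| * (pi / 2 * X).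
  apply: (le_trans (ler_normD _ _)); apply: lerD.
    by rewrite normrM ler_wpM2l// ltW.
  have px : 0 <= pi / 2 * `|x| by exact: mulr_ge0.
  by rewrite normrM (ger0_norm px) ler_wpM2l// ler_wpM2l// ltW.
by move: h1 h2; rewrite /W !ler_norml => /andP[? ?] /andP[? ?]; lra.
Qed.

End Growth.

(** * Symmetry *)

Section ComplexMeasurable.
Context {R : realType}.
Notation mu := (@lebesgue_measure R).
Implicit Types (h g : R -> R[i]).

Lemma cmeasurable_cst (k : R[i]) : cmeasurable setT (fun=> k).
Proof. by split; exact: measurable_cst. Qed.

Lemma cmeasurableD h g : cmeasurable setT h -> cmeasurable setT g ->
  cmeasurable setT (fun x => h x + g x).
Proof.
move=> [h1 h2] [g1 g2]; split.
- rewrite (_ : (fun x => _) = (fun x => Re (h x)) \+ (fun x => Re (g x))).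
    exact: measurable_funD.
  by apply/funext => x /=; case: (h x) (g x) => ? ? [].
- rewrite (_ : (fun x => _) = (fun x => Im (h x)) \+ (fun x => Im (g x))).
    exact: measurable_funD.
  by apply/funext => x /=; case: (h x) (g x) => ? ? [].
Qed.

Lemma cmeasurableM h g : cmeasurable setT h -> cmeasurable setT g ->
  cmeasurable setT (fun x => h x * g x).
Proof.
move=> [h1 h2] [g1 g2]; split.
- rewrite (_ : (fun x => _) = ((fun x => Re (h x)) \* (fun x => Re (g x))) \-
      ((fun x => Im (h x)) \* (fun x => Im (g x)))).
    by apply: measurable_funB; exact: measurable_funM.
  by apply/funext => x /=; case: (h x) (g x) => ? ? [].
- rewrite (_ : (fun x => _) = ((fun x => Re (h x)) \* (fun x => Im (g x))) \+
      ((fun x => Im (h x)) \* (fun x => Re (g x)))).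
    by apply: measurable_funD; exact: measurable_funM.
  by apply/funext => x /=; case: (h x) (g x) => ? ? [].
Qed.

Lemma cmeasurable_conj h : cmeasurable setT h -> cmeasurable setT (fun x => (h x)^*).
Proof.
move=> [h1 h2]; split.
- by rewrite (_ : (fun x => _) = (fun x => Re (h x)))//; apply/funext => x; case: (h x).
- rewrite (_ : (fun x => _) = cst 0 \- (fun x => Im (h x))).
    by apply: measurable_funB => //; exact: measurable_cst.
  by apply/funext => x /=; case: (h x) => ? ? /=; rewrite sub0r.
Qed.

Lemma measurable_sqr_normc h : cmeasurable setT h ->
  measurable_fun setT (fun x => normc (h x) ^+ 2).
Proof.
move=> [h1 h2].
rewrite (_ : (fun x => _) = ((fun x => Re (h x)) \* (fun x => Re (h x))) \+
      ((fun x => Im (h x)) \* (fun x => Im (h x)))).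
  by apply: measurable_funD; exact: measurable_funM.
apply/funext => x /=; case: (h x) => p q /=.
by rewrite sqr_sqrtr ?addr_ge0 ?sqr_ge0// !expr2.
Qed.

(** The inverse is the conjugate times [|h|^-2]. The real power with exponent -1 is measurable and
    has the same default value 0 at 0, so zeros of [h] are included. *)
Lemma cmeasurableV h : cmeasurable setT h -> cmeasurable setT (fun x => (h x)^-1).
Proof.
move=> mh; have mN : measurable_fun setT (fun x => (normc (h x) ^+ 2) `^ (-1)).
  exact: (measurableT_comp (measurable_powR (-1)) (measurable_sqr_normc mh)).
rewrite (_ : (fun x => (h x)^-1) = (fun x => (h x)^* * ((normc (h x) ^+ 2) `^
  (-1))%:C)).
  apply: cmeasurableM; first exact: cmeasurable_conj.
  by split => //=; exact: measurable_cst.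
apply/funext => x; rewrite powR_inv1 ?sqr_ge0//; case: (h x) => p q.
rewrite /= sqr_sqrtr ?addr_ge0 ?sqr_ge0//.
by simpc; rewrite -[LHS]/((p / _) -i* (q / _)).
Qed.

Lemma cmeasurable_prod (I : Type) (r : seq I) (F : I -> R -> R[i]) :
  (forall i, cmeasurable setT (F i)) -> cmeasurable setT (fun x => \prod_(i <- r) F
    i x).
Proof.
move=> mF; elim: r => [|i r ih].
  rewrite (_ : (fun x => _) = (fun=> 1)); first exact: cmeasurable_cst.
  by apply/funext => x; rewrite big_nil.
rewrite (_ : (fun x => _) = (fun x => F i x * \prod_(j <- r) F j x)).
  exact: cmeasurableM.
by apply/funext => x; rewrite big_cons.
Qed.

Lemma cmeasurable_real : cmeasurable setT (fun x : R => x%:C).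
Proof. by split; [exact: measurable_id|exact: measurable_cst]. Qed.

(** Serves to discard the real poles of the coefficients, where the integrands take default
    values. *)
Lemma Cint_ae h g (N : set R) : cmeasurable setT h -> cmeasurable setT g ->
  countable N -> (forall x, ~ N x -> h x = g x) -> Cint setT h = Cint setT g.
Proof.
move=> [h1 h2] [g1 g2] cN hg.
have aeN (u v : R -> R) : (forall x, ~ N x -> u x = v x) ->
    ae_eq mu setT (EFin \o u) (EFin \o v).
  move=> uv; exists N; split; first by apply: countable_measurable => // x;
    exact: measurable_set1.
    exact: countable_lebesgue_measure0.
  by move=> x /= H; apply: contrapT => Nx; apply: H => _; rewrite uv.
by congr (_ +i* _); congr fine; apply: ae_eq_integral => //;
  try (apply/measurable_EFinP => //); apply: aeN => x /hg ->.
Qed.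

End ComplexMeasurable.

(** * Square integrability and equality of the two inner products *)

Section Symmetry.
Context {R : realType} (m n : nat) (c : R) (a : 'I_m -> R[i]) (b : 'I_n -> R[i]).
Context (ha : forall k : 'I_m, 0 < Re (a k)).
Implicit Types (x y : R) (f g p q : R[i] -> R[i]) (z : R[i]).

Local Notation V := (growth c a b).
Local Notation Mu := (mu c a b).

(** With [p] either [f] or [up f], and [q] a reflection of [g] or of [up g], the values on the lines
    [Im z = 0] and [Im z = -1] give all terms of both inner products up to the factor
    [1 / (2 pi)]. *)
Definition kernel p q z : R[i] := p z * q z * (Mu z * nu c a b (z + 'i)).

Definition strip_bounded p (eps : R) := exists K : R, 0 <= K /\ forall x y,
  -1 <= y <= 0 -> normc (p (x +i* y)) <= K * ((V x)^-1 * bracket (- m%:R - 2^-1 -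
    eps) x).

Lemma strip_conj x y : (x +i* y + 'i)^* = x +i* (- (y + 1)).
Proof. by rewrite /= addr0. Qed.

Lemma approximable_kernel p q : approximable p -> approximable q ->
  approximable (kernel p q).
Proof.
move=> ap aq; apply: approximable_mul; first exact: approximable_mul.
apply: approximable_mul; first exact: approximable_mu.
by apply: (@approximable_conj R Mu); exact: approximable_mu.
Qed.

(** The powers [- y (m - n)] from [mu] and [(y + 1) (m - n)] from [nu (. + i)] add up to [m - n]
    whatever [y] is; with the decay of [p] and [q] the exponent is [- 1 - (e1 + e2) - (m + n)], and
    the growth factors cancel. *)
Lemma kernel_bounded p q e1 e2 : 0 < e1 -> 0 < e2 ->
  strip_bounded p e1 -> strip_bounded q e2 ->
  exists K : R, forall z, in_strip z ->
    normc (kernel p q z) <= K * bracket (- 1 - (e1 + e2)) (Re z).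
Proof.
move=> e10 e20 [K1 [K10 H1]] [K2 [K20 H2]].
have [C [C0 HC]] := @normc_mu_le R m n c a b ha.
exists (K1 * K2 * (C * C)) => -[x y]; rewrite /in_strip [Re _]/= [Im _]/= => y01.
have y02 : -1 <= - (y + 1) <= 0 by move: y01 => /andP[? ?]; apply/andP; split; lra.
rewrite /kernel (Normc.normcM (p _ * q _)) (Normc.normcM (p _)) (Normc.normcM (Mu _)).
rewrite /nu normc_conj strip_conj.
have V0 := growth_gt0 c a b x.
apply: (le_trans (ler_pM (mulr_ge0 (normc_ge0 _) (normc_ge0 _))
  (mulr_ge0 (normc_ge0 _) (normc_ge0 _))
  (ler_pM (normc_ge0 _) (normc_ge0 _) (H1 x y y01) (H2 x y y01))
  (ler_pM (normc_ge0 _) (normc_ge0 _) (HC x y y01) (HC x _ y02)))).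
rewrite [leLHS](_ : _ = K1 * K2 * (C * C) *
  (bracket (- m%:R - 2^-1 - e1) x * bracket (- m%:R - 2^-1 - e2) x *
   (bracket (- y * (m%:R - n%:R)) x * bracket (- - (y + 1) * (m%:R - n%:R)) x)));
     last first.
  by field; rewrite gt_eqF.
rewrite ler_wpM2l ?mulr_ge0// -!bracketD; apply: bracket_le.
have m0 : 0 <= m%:R :> R by []. have n0 : 0 <= n%:R :> R by [].
rewrite [leLHS](_ : _ = - 1 - (e1 + e2) - (m%:R + n%:R)); last by field.
by rewrite lerBlDr lerDl addr_ge0.
Qed.

Lemma cintegrable_line p (K e : R) y : 0 < e -> approximable p -> -1 <= y <= 0 ->
  (forall z, in_strip z -> normc (p z) <= K * bracket (- 1 - e) (Re z)) ->
  cintegrable setT (fun x => p (x +i* y)).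
Proof.
move=> e0 ap y01 H; apply: (@cintegrable_le R _ _ (fun x => K * bracket (- 1 - e)
  x)) => //.
- exact: approximable_line.
- by apply: integrableMl => //; exact: integrable_bracket.
- by move=> x _; exact: (H (x +i* y) y01).
Qed.

Lemma kernel_shift p q e1 e2 : 0 < e1 -> 0 < e2 -> approximable p -> approximable q ->
  strip_bounded p e1 -> strip_bounded q e2 ->
  [/\ cintegrable setT (fun x => kernel p q (x +i* (-1))),
      cintegrable setT (fun x => kernel p q (x +i* 0)) &
      Cint setT (fun x => kernel p q (x +i* (-1))) =
      Cint setT (fun x => kernel p q (x +i* 0))].
Proof.
move=> e10 e20 ap aq bp bq; have ak := approximable_kernel ap aq.
have [K HK] := kernel_bounded e10 e20 bp bq.
have e0 : 0 < e1 + e2 by rewrite addr_gt0.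
split.
- by apply: (cintegrable_line e0 ak _ HK); rewrite lexx lerN10.
- by apply: (cintegrable_line e0 ak _ HK); rewrite lexx lerN10.
- exact: (strip_shift e0 ak HK).
Qed.

(** The real zeros of the denominator of [coefB], and by conjugation of that of [coefA]. *)
Definition pole_set : set R := [set x | exists l, b l + 'i * x%:C = 0].

Lemma countable_pole_set : countable pole_set.
Proof.
apply: finite_set_countable.
apply: (@sub_finite_set _ _ ((fun l => - Im (b l)) @` [set: 'I_n])).
  move=> x [l bl]; exists l => //.
  have := congr1 (@complex.Im R) bl; rewrite (Im_shift (b l) x 0) /= => /eqP.
  by rewrite addr_eq0 => /eqP ->; rewrite opprK.
by apply: finite_image; exact: finite_finset.
Qed.

Lemma rotS (al z : R[i]) : al + 'i * (z - 'i) = al + 'i * z + 1.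
Proof. by case: al z => p q [x y]; simpc; congr (_ +i* _); ring. Qed.

Lemma rot_neq0 k x : a k + 'i * x%:C != 0.
Proof.
apply/eqP => /(congr1 (@complex.Re R)); rewrite (Re_shift (a k) x 0) subr0.
by move/eqP; rewrite gt_eqF// ha.
Qed.

(** As [i (x - i) = i x + 1], the functional equation applies to every factor; its arguments are
    nonzero by [0 < Re (a k)] and by the choice of [x]. *)
Lemma coefB_mu x : ~ pole_set x -> coefB c a b x%:C * Mu x%:C = Mu (x%:C - 'i).
Proof.
move=> px; have nz l : b l + 'i * x%:C != 0 by apply/eqP => bl; apply: px; exists l.
rewrite /coefB /mu.
have -> : cexp (c%:C * (x%:C - 'i)) = cexp (- ('i * c%:C)) * cexp (c%:C * x%:C) :> R[i].
  by rewrite -cexpD; congr cexp; ring.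
have -> : \prod_(k < m) cGamma (a k + 'i * (x%:C - 'i)) =
    \prod_(k < m) (a k + 'i * x%:C) * \prod_(k < m) cGamma (a k + 'i * x%:C).
  rewrite -big_split /=; apply: eq_bigr => k _.
  by rewrite rotS cGammaS// rot_neq0.
have -> : \prod_(l < n) cGamma (b l + 'i * (x%:C - 'i)) =
    \prod_(l < n) (b l + 'i * x%:C) * \prod_(l < n) cGamma (b l + 'i * x%:C).
  rewrite -big_split /=; apply: eq_bigr => l _.
  by rewrite rotS cGammaS.
rewrite invfM; ring.
Qed.

(** At a real pole the left side is 0 by the convention for inverses, so the estimate has no
    exceptional points. *)
Lemma coefB_mu_le x : normc (coefB c a b x%:C * Mu x%:C) <= normc (Mu (x%:C - 'i)).
Proof.
have [[l bl]|px] := pselect (pole_set x); last by rewrite coefB_mu.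
rewrite (_ : coefB c a b x%:C = 0) ?mul0r ?Normc.normc0 ?normc_ge0//.
rewrite /coefB (_ : \prod_(l < n) (b l + 'i * x%:C) = 0) ?invr0 ?mulr0//.
by apply/eqP/prodf_eq0; exists l => //; rewrite bl.
Qed.

Lemma conjcM (u v : R[i]) : conjc (u * v) = conjc u * conjc v.
Proof. exact: rmorphM. Qed.

Lemma conjcD (u v : R[i]) : conjc (u + v) = conjc u + conjc v.
Proof. exact: rmorphD. Qed.

Lemma conjc_prod (I : Type) (r : seq I) (F : I -> R[i]) :
  conjc (\prod_(i <- r) F i) = \prod_(i <- r) conjc (F i).
Proof. exact: rmorph_prod. Qed.

Lemma coefA_conj x : coefA c a b x%:C = (coefB c a b x%:C)^*.
Proof.
rewrite /coefA /coefB.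
(* In ring_scope [^*] is [Num.conj], which is convertible to [conjc]. *)
transitivity (conjc (cexp (- ('i * c%:C)) * ((\prod_(k < m) (a k + 'i * x%:C)) /
  (\prod_(l < n) (b l + 'i * x%:C))))); last by [].
rewrite conjcM cexpJ; congr (_ * _).
  by congr cexp; apply/eqP; rewrite eq_complex /=; apply/andP; split; apply/eqP; ring.
rewrite conjcM conjc_inv !conjc_prod; congr (_ / _);
  apply: eq_bigr => k _; rewrite conjcD; congr (_ + _);
  by apply/eqP; rewrite eq_complex /=; apply/andP; split; apply/eqP; ring.
Qed.

Lemma nu_real x : nu c a b x%:C = (Mu x%:C)^*.
Proof. by rewrite /nu conjc_real. Qed.

Definition up f z : R[i] := f (z + 'i).

(** This is the conjugate-reflected function shifted by [i]; applied to [up g] it gives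
    [conj (g (conj z))] itself. *)
Definition reflect_strip f z : R[i] := (f (z + 'i)^*)^*.

Lemma strip_bounded_reflect p e : strip_bounded p e -> strip_bounded (reflect_strip
  p) e.
Proof.
move=> [K [K0 H]]; exists K; split=> // x y y01.
rewrite /reflect_strip normc_conj strip_conj; apply: H.
by move: y01 => /andP[? ?]; apply/andP; split; lra.
Qed.

(** Folds the strip [|Im z| <= 1] onto its lower half: [f] covers [-1 <= Im z <= 0] and [up f] the
    upper half, with a common exponent. *)
Lemma spaceH_pieces f : spaceH c a b f -> exists2 e : R, 0 < e &
  [/\ approximable f, approximable (up f), strip_bounded f e & strip_bounded (up f) e].
Proof.
move=> Hf; have [e [K [e0 K0 H]]] := normc_spaceH_le Hf; exists e => //.
case: Hf => [[d d0 hf] _]; split.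
- apply: approximable_holo => z /andP[z1 z2]; apply: hf => /=.
  by apply: (@le_lt_trans _ _ 1); [rewrite ler_norml; apply/andP; split;
    lra|rewrite ltrDl].
- apply: approximable_holo => -[x y] /andP[/= z1 z2].
  have := @derivable_affine R 1 'i f (x +i* y).
  rewrite (_ : (fun w => f (1 * w + 'i)) = up f); last by apply/funext => w;
    rewrite mul1r.
  apply; rewrite mul1r; apply: hf => /=.
  by apply: (@le_lt_trans _ _ 1); [rewrite ler_norml; apply/andP; split;
    lra|rewrite ltrDl].
- exists K; split=> // x y /andP[? ?]; apply: H.
  by rewrite ler_norml; apply/andP; split; lra.
- exists K; split=> // x y /andP[? ?].
  have -> : up f (x +i* y) = f (x +i* (y + 1)) by rewrite /up; simpc.
  by apply: H; rewrite ler_norml; apply/andP; split; lra.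
Qed.

Local Notation W := (weight c a b).
Local Notation k2pi := ((2 * pi)^-1 : R).

Lemma Re_weight x : Re (W x%:C) = k2pi * normc (Mu x%:C) ^+ 2.
Proof.
rewrite /weight nu_real; case: (Mu x%:C) => p q /=.
rewrite sqr_sqrtr ?addr_ge0 ?sqr_ge0//; ring.
Qed.

Lemma cmeasurable_mu : cmeasurable setT (fun x => Mu x%:C).
Proof. by apply: (@approximable_line R Mu 0);
  [rewrite lexx lerN10|exact: approximable_mu]. Qed.

(** On the real line the weight is [|mu|^2 / (2 pi)], so squaring the bound gives the integrable
    exponent [- 1 - 2 e]. *)
Lemma inL2_bounded (h : R[i] -> R[i]) (K e : R) : 0 < e ->
  cmeasurable setT (fun x => h x%:C) ->
  (forall x, normc (h x%:C) * normc (Mu x%:C) <= K * bracket (- 2^-1 - e) x) ->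
  inL2 W h.
Proof.
move=> e0 mh H; split; [by case: mh|by case: mh|].
rewrite (_ : (fun x => _) = EFin \o (fun x => k2pi * normc (h x%:C * Mu x%:C) ^+
  2)); last first.
  by apply/funext => x /=; rewrite Re_weight (Normc.normcM (h x%:C)) exprMn;
    congr EFin; ring.
apply: integrableMl => //.
have e20 : 0 < e + e by rewrite addr_gt0.
have iB := integrableMl (K ^+ 2) measurableT (integrable_bracket e20).
apply: (le_integrable _ _ _ iB) => //.
  apply/measurable_EFinP; apply: measurable_sqr_normc.
  by apply: cmeasurableM => //; exact: cmeasurable_mu.
move=> x _ /=; rewrite lee_fin; apply: le_trans (ler_norm _).
rewrite ger0_norm ?sqr_ge0// (Normc.normcM (h x%:C)).
rewrite (_ : bracket (- 1 - (e + e)) x = bracket (- 2^-1 - e) x ^+ 2); last first.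
  by rewrite expr2 -bracketD; congr bracket; field.
have hm0 := mulr_ge0 (normc_ge0 (h x%:C)) (normc_ge0 (Mu x%:C)).
by rewrite -exprMn ler_sqr ?nnegrE// (le_trans hm0 (H x)).
Qed.

Lemma line0 x : x +i* 0 = x%:C. Proof. by []. Qed.

Lemma line1 x : x +i* (-1) = x%:C - 'i. Proof. by simpc. Qed.

Lemma up1 f x : up f (x%:C - 'i) = f x%:C.
Proof. by rewrite /up subrK. Qed.

Lemma cmeasurable_coefB : cmeasurable setT (fun x => coefB c a b x%:C).
Proof.
have mrot (al : R[i]) : cmeasurable setT (fun x => al + 'i * x%:C).
  apply: cmeasurableD; first exact: cmeasurable_cst.
  by apply: cmeasurableM; [exact: cmeasurable_cst|exact: cmeasurable_real].
apply: cmeasurableM; first exact: cmeasurable_cst.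
apply: cmeasurableM; first by apply: cmeasurable_prod => k; exact: mrot.
by apply: cmeasurableV; apply: cmeasurable_prod => l; exact: mrot.
Qed.

Lemma cmeasurable_opL f : approximable f -> approximable (up f) ->
  cmeasurable setT (fun x => opL c a b f x%:C).
Proof.
move=> af au; have mB := cmeasurable_coefB.
have mA : cmeasurable setT (fun x => coefA c a b x%:C).
  rewrite (_ : (fun x => _) = (fun x => (coefB c a b x%:C)^*));
    first exact: cmeasurable_conj.
  by apply/funext => x; exact: coefA_conj.
have m0 : cmeasurable setT (fun x => f x%:C).
  by apply: (@approximable_line R f 0) => //; rewrite lexx lerN10.
have m1 : cmeasurable setT (fun x => f (x%:C + 'i)).
  by apply: (@approximable_line R (up f) 0) => //; rewrite lexx lerN10.
have m2 : cmeasurable setT (fun x => f (x%:C - 'i)).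
  rewrite (_ : (fun x => _) = (fun x => f (x +i* (-1)))).
    by apply: approximable_line => //; rewrite lexx lerN10.
  by apply/funext => x; rewrite line1.
rewrite (_ : (fun x => _) = (fun x => coefA c a b x%:C * f (x%:C + 'i) +
  (-1) * ((coefA c a b x%:C + coefB c a b x%:C) * f x%:C) +
  coefB c a b x%:C * f (x%:C - 'i))); last first.
  by apply/funext => x; rewrite /opL; ring.
apply: cmeasurableD; last exact: cmeasurableM.
apply: cmeasurableD; first exact: cmeasurableM.
apply: cmeasurableM; first exact: cmeasurable_cst.
by apply: cmeasurableM => //; exact: cmeasurableD.
Qed.

(** For [L f] the coefficients are absorbed into [mu]: [|A| = |B|] and [|B mu| <= |mu (. - i)|] on
    the real line, at the cost of the power [m - n]. The [m] in the decay of [f] leaves the exponent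
    [- 1/2 - e - n]. *)
Lemma inL2_spaceH f : spaceH c a b f -> inL2 W f /\ inL2 W (opL c a b f).
Proof.
move=> /spaceH_pieces[e e0 [af au [K1 [K10 H1]] [K2 [K20 H2]]]].
have [C [C0 HC]] := @normc_mu_le R m n c a b ha.
have s0 : -1 <= (0 : R) <= 0 by rewrite lexx lerN10.
have s1 : -1 <= (-1 : R) <= 0 by rewrite lexx lerN10.
have HC0 x : normc (Mu x%:C) <= C * growth c a b x.
  have := HC x 0 s0; rewrite oppr0 mul0r (_ : bracket 0 x = 1) ?mulr1//.
  by rewrite /bracket powRr0.
have HC1 x : normc (Mu (x%:C - 'i)) <= C * (growth c a b x * bracket (m%:R - n%:R) x).
  by have := HC x (-1) s1; rewrite line1 opprK mul1r.
have bm (q : R) x : bracket (- m%:R - 2^-1 - q) x <= bracket (- 2^-1 - q) x.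
  by apply: bracket_le; rewrite lerD2r lerBlDr -[X in _ <= X + _]add0r addrNK oppr_le0.
split.
- apply: (@inL2_bounded f (K1 * C) e e0) => [|x].
    by apply: (@approximable_line R f 0) => //; rewrite lexx lerN10.
  apply: (le_trans (ler_pM (normc_ge0 _) (normc_ge0 _) (H1 x 0 s0) (HC0 x))).
  rewrite [leLHS](_ : _ = K1 * C * bracket (- m%:R - 2^-1 - e) x); last first.
    by field; rewrite gt_eqF// growth_gt0.
  by rewrite ler_wpM2l ?mulr_ge0.
(* [K2] bounds [f (x + i)], [2 K1] the middle term through [|A + B| <= 2 |B|], and the last [K1]
   bounds [f (x - i)]. *)
apply: (@inL2_bounded _ (C * (K2 + 2 * K1 + K1)) e e0) => [|x].
  exact: cmeasurable_opL.
have nA : normc (coefA c a b x%:C) = normc (coefB c a b x%:C).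
  by rewrite coefA_conj normc_conj.
have Bm := coefB_mu_le x; rewrite (Normc.normcM (coefB c a b x%:C)) in Bm.
have f1 := H1 x 0 s0; have f2 := H1 x (-1) s1; have f3 := H2 x 0 s0.
rewrite line1 in f2.
set T := (growth c a b x)^-1 * _ in f1 f2 f3.
set F1 := normc (f _) in f1; set F2 := normc (f _) in f2; set F3 := normc _ in f3.
have step : normc (opL c a b f x%:C) <=
    normc (coefB c a b x%:C) * (F3 + 2 * F1 + F2).
  apply: (le_trans (normcD _ _)).
  rewrite (Normc.normcM (coefB c a b x%:C)) [leRHS]mulrDr lerD2r.
  apply: (le_trans (normcD _ _)); rewrite normcN (Normc.normcM (coefA c a b x%:C)).
  rewrite (Normc.normcM (coefA c a b x%:C + _)) [leRHS]mulrDr nA.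
  rewrite lerD2l mulrA ler_wpM2r ?normc_ge0//.
  by apply: (le_trans (normcD _ _)); rewrite nA mulr_natr mulr2n.
apply: (le_trans (ler_wpM2r (normc_ge0 _) step)).
rewrite mulrAC.
have F0 : 0 <= F3 + 2 * F1 + F2.
  by rewrite !addr_ge0 ?mulr_ge0 ?normc_ge0.
apply: (le_trans (ler_wpM2r F0 (le_trans Bm (HC1 x)))).
have FT : F3 + 2 * F1 + F2 <= (K2 + 2 * K1 + K1) * T.
  by rewrite !mulrDl -mulrA !lerD// ler_wpM2l.
have V0 := growth_gt0 c a b x.
have CV : 0 <= C * (growth c a b x * bracket (m%:R - n%:R) x).
  by rewrite !mulr_ge0// ltW// bracket_gt0.
apply: (le_trans (ler_wpM2l CV FT)).
rewrite [leLHS](_ : _ = C * (K2 + 2 * K1 + K1) *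
  (bracket (m%:R - n%:R) x * bracket (- m%:R - 2^-1 - e) x)); last first.
  by rewrite /T; field; rewrite gt_eqF.
rewrite ler_wpM2l ?mulr_ge0 ?addr_ge0 ?mulr_ge0// -bracketD; apply: bracket_le.
have n0 : 0 <= n%:R :> R by [].
rewrite [leLHS](_ : _ = - 2^-1 - e - n%:R); last by field.
by rewrite lerBlDr lerDl.
Qed.

Lemma cmeasurable_approximable f : approximable f -> cmeasurable setT (fun x => f x%:C).
Proof. by move=> af; apply: (@approximable_line R f 0) => //; rewrite lexx lerN10. Qed.

Lemma reflect_strip0 f x : reflect_strip f x%:C = conjc (f (x%:C - 'i)).
Proof.
rewrite /reflect_strip; congr conjc; congr f.
by apply/eqP; rewrite eq_complex /=; apply/andP; split; apply/eqP; ring.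
Qed.

Lemma reflect_strip1 f x : reflect_strip f (x%:C - 'i) = conjc (f x%:C).
Proof.
rewrite /reflect_strip; congr conjc; congr f.
by apply/eqP; rewrite eq_complex /=; apply/andP; split; apply/eqP; ring.
Qed.

Lemma nu_up x : nu c a b (x%:C + 'i) = conjc (Mu (x%:C - 'i)).
Proof. exact: (@reflect_strip0 Mu). Qed.

Lemma opL_real f x : opL c a b f x%:C =
  conjc (coefB c a b x%:C) * f (x%:C + 'i) -
  (conjc (coefB c a b x%:C) + coefB c a b x%:C) * f x%:C +
  coefB c a b x%:C * f (x%:C - 'i).
Proof. by rewrite /opL coefA_conj. Qed.

(** Here [k = 1 / (2 pi)], [B] and [conj B] are the coefficients on the real line, and [M] and [B M]
    stand for the values of [mu] at [x] and, off the poles, at [x - i]. *)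
Lemma integrand_alg_l (k B M u v w t : R[i]) :
  (conjc B * u - (conjc B + B) * v + B * w) * t * (k * (M * conjc M)) =
  k * (u * t * (M * conjc (B * M)) + w * t * (B * M * conjc M) -
       (v * t * (M * conjc (B * M)) + v * t * (B * M * conjc M))).
Proof. rewrite conjcM; ring. Qed.

Lemma integrand_alg_r (k B M u v w t : R[i]) :
  t * conjc (conjc B * u - (conjc B + B) * v + B * w) * (k * (M * conjc M)) =
  k * (t * conjc u * (B * M * conjc M) + t * conjc w * (M * conjc (B * M)) -
       (t * conjc v * (M * conjc (B * M)) + t * conjc v * (B * M * conjc M))).
Proof.
rewrite -(mulN1r ((conjc B + B) * v)) !conjcD !conjcM !conjcD !conjcK.
have -> : conjc (-1 : R[i]) = -1 by rewrite -[RHS]/(- 1); exact: rmorphN1.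
ring.
Qed.

(** The first two kernels appear on opposite lines in the two identities and have to be shifted. The
    last two come from the term in [A + B] and are the same in both. *)
Lemma integrand_eq f g x : ~ pole_set x ->
  opL c a b f x%:C * (g x%:C)^* * W x%:C = k2pi%:C *
    (kernel (up f) (reflect_strip (up g)) (x +i* 0) +
     kernel f (reflect_strip g) (x +i* (-1)) -
     (kernel f (reflect_strip (up g)) (x +i* 0) +
      kernel (up f) (reflect_strip g) (x +i* (-1)))) /\
  f x%:C * (opL c a b g x%:C)^* * W x%:C = k2pi%:C *
    (kernel (up f) (reflect_strip (up g)) (x +i* (-1)) +
     kernel f (reflect_strip g) (x +i* 0) -
     (kernel f (reflect_strip (up g)) (x +i* 0) +
      kernel (up f) (reflect_strip g) (x +i* (-1)))).
Proof.
move=> px; have BM := coefB_mu px.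
rewrite line0 line1 /kernel !reflect_strip0 !reflect_strip1 !up1 !subrK.
rewrite nu_up nu_real -BM !opL_real /weight nu_real; split.
- exact: integrand_alg_l.
- exact: integrand_alg_r.
Qed.

Lemma inner_spaceH f g : spaceH c a b f -> spaceH c a b g ->
  inner W (opL c a b f) g = inner W f (opL c a b g).
Proof.
move=> /spaceH_pieces[e1 e10 [af au bf bu]] /spaceH_pieces[e2 e20 [ag aug bg bug]].
have arg := approximable_conj ag; have arug := approximable_conj aug.
have brg := strip_bounded_reflect bg; have brug := strip_bounded_reflect bug.
have [i1 j1 E1] := kernel_shift e10 e20 au arug bu brug.
have [i2 j2 E2] := kernel_shift e10 e20 af arg bf brg.
have [_ j3 _] := kernel_shift e10 e20 af arug bf brug.
have [i4 _ _] := kernel_shift e10 e20 au arg bu brg.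
pose k1 := kernel (up f) (reflect_strip (up g)).
pose k2 := kernel f (reflect_strip g).
pose k3 := kernel f (reflect_strip (up g)).
pose k4 := kernel (up f) (reflect_strip g).
rewrite -/k1 in i1 j1 E1; rewrite -/k2 in i2 j2 E2.
rewrite -/k3 in j3; rewrite -/k4 in i4.
pose I1 x := k2pi%:C * ((k1 (x +i* 0) + k2 (x +i* (-1))) -
                        (k3 (x +i* 0) + k4 (x +i* (-1)))).
pose I2 x := k2pi%:C * ((k1 (x +i* (-1)) + k2 (x +i* 0)) -
                        (k3 (x +i* 0) + k4 (x +i* (-1)))).
have mT : measurable (setT : set R) by [].
have c34 := cintegrableD mT j3 i4.
have c12 := cintegrableD mT j1 i2; have c12' := cintegrableD mT i1 j2.
(* Only [k1] and [k2] change lines; for [k3] and [k4] integrability suffices. *)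
have EI : Cint setT I1 = Cint setT I2.
  rewrite (CintMl k2pi%:C mT (cintegrableB mT c12 c34)).
  rewrite (CintMl k2pi%:C mT (cintegrableB mT c12' c34)).
  rewrite (CintB mT c12 c34) (CintB mT c12' c34).
  by rewrite (CintD mT j1 i2) (CintD mT i1 j2) E1 E2.
have mM := cmeasurable_mu.
have mW : cmeasurable setT (fun x => W x%:C).
  rewrite (_ : (fun x => _) = (fun x => k2pi%:C * (Mu x%:C * (Mu x%:C)^*))).
    apply: cmeasurableM; first exact: cmeasurable_cst.
    exact: (cmeasurableM mM (cmeasurable_conj mM)).
  by apply/funext => x; rewrite /weight nu_real.
have mI h h' : cmeasurable setT (fun x => h x%:C) -> cmeasurable setT (fun x => h'
  x%:C) ->
    cmeasurable setT (fun x => h x%:C * (h' x%:C)^* * W x%:C).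
  move=> mh mh'.
  exact: (cmeasurableM (cmeasurableM mh (cmeasurable_conj mh')) mW).
have mf := cmeasurable_approximable af; have mg := cmeasurable_approximable ag.
have mLf := cmeasurable_opL af au; have mLg := cmeasurable_opL ag aug.
have mk1 := cintegrable_measurable mT (cintegrableMl k2pi%:C mT (cintegrableB mT
  c12 c34)).
have mk2 := cintegrable_measurable mT (cintegrableMl k2pi%:C mT (cintegrableB mT
  c12' c34)).
rewrite /inner -[LHS]/(Cint setT (fun x => opL c a b f x%:C * (g x%:C)^* * W x%:C)).
rewrite -[RHS]/(Cint setT (fun x => f x%:C * (opL c a b g x%:C)^* * W x%:C)).
(* The integrands agree with [I1] and [I2] off the real poles only, hence the passage through a
   negligible set. *)
rewrite (@Cint_ae R _ I1 pole_set (mI _ _ mLf mg) mk1 countable_pole_set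
  (fun x px => (@integrand_eq f g x px).1)).
by rewrite (@Cint_ae R _ I2 pole_set (mI _ _ mf mLg) mk2 countable_pole_set
  (fun x px => (@integrand_eq f g x px).2)).
Qed.

End Symmetry.

Theorem corollary2p3 (R : realType) (m n : nat) (c : R)
    (a : 'I_m -> R[i]) (b : 'I_n -> R[i])
    (ha : forall k : 'I_m, 0 < complex.Re (a k)) :
  symmetric_in_L2 (weight c a b) (spaceH c a b) (opL c a b).
Proof.
split=> [f|f g]; [exact: inL2_spaceH|exact: inner_spaceH].
Qed.
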